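(* Let $(M,\mathcal D,\mathbf g)$ be a sub-Riemannian structure with $\dim M=n$ and $\mathrm{rank}\,\mathcal D=k$, let $TM=\mathcal D\oplus\mathbf c$ be a splitting with $\mathbf c$ a complement, and let $\mu_{\mathbf c}=\{\mu_{\mathbf c_q}\}_{q\in M}$ be any adapted measure. Then the microscopic Laplacian $L_{\mu_{\mathbf c}}$, defined by $$(L_{\mu_{\mathbf c}}\phi)(q):=\lim_{t\to0^+}\frac{2k}{t^2}\left(\int_{C_q}\phi\big(\exp_q(t,\lambda)\big)\,\mu_{\mathbf c_q}(\lambda)-\phi(q)\right),$$ depends only on $\mathbf c$. Moreover, if $X_1,\dots,X_k$ is a local orthonormal frame for $\mathcal D$ and $X_{k+1},\dots,X_n$ a local frame for $\mathbf c$, then $$L_{\mu_{\mathbf c}}=\sum_{i=1}^kX_i^2+\sum_{i,j=1}^kc_{ji}^jX_i,$$ where the structural functions $c_{ij}^\ell\in C^\infty(M)$ are defined by $[X_i,X_j]=\sum_{\ell=1}^nc_{ij}^\ell X_\ell$ for all $i,j=1,\dots,n$. Finally, the convergence in the definition of $L_{\mu_{\mathbf c}}\phi$ is uniform on compact sets.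
   Context: A sub-Riemannian structure is a triple $(M,\mathcal D,\mathbf g)$ where $M$ is a smooth connected $n$-manifold, $\mathcal D\subset TM$ is a smooth distribution of constant rank $k<n$ satisfying the Hörmander (bracket-generating) condition, and $\mathbf g$ is a smooth scalar product on $\mathcal D$. The Hamiltonian $H:T^*M\to\mathbb R$ is $H(\lambda)=\frac12\sum_{i=1}^k\langle\lambda,X_i\rangle^2$ for any local orthonormal frame $X_1,\dots,X_k$ of $\mathcal D$. Let $C_q=\{\lambda\in T_q^*M: 2H(\lambda)=1\}$. For $\lambda\in T^*_qM$, $\exp_q(t,\lambda)=\pi(\lambda(t))$, where $\pi:T^*M\to M$ is the projection and $\lambda(t)$ is the integral curve of the Hamiltonian vector field of $H$ with $\lambda(0)=\lambda$. For each $q$ there is $\varepsilon>0$ such that $\exp_q(t,\lambda)$ is defined for all $t\in[0,\varepsilon)$ and $\lambda\in C_q$. A complement $\mathbf c$ is a smooth sub-bundle of $TM$ with $T_qM=\mathcal D_q\oplus\mathbf c_q$ for all $q$. Put $\mathbf h_q=\mathbf c_q^\perp$ and $\mathbf v_q=\mathcal D_q^\perp$ (annihilators in $T_q^*M$), so $T_q^*M=\mathbf h_q\oplus\mathbf v_q$, and $2H|_{\mathbf h_q}$ is a positive definite quadratic form. Let $\mathbb S_q^{k-1}=C_q\cap\mathbf h_q$ be its Euclidean unit sphere; then $C_q=\mathbb S_q^{k-1}\times\mathbf v_q$. A collection $\{\mu_{\mathbf c_q}\}_{q\in M}$ of probability measures on $C_q$ is an adapted measure if for every $q$, $\mu_{\mathbf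 c_q}=\mu_{\mathbb S_q^{k-1}}\times\mu_{\mathbf v_q}$, where $\mu_{\mathbb S^{k-1}_q}$ is the uniform probability measure on the Euclidean sphere $\mathbb S_q^{k-1}$ and $\mu_{\mathbf v_q}$ is a Borel probability measure on $\mathbf v_q$ that is $2$-decreasing (every linear function on $\mathbf v_q$ is in $L^2(\mathbf v_q,\mu_{\mathbf v_q})$), and moreover for every continuous, fiberwise linear $f:T^*M\to\mathbb R$ the map $q\mapsto\int_{C_q}f^2\,\mu_{\mathbf c_q}$ is continuous. Here $\phi\in C^\infty(M)$. Equiregularity is not assumed. *)

(* Defs.v *)
From HB Require Import structures.
From mathcomp Require Import all_boot all_order all_algebra.
From mathcomp Require Import all_classical all_reals all_analysis.
Set Implicit Arguments.
Unset Strict Implicit.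
Unset Printing Implicit Defensive.
Import Order.TTheory GRing.Theory Num.Theory.
Import numFieldNormedType.Exports.
Local Open Scope classical_set_scope.
Local Open Scope ring_scope.

Definition basis_vec {R : realType} {n : nat} (i : 'I_n) : 'rV[R]_n :=
  delta_mx ord0 i.

(* Continuous partial derivatives up to order [m] on [U].  Only meant for open
   [U]; the values of [f] outside [U] play no role then. *)
Fixpoint Ck {R : realType} {n : nat} (m : nat) (U : set 'rV[R]_n)
    (f : 'rV[R]_n -> R) : Prop :=
  (forall x, U x -> {for x, continuous f}) /\
  if m is m'.+1 then
    forall i : 'I_n,
      (forall x, U x -> derivable f x (basis_vec i)) /\
      Ck m' U (fun x => 'D_(basis_vec i) f x)
  else True.

Definition smooth_Rn {R : realType} {n : nat} (U : set 'rV[R]_n)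
    (f : 'rV[R]_n -> R) : Prop :=
  forall m, Ck m U f.

(* [cmap] is a homeomorphism from the open set [cdom] onto an open subset of
   R^n, with inverse [cinv]; both maps take arbitrary values elsewhere. *)
Record chart (R : realType) (n : nat) (M : topologicalType) := Chart {
  cdom : set M ;
  cmap :> M -> 'rV[R]_n ;
  cinv : 'rV[R]_n -> M ;
  cdom_open : open cdom ;
  cimg_open : open (cmap @` cdom) ;
  cmapK : forall q, cdom q -> cinv (cmap q) = q ;
  cmap_continuous : forall q, cdom q -> {for q, continuous cmap} ;
  cinv_continuous : forall q, cdom q -> {for cmap q, continuous cinv} }.

(* A preferred chart [chart_at q] is fixed around each point [q].  It only
   serves to represent T_qM and T*_qM by R^n, below. *)
Record manifold (R : realType) (n : nat) (M : topologicalType) := Manifold {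
  atlas : set (chart R n M) ;
  chart_at : M -> chart R n M ;
  chart_at_atlas : forall q, atlas (chart_at q) ;
  chart_at_dom : forall q, cdom (chart_at q) q ;
  transition_smooth : forall c c', atlas c -> atlas c' -> forall i,
    smooth_Rn (c @` (cdom c `&` cdom c')) (fun x => c' (cinv c x) ord0 i) ;
  manifold_hausdorff : hausdorff_space M ;
  manifold_second_countable : second_countable (T := M) ;
  manifold_connected : connected [set: M] }.

Section manifold_calculus.
Context {R : realType} {n : nat} {M : topologicalType} (A : manifold R n M).
Implicit Types (c : chart R n M) (q : M) (U : set M).

Definition smooth_on U (f : M -> R) : Prop :=
  forall c, atlas A c ->
    smooth_Rn (c @` (cdom c `&` U)) (fun x => f (cinv c x)).

(* Both T_qM and T*_qM are identified with 'rV_n, through the coordinate bases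
   d/dx_i and dx_i of the preferred chart at q.  A vector field on M, possibly
   only meaningful on an open set, is thus a map M -> 'rV_n. *)
Definition vfield := M -> 'rV[R]_n.

(* The coordinates in the chart [c] of the tangent vector [v] at [q]. *)
Definition tangent_coord c q (v : 'rV[R]_n) : 'rV[R]_n :=
  'D_v (fun x => c (cinv (chart_at A q) x)) (chart_at A q q).

(* The coordinate field d/dx_i of the chart [c], at [q]. *)
Definition coord_field c (i : 'I_n) q : 'rV[R]_n :=
  'D_(basis_vec i) (fun x => chart_at A q (cinv c x)) (c q).

Definition pairing (l v : 'rV[R]_n) : R := \sum_(i < n) l ord0 i * v ord0 i.

(* [covector c q p] is the covector sum_i p_i dx_i at [q], and
   [covector_coord c q] its inverse, for the coordinates x of the chart [c]. *)
Definition covector c q (p : 'rV[R]_n) : 'rV[R]_n :=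
  \row_j pairing p (tangent_coord c q (basis_vec j)).

Definition covector_coord c q (l : 'rV[R]_n) : 'rV[R]_n :=
  \row_i pairing l (coord_field c i q).

Definition smooth_vfield U (X : vfield) : Prop :=
  forall c, atlas A c -> forall i,
    smooth_Rn (c @` (cdom c `&` U))
      (fun x => tangent_coord c (cinv c x) (X (cinv c x)) ord0 i).

(* The function Xf. *)
Definition vderive (X : vfield) (f : M -> R) q : R :=
  'D_(X q) (fun x => f (cinv (chart_at A q) x)) (chart_at A q q).

(* [X, Y] = XY - YX, obtained at [q] by applying both sides to the coordinate
   functions of the preferred chart at [q]. *)
Definition lie_bracket (X Y : vfield) : vfield := fun q =>
  \row_l let x_l := fun p => chart_at A q p ord0 l in
         vderive X (vderive Y x_l) q - vderive Y (vderive X x_l) q.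

Definition bundle := M -> {vspace 'rV[R]_n}.

Definition local_frame {I : finType} (E : bundle) U (X : I -> vfield) : Prop :=
  [/\ open U, forall i, smooth_vfield U (X i) &
      forall q, U q -> basis_of (E q) [seq X i q | i : I]].

Definition smooth_subbundle (r : nat) (E : bundle) : Prop :=
  forall q, exists U (X : 'I_r -> vfield), U q /\ local_frame E U X.

Definition smooth_section (E : bundle) U (X : vfield) : Prop :=
  smooth_vfield U X /\ forall q, U q -> X q \in E q.

(* The iterated brackets of global smooth sections of E. *)
Inductive iterated_bracket (E : bundle) : vfield -> Prop :=
| IterSection X of smooth_section E setT X : iterated_bracket E X
| IterBracket X Y of iterated_bracket E X & iterated_bracket E Y :
    iterated_bracket E (lie_bracket X Y).

Definition bracket_generating (E : bundle) : Prop :=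
  forall q, exists m (Z : 'I_m -> vfield),
    (forall i, iterated_bracket E (Z i)) /\
    span [seq Z i q | i : 'I_m] = fullv.

End manifold_calculus.

(* [metric q] is only meaningful on [dist q]. *)
Record subriemannian (R : realType) (n : nat) (M : topologicalType)
    (A : manifold R n M) (k : nat) := SubRiemannian {
  rank_lt : (k < n)%N ;
  dist : bundle (R := R) (n := n) (M := M) ;
  dist_smooth : smooth_subbundle A k dist ;
  dist_hormander : bracket_generating A dist ;
  metric : M -> 'rV[R]_n -> 'rV[R]_n -> R ;
  metric_linear : forall q a u v w,
    u \in dist q -> v \in dist q -> w \in dist q ->
    metric q (a *: u + v) w = a * metric q u w + metric q v w ;
  metric_sym : forall q u v, u \in dist q -> v \in dist q ->
    metric q u v = metric q v u ;
  metric_pos : forall q u, u \in dist q -> u != 0 -> 0 < metric q u u ;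
  metric_smooth : forall (U : set M) X Y, open U ->
    smooth_section A dist U X -> smooth_section A dist U Y ->
    smooth_on A U (fun q => metric q (X q) (Y q)) }.

(* 'rV_n with the Borel sigma-algebra of its usual topology. *)
Notation borel_rV R n := (g_sigma_algebraType (@open 'rV[R]_n)).

Section microscopic_laplacian.
Context {R : realType} {n : nat} {M : topologicalType} {A : manifold R n M}
  {k : nat} (S : subriemannian A k).
Implicit Types (q : M) (cc : bundle (R := R) (n := n) (M := M)).

Definition orthonormal_frame {I : finType} (U : set M)
    (X : I -> vfield (R := R) (n := n) (M := M)) : Prop :=
  local_frame A (dist S) U X /\
  forall q, U q -> forall i j, metric S q (X i q) (X j q) = (i == j)%:R.

(* The value does not depend on the orthonormal frame chosen by [xget]. *)
Definition hamiltonian q (l : 'rV[R]_n) : R :=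
  xget 0 [set h | exists U (X : 'I_k -> vfield),
    [/\ orthonormal_frame U X, U q &
        h = 2^-1 * \sum_(i < k) pairing l (X i q) ^+ 2]].

(* H in the canonical coordinates (x, p) of T*M induced by the chart [c]. *)
Definition hamiltonian_coord (c : chart R n M) (x p : 'rV[R]_n) : R :=
  hamiltonian (cinv c x) (covector A c (cinv c x) p).

(* The curve t |-> (x t, l t) of T*M satisfies Hamilton's equations on ]a, b[,
   in the canonical coordinates of every chart of the atlas. *)
Definition hamiltonian_curve (a b : R) (x : R -> M) (l : R -> 'rV[R]_n) :
    Prop :=
  forall t, a < t < b ->
    {for t, continuous x} /\
    forall c, atlas A c -> cdom c (x t) -> forall i,
      let xt := c (x t) in
      let pt := covector_coord A c (x t) (l t) in
      is_derive t 1 (fun s => c (x s) ord0 i)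
        ('D_(basis_vec i) (fun p => hamiltonian_coord c xt p) pt) /\
      is_derive t 1 (fun s => covector_coord A c (x s) (l s) ord0 i)
        (- 'D_(basis_vec i) (fun y => hamiltonian_coord c y pt) xt).

(* exp_q(t, l), with default value [q] where it is undefined. *)
Definition sr_exp q (t : R) (l : 'rV[R]_n) : M :=
  xget q [set y | exists a b x p,
    [/\ a < 0 < b, a < t < b, hamiltonian_curve a b x p,
        x 0 = q /\ p 0 = l & y = x t]].

Definition is_complement cc : Prop :=
  smooth_subbundle A (n - k) cc /\
  forall q, (dist S q + cc q = fullv)%VS /\ (dist S q :&: cc q = 0)%VS.

Definition annihilator (V : {vspace 'rV[R]_n}) : set 'rV[R]_n :=
  [set l | forall v, v \in V -> pairing l v = 0].

Definition cosphere q : set 'rV[R]_n := [set l | 2 * hamiltonian q l = 1].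

Definition hor cc q : set 'rV[R]_n := annihilator (cc q).

Definition ver q : set 'rV[R]_n := annihilator (dist S q).

(* The Borel probability measure carried by the Euclidean unit sphere of
   (h_q, 2H) and invariant under all linear isometries of (h_q, 2H). *)
Definition uniform_on_sphere cc q (mu : probability (borel_rV R n) R) : Prop :=
  mu (cosphere q `&` hor cc q) = 1%E /\
  forall f : {linear 'rV[R]_n -> 'rV[R]_n},
    (forall l, hor cc q l ->
       hor cc q (f l) /\ hamiltonian q (f l) = hamiltonian q l) ->
    forall B : set (borel_rV R n), measurable B -> mu (f @^-1` B) = mu B.

(* Every linear function on v_q is the restriction of one on T*_qM. *)
Definition two_decreasing q (mu : probability (borel_rV R n) R) : Prop :=
  forall f : 'rV[R]_n -> R, scalar f ->
    mu.-integrable (ver q : set (borel_rV R n))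
      (fun l : borel_rV R n => (f l ^+ 2)%:E).

Definition continuous_fiberwise_linear (f : M -> 'rV[R]_n -> R) : Prop :=
  (forall q, scalar (f q)) /\
  forall c, atlas A c -> forall q (p : 'rV[R]_n), cdom c q ->
    {for (c q, p), continuous (fun z : 'rV[R]_n * 'rV[R]_n =>
       f (cinv c z.1) (covector A c (cinv c z.1) z.2))}.

(* The decomposition C_q = S_q x v_q is (s, v) |-> s + v, so the product
   measure on C_q is the image of muS x muV under addition. *)
Definition adapted cc (mu : M -> probability (borel_rV R n) R) : Prop :=
  (forall q, exists muS muV : probability (borel_rV R n) R,
     [/\ uniform_on_sphere cc q muS, muV (ver q) = 1%E, two_decreasing q muV &
      forall B : set (borel_rV R n), measurable B ->
        mu q B = (muS \x muV)%E
          [set z | B ((z.1 : 'rV[R]_n) + (z.2 : 'rV[R]_n))]]) /\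
  forall f, continuous_fiberwise_linear f ->
    continuous (fun q => \int[mu q]_(l in cosphere q) (f q l ^+ 2)%:E)%E.

Definition laplacian_quotient (mu : M -> probability (borel_rV R n) R)
    (phi : M -> R) (t : R) q : R :=
  2 * k%:R / t ^+ 2 *
  (\int[mu q]_(l in cosphere q) phi (sr_exp q t l) - phi q).

Definition microscopic_laplacian (mu : M -> probability (borel_rV R n) R)
    (phi : M -> R) q : R :=
  lim (laplacian_quotient mu phi t q @[t --> 0^'+]).

End microscopic_laplacian.

(* Main.v *)
Require Import Defs.
From HB Require Import structures.
From mathcomp Require Import all_boot all_order all_algebra.
From mathcomp Require Import all_classical all_reals all_analysis.
From mathcomp Require Import perm measurable_realfun.
From mathcomp Require Import ring lra.
Set Implicit Arguments.
Unset Strict Implicit.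
Unset Printing Implicit Defensive.
Import Order.TTheory GRing.Theory Num.Theory.
Import numFieldNormedType.Exports.
Local Open Scope classical_set_scope.
Local Open Scope ring_scope.

(** Let [h_i(l) = <l, X_i>] be the components of a covector [l] in a local
    orthonormal frame of the distribution, so that [2 H = sum_i h_i^2].  The
    Hamiltonian curve [l(t)] projects to a curve with velocity [sum_i h_i X_i],
    and the derivative of [<l, W>] along it is [sum_j h_j <l, [X_j, W]>] for
    every field [W].  Hence
    [phi(exp_q(t, l)) = phi(q) + t F1(l) + t^2/2 F2(l) + O(t^3)] with
    [F1 = sum_i h_i X_i phi] and
    [F2 = sum_ij h_i h_j X_j X_i phi + sum_ij h_j <l, [X_j, X_i]> X_i phi].

    The mean of [h_j] vanishes and that of [h_j <l, w>] is [w_j / k], where [w_j]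
    is the coefficient of [X_j] in the projection of [w] on the distribution
    along the complement: the vertical part of [l] is independent of the
    horizontal part, which has mean zero, and the moments of the uniform measure
    of the sphere are determined by its invariance under the reflections and
    transpositions of the dual basis ([sphere_mean], [sphere_covariance],
    [adapted_covariance]).  Therefore [F1] has mean zero, and [k] times the mean
    of [F2] is [sum_i X_i^2 phi + sum_ij c_ji^j X_i phi].  This is the limit of
    the difference quotient; the only trace of the measure that it keeps is the
    projection along the complement ([expectation_flow_derive2],
    [chart_laplacian_frame]).

    The covectors of [C_q] are unbounded, so that the remainder has to be
    controlled uniformly.  On the unit energy level [|h_i| <= 1]: the velocity
    is bounded and the curves remain in a chart for a time independent of [l]
    ([hamiltonian_curve_arc]).  The equation of the momentum is linear in the
    momentum with bounded coefficients, and each derivative along the flow costs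
    at most one power of [|l|].  As [F2] is affine in [l] with bounded
    coefficients involving the [h_i], the remainder is [O(t^3 (1 + |l|)^2)]
    ([exp_taylor]).  The mean of [|l|^2] is finite, and locally bounded in [q]:
    multiplied by a bump function, the coordinates of covectors become continuous
    fiberwise linear functions, whose second moments are continuous
    ([moment_coord_bound]).  Near each point the difference quotient is thus
    within [O(t)] of its limit ([local_estimate]), and compactness gives the
    uniform convergence.

    The existence of the Hamiltonian curves for a time independent of [l] rests
    on Picard iteration for a truncated equation ([hamiltonian_flow_exists]).
    The estimates hold for every Hamiltonian curve issued from [l], in particular
    for the one selected in the definition of the exponential map, and the mean
    over [C_q] is evaluated by monotonicity, between the means of polynomials in
    [l] ([Rintegral_sandwich]). *)

(** * Partial derivatives and differentiability *)

(** Locked, since unification would otherwise unfold iterated partial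
    derivatives down to limits. *)
HB.lock Definition pd {R : realType} {n : nat} (i : 'I_n)
  (f : 'rV[R]_n -> R) (x : 'rV[R]_n) : R := 'D_(basis_vec i) f x.

Lemma pdE {R : realType} {n : nat} (i : 'I_n) (f : 'rV[R]_n -> R) :
  pd i f = (fun x => 'D_(basis_vec i) f x).
Proof. by apply/funext => x; rewrite pd.unlock. Qed.

Lemma pd_derive {R : realType} {n : nat} (i : 'I_n) (f : 'rV[R]_n -> R) x :
  pd i f x = 'D_(basis_vec i) f x.
Proof. by rewrite pdE. Qed.

Lemma CkS {R : realType} {n : nat} m (U : set 'rV[R]_n) (f : 'rV[R]_n -> R) :
  Ck m.+1 U f <-> (forall x, U x -> {for x, continuous f}) /\
    forall i, (forall x, U x -> derivable f x (basis_vec i)) /\ Ck m U (pd i f).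
Proof.
by split=> -[cf hf]; split=> // i; have := hf i; rewrite pdE.
Qed.

Lemma cvg_sumR {R : realType} (T : Type) (F : set_system T) {FF : Filter F}
    (I : Type) (r : seq I) (P : pred I) (f : I -> T -> R) (l : I -> R) :
  (forall i, P i -> f i x @[x --> F] --> l i) ->
  (\sum_(i <- r | P i) f i x) @[x --> F] --> \sum_(i <- r | P i) l i.
Proof.
move=> h; elim: r => [|i r IH].
  by rewrite big_nil; under eq_cvg do rewrite big_nil; exact: cvg_cst.
rewrite big_cons; under eq_cvg do rewrite big_cons.
by case: ifP => // Pi; apply: cvgD => //; exact: h.
Qed.

Section coordinates.
Context {R : realType} {n : nat}.
Implicit Types (f g : 'rV[R]_n -> R) (U : set 'rV[R]_n) (x y v : 'rV[R]_n).

Lemma coord_norm_le v i : `|v ord0 i| <= `|v|.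
Proof.
rewrite [leRHS]/Num.Def.normr /= mx_normrE; apply/bigmax_geP; right => /=.
by exists (ord0, i).
Qed.

Lemma rV_norm_le v e : 0 <= e -> (forall i, `|v ord0 i| <= e) -> `|v| <= e.
Proof.
move=> e0 h; rewrite [leLHS]/Num.Def.normr /= mx_normrE; apply/bigmax_leP; split=> //.
by move=> [i j] _ /=; rewrite ord1.
Qed.

Lemma basis_vecE (i j : 'I_n) : (basis_vec i : 'rV[R]_n) ord0 j = (j == i)%:R.
Proof. by rewrite /basis_vec mxE eqxx. Qed.

Lemma differentiable_rV m (g : 'rV[R]_n -> 'rV[R]_m) x :
  (forall i, differentiable (fun y => g y ord0 i) x) -> differentiable g x.
Proof.
move=> h.
have -> : g = \sum_(i < m) (fun y => g y ord0 i *: (delta_mx ord0 i : 'rV[R]_m)).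
  by apply/funext => y; rewrite fct_sumE {1}(row_sum_delta (g y)).
apply: differentiable_sum => i; apply: differentiableZl; exact: h.
Qed.

Lemma derive_pd f x v : differentiable f x ->
  'D_v f x = \sum_i v ord0 i * pd i f x.
Proof.
move=> df; rewrite deriveE // {1}(row_sum_delta v) linear_sum /=.
by apply: eq_bigr => i _; rewrite linearZ /= pdE deriveE.
Qed.

Lemma is_derive_curve (c : R -> 'rV[R]_n) (v : 'I_n -> R) (t : R) f :
  (forall i, is_derive t 1 (fun s => c s ord0 i) (v i)) ->
  differentiable f (c t) ->
  is_derive t 1 (f \o c) (\sum_i v i * pd i f (c t)).
Proof.
move=> hc df.
have dc : derivable c t 1.
  by apply/derivable_mxP => i j; rewrite ord1; have [] := hc j.
have dc' : differentiable c t by apply/derivable1_diffP.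
have dfc : differentiable (f \o c) t by apply: differentiable_comp.
apply: DeriveDef; first exact/derivable1_diffP.
rewrite deriveE // diff_comp //= -(deriveE _ dc') -(deriveE _ df) derive_pd //.
apply: eq_bigr => i _; congr (_ * _).
by rewrite derive_mx // mxE; case: (hc i).
Qed.

End coordinates.

Section composition.
Context {R : realType} {n : nat}.
Implicit Types (f g : 'rV[R]_n -> R) (U : set 'rV[R]_n) (x y v : 'rV[R]_n).

Lemma derive_comp_rV m (g : 'rV[R]_n -> 'rV[R]_m) (f : 'rV[R]_m -> R) x v :
  (forall i, differentiable (fun y => g y ord0 i) x) ->
  differentiable f (g x) ->
  'D_v (f \o g) x = \sum_i 'D_v (fun y => g y ord0 i) x * pd i f (g x).
Proof.
move=> dg df; have dg' := differentiable_rV dg.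
rewrite deriveE; last exact: differentiable_comp.
rewrite diff_comp //= -(deriveE _ dg') -(deriveE _ df) derive_pd //.
apply: eq_bigr => i _; congr (_ * _).
by rewrite derive_mx ?mxE //; apply: diff_derivable.
Qed.

Lemma pd_eq_near f g x i : (\near x, f x = g x) -> pd i f x = pd i g x.
Proof. by move=> fg; rewrite !pdE; exact: near_eq_derive. Qed.

Lemma is_derive_line f x (i : 'I_n) s :
  derivable f (s *: basis_vec i + x) (basis_vec i) ->
  is_derive s 1 (fun u : R => f (u *: basis_vec i + x)) (pd i f (s *: basis_vec i + x)).
Proof.
move=> df.
have E : (fun h : R => h^-1 *: (f ((h *: (1 : R) + s) *: basis_vec i + x)
    - f (s *: basis_vec i + x))) =
   (fun h : R => h^-1 *: (f (h *: basis_vec i + (s *: basis_vec i + x))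
    - f (s *: basis_vec i + x))).
  by apply/funext => h; rewrite scalerDl addrA [h *: 1]mulr1.
apply: DeriveDef; rewrite ?pdE /derivable /derive /=.
  by rewrite E.
by rewrite E.
Qed.

Lemma is_derive_of_line f x v (d : R) :
  is_derive (0 : R) 1 (fun u : R => f (u *: v + x)) d -> is_derive x v f d.
Proof.
move=> [h1 h2]; apply: DeriveDef; first exact: (proj2 (derivable1P f x v) h1).
rewrite -h2 /derive /=.
suff -> : (fun h : R => h^-1 *: (f (h *: v + x) - f x)) =
  (fun h : R => h^-1 *: (f ((h *: (1 : R) + 0) *: v + x) - f (0 *: v + x))) by [].
by apply/funext => h; rewrite scale0r add0r addr0 [h *: 1]mulr1.
Qed.

Lemma MVT_line f x (i : 'I_n) (s : R) :
  (forall u, `|u| <= `|s| -> derivable f (u *: basis_vec i + x) (basis_vec i)) ->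
  exists2 u, `|u| <= `|s| &
    f (s *: basis_vec i + x) - f x = s * pd i f (u *: basis_vec i + x).
Proof.
move=> df.
have fx : f x = f (0 *: basis_vec i + x) by rewrite scale0r add0r.
have cont (a b : R) : (forall u, u \in `[a, b] -> `|u| <= `|s|) ->
    {within `[a, b], continuous (fun u : R => f (u *: basis_vec i + x))}.
  move=> hab; apply: derivable_within_continuous => u uab.
  by have [] := is_derive_line (df u (hab u uab)).
have [s0|s0] := leP 0 s.
  have hs u : u \in `[0, s] -> `|u| <= `|s|.
    by rewrite in_itv /= => /andP[u0 us]; rewrite !ger0_norm.
  have [u us E] := @MVT_segment R (fun u => f (u *: basis_vec i + x))
    (fun u => pd i f (u *: basis_vec i + x)) 0 s s0
    (fun u us => is_derive_line (df u (hs u (subset_itv_oo_cc us)))) (cont _ _ hs).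
  by exists u; [exact: hs | rewrite {1}fx E subr0 mulrC].
have hs u : u \in `[s, 0] -> `|u| <= `|s|.
  rewrite in_itv /= => /andP[u0 us]; rewrite !ler0_norm ?lerN2 // ltW //.
have [u us E] := @MVT_segment R (fun u => f (u *: basis_vec i + x))
  (fun u => pd i f (u *: basis_vec i + x)) s 0 (ltW s0)
  (fun u us => is_derive_line (df u (hs u (subset_itv_oo_cc us)))) (cont _ _ hs).
exists u; first exact: hs.
apply: oppr_inj; rewrite opprB {1}fx E sub0r mulrN mulrC //.
Qed.

End composition.

Section differentiability.
Context {R : realType} {n : nat}.
Implicit Types (f g : 'rV[R]_n -> R) (U : set 'rV[R]_n) (x y v : 'rV[R]_n).

Let trunc_row (h : 'rV[R]_n) (j : nat) : 'rV[R]_n :=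
  \row_i (if (i < j)%N then h ord0 i else 0).

Let trunc_rowS h (j : 'I_n) :
  trunc_row h j.+1 = h ord0 j *: basis_vec j + trunc_row h j.
Proof.
apply/rowP => i; rewrite !mxE eqxx ltnS leq_eqVlt.
have [->|ne] /= := eqVneq i j; first by rewrite eqxx mulr1 ltnn addr0.
have -> : (i == j :> nat) = false by apply/negbTE; exact: ne.
by rewrite mulr0 add0r.
Qed.

(** The increment of [f] is the sum of its increments along the edges of a
    path parallel to the axes; the mean value theorem on each edge compares it
    with the linear form given by the partial derivatives at [x]. *)
Lemma C1_differentiable U f x : open U -> Ck 1 U f -> U x -> differentiable f x.
Proof.
move=> oU /CkS[cf hf] Ux.
pose L (v : 'rV[R]_n) := \sum_i v ord0 i * pd i f x.
have Llin : linear L.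
  move=> a u v; rewrite /L scaler_sumr -big_split /=; apply: eq_bigr => i _.
  by rewrite !mxE mulrDl [a *: _]mulrA.
pose LL : {linear 'rV[R]_n -> R} :=
  HB.pack L (GRing.isLinear.Build _ _ _ _ L Llin).
have Lcont : continuous LL.
  move=> v; apply: (@cvg_sumR _ _ (nbhs v) (nbhs_filter v)) => i _.
  by apply: cvgMl; exact: coord_continuous.
suff key : f \o shift x = cst (f x) + LL +o_ (0 : 'rV[R]_n) id.
  have E := diff_unique Lcont key.
  by apply/diff_locallyP; rewrite E.
apply/eqaddoP => e e0.
(* [n.+1] rather than [n], which may vanish *)
have e1 : 0 < e / n.+1%:R by rewrite divr_gt0.
have : \forall y \near x, U y /\ forall i, `|pd i f x - pd i f y| <= e / n.+1%:R.
  have h : \forall y \near x, forall i, `|pd i f x - pd i f y| <= e / n.+1%:R.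
    apply: (@filter_forall _ _ (fun i y => `|pd i f x - pd i f y| <= e / n.+1%:R) (nbhs x)) => i.
    by have [_ [/(_ x Ux) + _]] := hf i => /cvgrPdist_le /(_ _ e1).
  by near=> y; split; near: y => //; exact: open_nbhs_nbhs.
move=> /nbhs_ballP [d /= d0 hd].
near=> h.
have hlt : `|h| < d.
  near: h; apply/nbhs_ballP; exists d => //= y.
  by rewrite -ball_normE /= sub0r normrN.
have tr_le v i : (forall j, `|v ord0 j| <= `|h ord0 j|) -> `|v ord0 i| <= `|h|.
  by move=> hv; apply: le_trans (hv i) (coord_norm_le _ _).
have inball v : (forall j, `|v ord0 j| <= `|h ord0 j|) -> ball x d (v + x).
  move=> hv; rewrite -ball_normE /= opprD addrCA subrr addr0 normrN.
  by apply: le_lt_trans hlt; apply: rV_norm_le => // i; exact: tr_le.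
rewrite [X in `|X|](_ : _ = \sum_(j < n) (f (trunc_row h j.+1 + x) - f (trunc_row h j + x)
                 - h ord0 j * pd j f x)); last first.
  rewrite big_split /= sumrN addrC.
  rewrite -(big_mkord xpredT (fun j => f (trunc_row h j.+1 + x) - f (trunc_row h j + x))).
  rewrite telescope_sumr // /shift /=.
  have -> : trunc_row h n = h by apply/rowP => i; rewrite mxE ltn_ord.
  have -> : trunc_row h 0 = 0 by apply/rowP => i; rewrite !mxE.
  by rewrite add0r [in LHS]opprD addrA addrC.
apply: le_trans (ler_norm_sum _ _ _) _.
have step (j : 'I_n) : `|f (trunc_row h j.+1 + x) - f (trunc_row h j + x)
                 - h ord0 j * pd j f x| <= `|h| * (e / n.+1%:R).
  have edge u : `|u| <= `|h ord0 j| ->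
      ball x d (u *: basis_vec j + (trunc_row h j + x)).
    move=> uh; rewrite addrA; apply: inball => k.
    rewrite !mxE eqxx /=; have [->|ne] := eqVneq k j.
      by rewrite ltnn mulr1 addr0.
    by rewrite mulr0 add0r; case: ifP => // _; rewrite normr0.
  have [|u uh E] := @MVT_line R n f (trunc_row h j + x) j (h ord0 j).
    move=> u uh; have [Uu _] := hd _ (edge u uh).
    by have [+ _] := hf j; exact.
  rewrite trunc_rowS -[_ *: _ + _ + x]addrA E -mulrBr normrM; apply: ler_pM => //.
    exact: coord_norm_le.
  by have [_ /(_ j)] := hd _ (edge u uh); rewrite distrC.
apply: le_trans (ler_sum _ (fun j _ => step j)) _.
have -> : e * `|id h| = \sum_(i < n.+1) `|h| * (e / n.+1%:R).
  rewrite sumr_const card_ord -mulrnAr -[_ *+ n.+1]mulr_natr divfK //.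
  by rewrite mulrC.
by rewrite big_ord_recr /= lerDl mulr_ge0 // ltW.
Unshelve. all: by end_near. Qed.

(** Both mixed derivatives are limits of the same second difference quotient. *)
Lemma pd_comm U f x i j : open U -> Ck 2 U f -> U x ->
  pd i (pd j f) x = pd j (pd i f) x.
Proof.
move=> oU /CkS[cf hf] Ux.
have [dfi /CkS[_ cij]] := hf i.
have [dfj /CkS[_ cji]] := hf j.
have [dij [cfij _]] := cij j.
have [dji [cfji _]] := cji i.
apply/eqP; rewrite -subr_eq0 -normr_le0; apply/ler_addgt0Pl => e e0.
rewrite addr0.
have e2 : 0 < e / 2 by rewrite divr_gt0.
have : \forall y \near x, [/\ U y, `|pd i (pd j f) x - pd i (pd j f) y| <= e / 2
     & `|pd j (pd i f) x - pd j (pd i f) y| <= e / 2].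
  have h1 : \forall y \near x, `|pd i (pd j f) x - pd i (pd j f) y| <= e / 2.
    by move: (cfji x Ux) => /cvgrPdist_le /(_ _ e2).
  have h2 : \forall y \near x, `|pd j (pd i f) x - pd j (pd i f) y| <= e / 2.
    by move: (cfij x Ux) => /cvgrPdist_le /(_ _ e2).
  have h3 : \forall y \near x, U y by exact: open_nbhs_nbhs.
  by move: h3 h1 h2; apply: filterS3 => y hy1 hy2 hy3; split.
move=> /nbhs_ballP [d /= d0 hd].
pose s := d / 3.
have s0 : 0 < s by rewrite divr_gt0.
have inb (k l : 'I_n) a b : `|a| <= `|s| -> `|b| <= `|s| ->
    ball x d (a *: basis_vec k + (b *: basis_vec l + x)).
  move=> ha hb; rewrite -ball_normE /= addrA opprD addrCA subrr addr0 normrN.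
  apply: (@le_lt_trans _ _ (s + s)); last by rewrite /s; lra.
  apply: rV_norm_le; first by rewrite addr_ge0 // ltW.
  move=> m; rewrite mxE; apply: le_trans (ler_normD _ _) _.
  have le1 (c : R) (t : bool) : `|c * t%:R| <= `|c|.
    by case: t; rewrite ?mulr1 ?mulr0 ?normr0.
  rewrite !mxE eqxx /= -[s]gtr0_norm //.
  by apply: lerD; apply: le_trans (le1 _ _) _.
have inb1 (k l : 'I_n) a b : `|a| <= `|s| -> `|b| <= `|s| ->
    U (a *: basis_vec k + (b *: basis_vec l + x)).
  by move=> ha hb; have [] := hd _ (inb k l a b ha hb).
have n0 : `|0 : R| <= `|s| by rewrite normr0.
(* two applications of the mean value theorem to the second difference *)
have second (k l : 'I_n) :
   (forall y, U y -> derivable f y (basis_vec k)) ->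
   (forall y, U y -> derivable (pd k f) y (basis_vec l)) ->
   exists2 y, ball x d y &
    f (s *: basis_vec k + (s *: basis_vec l + x)) - f (s *: basis_vec k + x)
     - (f (s *: basis_vec l + x) - f x) = s * s * pd l (pd k f) y.
  move=> dk dkl.
  pose g y := f (s *: basis_vec l + y) - f y.
  have shift_der (y : 'rV[R]_n) : derivable f (s *: basis_vec l + y) (basis_vec k) ->
      derivable (fun z => f (s *: basis_vec l + z)) y (basis_vec k) /\
      'D_(basis_vec k) (fun z => f (s *: basis_vec l + z)) y =
      'D_(basis_vec k) f (s *: basis_vec l + y).
    move=> df.
    have E : (fun h : R => h^-1 *: (f (s *: basis_vec l + (h *: basis_vec k + y))
        - f (s *: basis_vec l + y))) =
      (fun h : R => h^-1 *: (f (h *: basis_vec k + (s *: basis_vec l + y))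
        - f (s *: basis_vec l + y))).
      by apply/funext => h; rewrite addrCA.
    by rewrite /derivable /derive /= E.
  have [|u us E] := @MVT_line R n g x k s.
    move=> u us; apply: derivableB.
      apply: (shift_der _ _).1; apply: dk.
      by rewrite addrCA; apply: inb1.
    by apply: dk; have := inb1 k l u 0 us n0; rewrite scale0r add0r.
  have [|w ws E'] := @MVT_line R n (pd k f) (u *: basis_vec k + x) l s.
    by move=> w ws; apply: dkl; apply: inb1.
  exists (w *: basis_vec l + (u *: basis_vec k + x)); first exact: inb.
  have -> : f (s *: basis_vec k + (s *: basis_vec l + x)) - f (s *: basis_vec k + x)
     - (f (s *: basis_vec l + x) - f x) = g (s *: basis_vec k + x) - g x.
    by rewrite /g addrCA.
  rewrite E -mulrA -E'; congr (_ * _).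
  have dku : derivable f (s *: basis_vec l + (u *: basis_vec k + x)) (basis_vec k).
    by apply: dk; apply: inb1.
  rewrite !pdE /g deriveB; first by rewrite (shift_der _ dku).2.
    exact: (shift_der _ dku).1.
  by apply: dk; have := inb1 k l u 0 us n0; rewrite scale0r add0r.
have [y yb Ey] := second j i dfj dji.
have [z zb Ez] := second i j dfi dij.
have [_ hy _] := hd _ yb; have [_ _ hz] := hd _ zb.
have EE : pd i (pd j f) y = pd j (pd i f) z.
  have ss : s * s != 0 by rewrite mulf_neq0 // gt_eqF.
  apply: (mulfI ss); rewrite -Ey -Ez [s *: basis_vec j + _]addrCA.
  by ring.
rewrite -(subrKA (pd i (pd j f) y)); apply: le_trans (ler_normD _ _) _.
rewrite [e]splitr; apply: lerD => //.
by rewrite EE distrC.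
Unshelve. all: by end_near. Qed.

End differentiability.

(** * Smooth functions on open sets of R^n *)

Section smooth_algebra.
Context {R : realType} {n : nat}.
Implicit Types (f g : 'rV[R]_n -> R) (U V : set 'rV[R]_n) (x y v : 'rV[R]_n).

Lemma Ck_continuous m U f x : Ck m U f -> U x -> {for x, continuous f}.
Proof. by case: m => [|m] [+ _]; exact. Qed.

Lemma Ck_derivable m U f x i : Ck m.+1 U f -> U x -> derivable f x (basis_vec i).
Proof. by move=> [_ /(_ i)[+ _]]; exact. Qed.

Lemma Ck_pd m U f i : Ck m.+1 U f -> Ck m U (pd i f).
Proof. by move=> /CkS[_ /(_ i)[]]. Qed.

Lemma Ck_le m U f : Ck m.+1 U f -> Ck m U f.
Proof.
elim: m f => [|m IH] f; first by move=> [cf _]; split.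
move=> /CkS[cf hf]; apply/CkS; split=> // i.
by have [df /IH] := hf i.
Qed.

Lemma Ck_sub m U V f : V `<=` U -> Ck m U f -> Ck m V f.
Proof.
move=> VU; elim: m f => [|m IH] f; first by move=> [cf _]; split=> // x /VU; exact: cf.
move=> /CkS[cf hf]; apply/CkS; split; first by move=> x /VU; exact: cf.
by move=> i; have [df ?] := hf i; split; [move=> x /VU; exact: df | exact: IH].
Qed.

Lemma open_near U (P : 'rV[R]_n -> Prop) x : open U -> U x ->
  (forall y, U y -> P y) -> \near x, P x.
Proof. by move=> oU Ux h; apply: filterS h _; exact: open_nbhs_nbhs. Qed.

Lemma near_continuous (T1 T2 : topologicalType) (f g : T1 -> T2) (a : T1) :
  (\near a, f a = g a) -> {for a, continuous f} -> {for a, continuous g}.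
Proof.
move=> fg cf; rewrite /prop_for /continuous_at -(nbhs_singleton fg).
apply: cvg_trans cf.
by apply: (@near_eq_cvg _ _ (nbhs a) (nbhs_filter a)); apply: filterS fg.
Qed.

Lemma Ck_eq m U f g : open U -> (forall x, U x -> f x = g x) ->
  Ck m U f -> Ck m U g.
Proof.
move=> oU; elim: m f g => [|m IH] f g fg.
  move=> [cf _]; split=> // x Ux; apply: near_continuous (cf x Ux).
  exact: (open_near oU Ux fg).
move=> /CkS[cf hf]; apply/CkS; split.
  move=> x Ux; apply: near_continuous (cf x Ux).
  exact: (open_near oU Ux fg).
move=> i; have [df hpd] := hf i; split.
  move=> x Ux; apply: near_eq_derivable (df x Ux).
  exact: (open_near oU Ux fg).
apply: IH hpd => x Ux; apply: pd_eq_near; exact: (open_near oU Ux fg).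
Qed.

Lemma Ck_cst m U (a : R) : Ck m U (fun=> a).
Proof.
elim: m a => [|m IH] a; first by split=> // x _; exact: cst_continuous.
apply/CkS; split=> [x _|i]; first exact: cst_continuous.
split=> [x _|]; first exact: derivable_cst.
suff -> : pd i (fun=> a : R) = (fun=> 0 : R) by exact: IH.
by apply/funext => x; rewrite pdE derive_cst.
Qed.

Lemma pdD i f g x : derivable f x (basis_vec i) -> derivable g x (basis_vec i) ->
  pd i (fun y => f y + g y) x = pd i f x + pd i g x.
Proof.
move=> df dg; have -> : (fun y => f y + g y) = f + g by exact/funext.
by rewrite {1}pdE deriveD // -!pd_derive.
Qed.

Lemma pdM i f g x : derivable f x (basis_vec i) -> derivable g x (basis_vec i) ->
  pd i (fun y => f y * g y) x = f x * pd i g x + g x * pd i f x.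
Proof.
move=> df dg; have -> : (fun y => f y * g y) = f * g by exact/funext.
rewrite !pd_derive. exact: (deriveM df dg).
Qed.

Lemma pdMl i f (a : R) x : derivable f x (basis_vec i) ->
  pd i (fun y => a * f y) x = a * pd i f x.
Proof. by move=> df; rewrite !pdE; exact: deriveZ. Qed.

Lemma pd_sum i (I : Type) (r : seq I) (P : pred I) (f : I -> 'rV[R]_n -> R) x :
  (forall j, P j -> derivable (f j) x (basis_vec i)) ->
  derivable (fun y => \sum_(j <- r | P j) f j y) x (basis_vec i) /\
  pd i (fun y => \sum_(j <- r | P j) f j y) x = \sum_(j <- r | P j) pd i (f j) x.
Proof.
move=> h; elim: r => [|j r [dr Er]].
  have -> : (fun y => \sum_(j <- [::] | P j) f j y) = cst 0.
    by apply/funext => y; rewrite big_nil.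
  rewrite big_nil.
  by rewrite pdE derive_cst; split=> //; exact: derivable_cst.
rewrite big_cons; case: ifP => Pj; last first.
  suff -> : (fun y => \sum_(j <- j :: r | P j) f j y) =
           (fun y => \sum_(j <- r | P j) f j y) by [].
  by apply/funext => y; rewrite big_cons Pj.
have -> : (fun y => \sum_(j <- j :: r | P j) f j y) =
          f j + (fun y => \sum_(j <- r | P j) f j y).
  by apply/funext => y; rewrite big_cons Pj.
have dj := h j Pj; split; first exact: derivableD.
by rewrite -Er pdE deriveD // -!pd_derive.
Qed.

Lemma Ck_add m U f g : open U -> Ck m U f -> Ck m U g ->
  Ck m U (fun x => f x + g x).
Proof.
move=> oU; elim: m f g => [|m IH] f g.
  by move=> [cf _] [cg _]; split=> // x Ux; exact: (continuousD (cf x Ux) (cg x Ux)).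
move=> /CkS[cf hf] /CkS[cg hg]; apply/CkS; split.
  by move=> x Ux; exact: (continuousD (cf x Ux) (cg x Ux)).
move=> i; have [df pf] := hf i; have [dg pg] := hg i; split.
  by move=> x Ux; apply: derivableD; [exact: df|exact: dg].
apply: Ck_eq (IH _ _ pf pg) => // x Ux.
by rewrite pdD //; [exact: df|exact: dg].
Qed.

Lemma Ck_mul m U f g : open U -> Ck m U f -> Ck m U g ->
  Ck m U (fun x => f x * g x).
Proof.
move=> oU; elim: m f g => [|m IH] f g.
  by move=> [cf _] [cg _]; split=> // x Ux; exact: (continuousM (cf x Ux) (cg x Ux)).
move=> Cf Cg; have /CkS[cf hf] := Cf; have /CkS[cg hg] := Cg; apply/CkS; split.
  by move=> x Ux; exact: (continuousM (cf x Ux) (cg x Ux)).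
move=> i; have [df pf] := hf i; have [dg pg] := hg i; split.
  by move=> x Ux; apply: derivableM; [exact: df|exact: dg].
apply: (@Ck_eq _ _ (fun x => f x * pd i g x + g x * pd i f x)) => //.
  by move=> x Ux; rewrite pdM //; [exact: df|exact: dg].
by apply: Ck_add => //; apply: IH => //; exact: Ck_le.
Qed.

Lemma Ck_opp m U f : open U -> Ck m U f -> Ck m U (fun x => - f x).
Proof.
move=> oU Cf; apply: (@Ck_eq _ _ (fun x => -1 * f x)) => //.
  by move=> x _; rewrite mulN1r.
by apply: Ck_mul => //; exact: Ck_cst.
Qed.

Lemma Ck_sum m U (I : Type) (r : seq I) (P : pred I) (f : I -> 'rV[R]_n -> R) :
  open U -> (forall j, P j -> Ck m U (f j)) ->
  Ck m U (fun x => \sum_(j <- r | P j) f j x).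
Proof.
move=> oU h; elim: r => [|j r IH].
  by apply: Ck_eq (Ck_cst m U 0) => // x _; rewrite big_nil.
case Pj : (P j); last by apply: Ck_eq IH => // x _; rewrite big_cons Pj.
by apply: Ck_eq (Ck_add oU (h j Pj) IH) => // x _; rewrite big_cons Pj.
Qed.

Lemma Ck_inv m U f : open U -> (forall x, U x -> f x != 0) -> Ck m U f ->
  Ck m U (fun x => (f x)^-1).
Proof.
move=> oU f0; elim: m => [|m IH].
  by move=> [cf _]; split=> // x Ux; exact: (continuousV (f0 x Ux) (cf x Ux)).
move=> Cf; have /CkS[cf hf] := Cf; apply/CkS; split.
  by move=> x Ux; exact: (continuousV (f0 x Ux) (cf x Ux)).
move=> i; have [df pf] := hf i; split.
  by move=> x Ux; apply: derivableV; [exact: f0|exact: df].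
have Ci := IH (Ck_le Cf).
apply: (@Ck_eq _ _ (fun x => - (((f x)^-1 * (f x)^-1) * pd i f x))) => //.
  move=> x Ux; rewrite !pdE deriveV; [|exact: f0|exact: df].
  by rewrite scaleNr expr2 invfM.
by apply: Ck_opp => //; apply: Ck_mul => //; apply: Ck_mul.
Qed.

Lemma Ck_sqrt m U f : open U -> (forall x, U x -> 0 < f x) -> Ck m U f ->
  Ck m U (fun x => Num.sqrt (f x)).
Proof.
move=> oU f0; elim: m => [|m IH].
  move=> [cf _]; split=> // x Ux; apply: (continuous_comp (cf x Ux)).
  exact: sqrt_continuous.
move=> Cf; have /CkS[cf hf] := Cf; apply/CkS; split.
  move=> x Ux; apply: (continuous_comp (cf x Ux)).
  exact: sqrt_continuous.
move=> i; have [df pf] := hf i.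
have der x : U x -> is_derive x (basis_vec i) (fun y => Num.sqrt (f y))
    ((2 * Num.sqrt (f x))^-1 * pd i f x).
  move=> Ux.
  apply: is_derive_of_line.
  have dl : is_derive (0 : R) 1 (fun u : R => f (u *: basis_vec i + x)) (pd i f x).
    have := @is_derive_line _ _ f x i 0; rewrite scale0r add0r.
    by apply; exact: df.
  have fx0 : f (0 *: basis_vec i + x) = f x by rewrite scale0r add0r.
  have ds : is_derive (f (0 *: basis_vec i + x)) 1 Num.sqrt (2 * Num.sqrt (f x))^-1.
    by rewrite fx0; apply: is_derive1_sqrt; exact: f0.
  exact: (@is_derive1_comp R Num.sqrt (fun u : R => f (u *: basis_vec i + x))).
split.
  by move=> x Ux; have [] := der x Ux.
have Cs := IH (Ck_le Cf).
apply: (@Ck_eq _ _ (fun x => (2 * Num.sqrt (f x))^-1 * pd i f x)) => //.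
  move=> x Ux; rewrite [RHS]pd_derive.
  by have D := der x Ux; rewrite (@derive_val _ _ _ _ _ _ _ D).
have C2 := Ck_mul oU (Ck_cst m U 2) Cs.
have n0 : forall x, U x -> 2 * Num.sqrt (f x) != 0.
  by move=> x Ux; rewrite mulf_neq0 ?gt_eqF ?sqrtr_gt0 ?f0.
exact: (Ck_mul oU (Ck_inv oU n0 C2) pf).
Qed.

End smooth_algebra.

(** * The mean value inequality and primitives *)

Section mean_value.
Context {R : realType}.
Implicit Types (f g : R -> R) (a b s t : R).

Lemma is_derive_continuous f s (d : R) : is_derive s 1 f d -> {for s, continuous f}.
Proof.
move=> [df _]; apply: differentiable_continuous; exact/derivable1_diffP.
Qed.

Lemma is_derive_mull (a : R) f s (d : R) :
  is_derive s 1 f d -> is_derive s 1 (fun u => a * f u) (a * d).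
Proof. by move=> h; exact: (is_deriveZ a h). Qed.

Lemma is_derive_add f g s (df dg : R) : is_derive s 1 f df -> is_derive s 1 g dg ->
  is_derive s 1 (fun u => f u + g u) (df + dg).
Proof. by move=> hf hg; exact: (is_deriveD hf hg). Qed.

Lemma is_derive_mul f g s (df dg : R) : is_derive s 1 f df -> is_derive s 1 g dg ->
  is_derive s 1 (fun u => f u * g u) (df * g s + f s * dg).
Proof.
move=> hf hg; apply: is_derive_eq (is_deriveM hf hg) _.
by rewrite [RHS]addrC [df * _]mulrC.
Qed.

Lemma is_derive_sumr (I : Type) (r : seq I) (P : pred I) (f : I -> R -> R)
    (df : I -> R) s :
  (forall i, P i -> is_derive s 1 (f i) (df i)) ->
  is_derive s 1 (fun u => \sum_(i <- r | P i) f i u) (\sum_(i <- r | P i) df i).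
Proof.
move=> h; elim: r => [|i r IH].
  have -> : (fun u => \sum_(i <- [::] | P i) f i u) = cst 0.
    by apply/funext => u; rewrite big_nil.
  by rewrite big_nil; exact: is_derive_cst.
rewrite big_cons; case: ifP => Pi; last first.
  have -> : (fun u => \sum_(i <- i :: r | P i) f i u) =
           (fun u => \sum_(i <- r | P i) f i u); last exact: IH.
  by apply/funext => u; rewrite big_cons Pi.
have -> : (fun u => \sum_(i <- i :: r | P i) f i u) =
         (fun u => f i u + \sum_(i <- r | P i) f i u).
  by apply/funext => u; rewrite big_cons Pi.
by apply: is_derive_add => //; exact: h.
Qed.

Lemma within_continuous f a b :
  (forall s, a <= s <= b -> {for s, continuous f}) ->
  {within `[a, b], continuous f}.
Proof.
move=> h; apply: continuous_in_subspaceT => s.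
by rewrite inE /= in_itv /=; exact: h.
Qed.

Lemma nonpos_derive_le f f' a b : a <= b ->
  (forall s, a <= s <= b -> is_derive s 1 f (f' s)) ->
  (forall s, a <= s <= b -> f' s <= 0) -> f b <= f a.
Proof.
move=> ab df f0.
have [s sab E] := @MVT_segment R f f' a b ab
  (fun s sab => df s (subset_itv_oo_cc sab))
  (within_continuous (fun s sab => is_derive_continuous (df s sab))).
by rewrite -subr_le0 E mulr_le0_ge0 ?subr_ge0 //; apply: f0; rewrite in_itv in sab.
Qed.

(** Both [g - f] and [g + f] have a nonnegative derivative. *)
Lemma mean_value_le f f' g g' a b : a <= b ->
  (forall s, a <= s <= b -> is_derive s 1 f (f' s)) ->
  (forall s, a <= s <= b -> is_derive s 1 g (g' s)) ->
  (forall s, a <= s <= b -> `|f' s| <= g' s) ->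
  `|f b - f a| <= g b - g a.
Proof.
move=> ab df dg fg.
have half (h h' : R -> R) : (forall s, a <= s <= b -> is_derive s 1 h (h' s)) ->
    (forall s, a <= s <= b -> h' s <= g' s) -> h b - h a <= g b - g a.
  move=> dh hg.
  have dgh s : a <= s <= b -> is_derive s 1 (g - h) (g' s - h' s).
    by move=> sab; apply: is_deriveB; [exact: dg|exact: dh].
  have [s sab E] := @MVT_segment R (g - h) (fun s => g' s - h' s) a b ab
    (fun s sab => dgh s (subset_itv_oo_cc sab))
    (within_continuous (fun s sab => is_derive_continuous (dgh s sab))).
  have E' : (g b - h b) - (g a - h a) = (g' s - h' s) * (b - a) := E.
  have : 0 <= (g b - h b) - (g a - h a).
    by rewrite E' mulr_ge0 ?subr_ge0 //; apply: hg; rewrite in_itv in sab.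
  by move=> H; lra.
rewrite ler_norml; apply/andP; split; last first.
  by apply: half df _ => s sab; rewrite (le_trans (ler_norm _)) // fg.
rewrite lerNl.
have : (- f) b - (- f) a <= g b - g a.
  apply: (half (- f) (fun s => - f' s)) => s sab; first exact/is_deriveN/df.
  by rewrite (le_trans _ (fg s sab)) // -normrN ler_norm.
by rewrite [(- f) b]/(- f b) [(- f) a]/(- f a) opprB opprK addrC.
Qed.

Lemma bounded_derive_lipschitz f f' (C : R) :
  (forall s, is_derive s 1 f (f' s)) -> (forall s, `|f' s| <= C) ->
  forall s t, `|f s - f t| <= C * `|s - t|.
Proof.
move=> df fC s t; wlog st : s t / t <= s => [hw|].
  by have [/hw//|/ltW/hw] := leP t s; rewrite distrC [`|s - t|]distrC.
rewrite [`|s - t|]ger0_norm ?subr_ge0 // mulrBr.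
have dC (u : R) : t <= u <= s -> is_derive u 1 (fun s : R => C * s) C.
  by move=> _; apply: is_derive_eq (is_derive_mull C (is_derive_id u (1 : R))) _; rewrite mulr1.
exact: (mean_value_le st (fun u _ => df u) dC (fun u _ => fC u)).
Qed.

Lemma lipschitz_continuous f (C : R) :
  (forall s t, `|f s - f t| <= C * `|s - t|) -> continuous f.
Proof.
move=> h s; apply/cvgrPdist_le => e e0.
have C0 : 0 <= C.
  by have := h 1 0; rewrite subr0 normr1 mulr1; apply: le_trans.
have C1 : 0 < C + 1 by rewrite ltr_wpDl.
apply/nbhs_ballP; exists (e / (C + 1)) => /=; first by rewrite divr_gt0.
move=> t; rewrite /ball /= => st; apply: le_trans (h s t) _.
apply: (@le_trans _ _ ((C + 1) * `|s - t|)).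
  by apply: ler_wpM2r => //; rewrite lerDl.
by rewrite -ler_pdivlMl // mulrC ltW.
Qed.

End mean_value.

Section primitive.
Context {R : realType}.
Local Notation mu := (@lebesgue_measure R).
Implicit Types (f : R -> R).

Definition primitive f (t : R) : R :=
  if 0 <= t then \int[mu]_(s in [set` Interval (BRight 0) (BRight t)]) f s
  else - \int[mu]_(s in [set` Interval (BRight t) (BRight 0)]) f s.

Let continuous_integrable f (a b : R) : continuous f ->
  mu.-integrable `[a, b] (EFin \o f).
Proof.
move=> cf; apply: continuous_compact_integrable; first exact: segment_compact.
exact: continuous_subspaceT.
Qed.

Let primitiveE f (a t : R) : continuous f -> a < 0 -> a < t ->
  primitive f t = \int[mu]_(s in `[a, t]) f s - \int[mu]_(s in `[a, 0]) f s.
Proof.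
move=> cf a0 at_; rewrite /primitive; case: leP => t0.
  rewrite Rintegral_itvB //; first exact: continuous_integrable.
    by rewrite bnd_simp ltW.
rewrite -(@Rintegral_itvB _ f (BLeft a) (BRight 0) t) ?opprB //.
- exact: continuous_integrable.
- by rewrite bnd_simp ltW.
- by rewrite bnd_simp ltW.
Qed.

Lemma primitive0 f : continuous f -> primitive f 0 = 0.
Proof.
by move=> cf; rewrite (@primitiveE f (-1)) ?subrr // ltrN10.
Qed.

Lemma is_derive_primitive f (t : R) : continuous f -> is_derive t 1 (primitive f) (f t).
Proof.
move=> cf; pose a := - (`|t| + 1).
have at_ : a < t.
  rewrite /a; have := ler_norm (- t); rewrite normrN => h; lra.
have a0 : a < 0 by rewrite /a oppr_lt0 ltr_pwDr.
have tt1 : t < t + 1 by rewrite ltrDl.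
have [dF F'] := continuous_FTC1_closed tt1 (continuous_integrable a (t + 1) cf)
  at_ (cf t).
apply: (@near_eq_is_derive _ _ _
  ((fun y => \int[mu]_(s in `[a, y]) f s) - cst (\int[mu]_(s in `[a, 0]) f s))).
  near=> y; rewrite (@primitiveE _ a) //; near: y; exact: lt_nbhsr.
rewrite -[f t]subr0; apply: is_deriveB.
by apply: (DeriveDef dF); rewrite -derive1E; exact: F'.
Unshelve. all: by end_near. Qed.

End primitive.

(** * Picard iteration *)

Lemma rV_subE {R : realType} {n : nat} (u v : 'rV[R]_n) i :
  (u - v) ord0 i = u ord0 i - v ord0 i.
Proof. by rewrite !mxE. Qed.

Section geometric.
Context {R : realType}.

Lemma ler_geometric (a b c : R) :
  (forall m : nat, a <= b + c / 2 ^+ m) -> a <= b.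
Proof.
move=> h; rewrite leNgt; apply/negP => ba.
have cvg0 : b + c * (2^-1) ^+ m @[m --> \oo] --> b.
  rewrite -[X in _ --> X]addr0; apply: cvgD; first exact: cvg_cst.
  rewrite -[X in _ --> X](mulr0 c); apply: cvgMr.
  by apply: cvg_expr; rewrite ger0_norm ?invr_ge0 // invf_lt1 // ltr1n.
have := @cvgr_ge R nat \oo _ _ b cvg0 a.
have : \forall m \near \oo, b + c * (2^-1) ^+ m < a.
  exact: (@cvgr_lt R nat \oo _ _ b cvg0 a ba).
move=> [m _ /(_ m (leqnn m)) /=]; rewrite exprVn => H _.
by have := h m; rewrite leNgt H.
Qed.

(** The intervals of centre [u m] and radius [2 * c / 2 ^+ m] are nested, and
    the limit is their common point. *)
Lemma geometric_limit (u : nat -> R) (c : R) : 0 <= c ->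
  (forall m, `|u m.+1 - u m| <= c / 2 ^+ m) ->
  exists l, forall m, `|u m - l| <= 2 * c / 2 ^+ m.
Proof.
move=> c0 hu.
pose e m := 2 * c / 2 ^+ m.
have e_ge0 m : 0 <= e m by rewrite !mulr_ge0 // invr_ge0 exprn_ge0.
have eS m : e m.+1 = c / 2 ^+ m.
  by rewrite /e exprS invfM mulrACA divff // mul1r.
have e2 m : e m = 2 * (c / 2 ^+ m) by rewrite /e mulrA.
have lo m : u m - e m <= u m.+1 - e m.+1.
  have := hu m; rewrite ler_norml eS e2 => /andP[h _]; lra.
have hi m : u m.+1 + e m.+1 <= u m + e m.
  have := hu m; rewrite ler_norml eS e2 => /andP[_ h]; lra.
have loD m j : u m - e m <= u (m + j)%N - e (m + j)%N.
  elim: j => [|j IH]; first by rewrite addn0.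
  by rewrite addnS; apply: le_trans IH (lo _).
have hiD m j : u (m + j)%N + e (m + j)%N <= u m + e m.
  elim: j => [|j IH]; first by rewrite addn0.
  by rewrite addnS; apply: le_trans (hi _) IH.
have cross m j : u m - e m <= u j + e j.
  apply: le_trans (loD m j) _; rewrite addnC; apply: le_trans (hiD j m).
  by have := e_ge0 (j + m)%N => h; lra.
pose A := [set x | exists m, x = u m - e m].
have A0 : A !=set0 by exists (u 0%N - e 0%N); exists 0%N.
exists (sup A) => m; rewrite -/(e m) ler_distlC; apply/andP; split.
  apply: (@ub_le_sup _ A); last by exists m.
  by exists (u 0%N + e 0%N) => _ [j ->]; exact: cross.
by apply: ge_sup => // _ [j ->]; exact: cross.
Qed.

End geometric.

Section picard.
Context {R : realType}.

Let expb (L c : R) (D D' : R -> R) (t : R) : 0 <= c -> 0 <= t ->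
  (forall s : R, is_derive s 1 D (D' s)) ->
  (forall s, `|D' s| <= 2 * L * c * expR (2 * L * `|s|)) -> D 0 = 0 ->
  `|D t| <= c * expR (2 * L * t).
Proof.
move=> c0 t0 dD bD D0.
have dg (s : R) : 0 <= s <= t -> is_derive s 1 (fun s => c * expR (2 * L * s))
    (2 * L * c * expR (2 * L * `|s|)).
  move=> /andP[s0 _]; rewrite (ger0_norm s0).
  have d1 : is_derive s 1 (fun s : R => 2 * L * s) (2 * L).
    by rewrite -[X in is_derive _ _ _ X]mulr1; apply: is_derive_mull; exact: is_derive_id.
  have d2 : is_derive s 1 (expR \o (fun s : R => 2 * L * s)) (expR (2 * L * s) * (2 * L)).
    exact: is_derive1_comp.
  by apply: is_derive_eq (is_derive_mull c d2) _; ring.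
have := @mean_value_le R D D' (fun s => c * expR (2 * L * s))
   (fun s => 2 * L * c * expR (2 * L * `|s|)) 0 t t0 (fun s _ => dD s) dg (fun s _ => bD s).
rewrite D0 subr0 => /le_trans; apply.
by rewrite lerBlDr lerDl mulr_ge0 // expR_ge0.
Qed.

(** Integration of the bound on the derivative from [0].  The weight
    [e^(2L|t|)] turns the Picard map into a contraction of factor [1/2] on the
    whole line. *)
Lemma derive_exp_bound (L c : R) (D D' : R -> R) (t : R) : 0 <= c ->
  (forall s : R, is_derive s 1 D (D' s)) ->
  (forall s, `|D' s| <= 2 * L * c * expR (2 * L * `|s|)) -> D 0 = 0 ->
  `|D t| <= c * expR (2 * L * `|t|).
Proof.
move=> c0 dD bD D0; case: (leP 0 t) => t0.
  by rewrite (ger0_norm t0); exact: (expb c0 t0 dD bD D0).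
rewrite (ltr0_norm t0) -[t in D t]opprK.
have t0' : 0 <= - t by rewrite oppr_ge0 ltW.
apply: (@expb L c (fun s => D (- s)) (fun s => - D' (- s)) (- t) c0 t0').
- move=> s.
  have d1 : is_derive s 1 (fun s : R => - s) (- 1) by exact: is_deriveN.
  have := @is_derive1_comp R D (fun s : R => - s) s _ _ (dD (- s)) d1.
  by rewrite mulrN1.
- by move=> s; rewrite normrN -[in leRHS]normrN; exact: bD.
- by rewrite oppr0.
Qed.

(** Picard iteration on the whole time axis: in the norm weighted by
    [e^(-2L|t|)] the successive iterates are at distance at most [K / 2^m], so
    that they converge geometrically.  The bound on [F] makes the iterates, and
    then their limit, Lipschitz in time. *)
Lemma lipschitz_flow N (F : 'rV[R]_N -> 'rV[R]_N) (L B : R) (z0 : 'rV[R]_N) :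
  0 < L ->
  (forall y z i, `|F y ord0 i - F z ord0 i| <= L * `|y - z|) ->
  (forall y i, `|F y ord0 i| <= B) ->
  exists2 y : R -> 'rV[R]_N, y 0 = z0 &
    forall (t : R) i, is_derive t 1 (fun s => y s ord0 i) (F (y t) ord0 i).
Proof.
move=> L0; case: N F z0 => [|N] F z0 FL FB; first by exists (fun=> z0) => // t [].
pose pic := fix pic m : R -> 'rV[R]_N.+1 := if m is m'.+1 then
  fun t => \row_i (z0 ord0 i + primitive (fun s => F (pic m' s) ord0 i) t)
  else fun=> z0.
have B0 : 0 <= B by exact: le_trans (FB z0 ord0).
have F_cont (y : R -> 'rV[R]_N.+1) i :
    (forall s t, `|y s - y t| <= B * `|s - t|) ->
    continuous (fun s => F (y s) ord0 i).
  move=> yB; apply: (@lipschitz_continuous R _ (L * B)) => s t.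
  by apply: le_trans (FL _ _ _) _; rewrite -mulrA; apply: ler_wpM2l => //; exact: ltW.
have prim_lip (y : R -> 'rV[R]_N.+1) i (s t : R) :
    continuous (fun s => F (y s) ord0 i) ->
    `|primitive (fun s => F (y s) ord0 i) s - primitive (fun s => F (y s) ord0 i) t|
      <= B * `|s - t|.
  move=> cF; apply: bounded_derive_lipschitz (fun u => FB (y u) i) s t.
  by move=> u; exact: is_derive_primitive.
have pic_lip m s t : `|pic m s - pic m t| <= B * `|s - t|.
  elim: m s t => [|m IH] s t /=; first by rewrite subrr normr0 mulr_ge0.
  apply: rV_norm_le => [|i]; first by rewrite mulr_ge0.
  by rewrite !mxE opprD addrACA subrr add0r; apply: prim_lip; exact: F_cont.
have cpic m i := F_cont (pic m) i (pic_lip m).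
pose W (t : R) : R := expR (2 * L * `|t|).
(* chosen so that the first step is bounded by [K * W t] *)
pose K := B / (2 * L).
have K0 : 0 <= K by rewrite divr_ge0 // mulr_ge0 // ltW.
have dD (y z : R -> 'rV[R]_N.+1) i (s : R) : continuous (fun s : R => F (y s) ord0 i) ->
    continuous (fun s : R => F (z s) ord0 i) ->
    is_derive s 1 (primitive (fun s => F (y s) ord0 i) - primitive (fun s => F (z s) ord0 i))
      (F (y s) ord0 i - F (z s) ord0 i).
  by move=> cy cz; apply: is_deriveB; apply: is_derive_primitive.
have step m t : `|pic m.+1 t - pic m t| <= K / 2 ^+ m * W t.
  have P0 j : 0 <= K / 2 ^+ j by rewrite divr_ge0 // exprn_ge0.
  have Q0 j s : 0 <= K / 2 ^+ j * W s by rewrite mulr_ge0 // expR_ge0.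
  elim: m t => [|m IH] t; apply: rV_norm_le => // i; rewrite !mxE /=.
    rewrite addrC addKr expr0 divr1.
    apply: (@derive_exp_bound L K _ (fun s => F z0 ord0 i)) => //.
    - by move=> s; apply: is_derive_primitive; exact: cst_continuous.
    - move=> s; apply: (le_trans (FB _ _)).
      have -> : 2 * L * K = B by rewrite /K mulrC divfK // gt_eqF // mulr_gt0.
      by rewrite ler_peMr // -expR0 ler_expR !mulr_ge0 // ltW.
    - by rewrite primitive0 //; exact: cst_continuous.
  rewrite opprD addrACA subrr add0r.
  apply: (@derive_exp_bound L _ _ _ _ (P0 m.+1) (fun s => dD _ _ i s (cpic m.+1 i) (cpic m i))).
  - move=> s; apply: le_trans (FL _ _ _) _.
    apply: le_trans (ler_wpM2l (ltW L0) (IH s)) _.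
    rewrite exprS invfM /W le_eqVlt; apply/orP; left; apply/eqP; field.
    by rewrite expf_neq0.
  - by rewrite (_ : forall f g : R -> R, (f - g) 0 = f 0 - g 0) // (primitive0 (cpic m.+1 i)) (primitive0 (cpic m i)) subrr.
have W0 t : 0 <= W t by exact: expR_ge0.
have lim_ex t i : exists l, forall m, `|pic m t ord0 i - l| <= 2 * (K * W t) / 2 ^+ m.
  apply: geometric_limit; first by rewrite mulr_ge0.
  move=> m; rewrite mulrAC; apply: le_trans _ (step m t).
  by have := coord_norm_le (pic m.+1 t - pic m t) i; rewrite rV_subE.
pose y t : 'rV[R]_N.+1 := \row_i projT1 (cid (lim_ex t i)).
have ylim t i m : `|pic m t ord0 i - y t ord0 i| <= 2 * (K * W t) / 2 ^+ m.
  by rewrite mxE; case: cid => l /= ->.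
have ylim' t m : `|pic m t - y t| <= 2 * (K * W t) / 2 ^+ m.
  apply: rV_norm_le => [|i]; first by rewrite divr_ge0 ?exprn_ge0 // mulr_ge0 // mulr_ge0.
  by rewrite rV_subE; exact: ylim.
have y_lip s t : `|y s - y t| <= B * `|s - t|.
  apply: (@ler_geometric R _ _ (2 * (K * W s) + 2 * (K * W t))) => m.
  have -> : y s - y t = (pic m s - pic m t) + (y s - pic m s) + (pic m t - y t).
    by rewrite [X in _ = X + _]addrC !addrA !subrK.
  apply: le_trans (ler_normD _ _) _; rewrite mulrDl [leRHS]addrA.
  apply: lerD; last exact: ylim'.
  apply: le_trans (ler_normD _ _) _.
  by apply: lerD; [exact: pic_lip | rewrite distrC; exact: ylim'].
have cy i := F_cont y i y_lip.
have yE t i : y t ord0 i = z0 ord0 i + primitive (fun s => F (y s) ord0 i) t.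
  apply/eqP; rewrite -subr_eq0 -normr_le0.
  apply: (@ler_geometric R _ _ (2 * (K * W t))) => m; rewrite add0r.
  have -> : y t ord0 i - (z0 ord0 i + primitive (fun s => F (y s) ord0 i) t) =
    (y t ord0 i - pic m.+1 t ord0 i) +
    (primitive (fun s => F (pic m s) ord0 i) t - primitive (fun s => F (y s) ord0 i) t).
    by rewrite /= [in RHS]mxE; ring.
  have -> : 2 * (K * W t) / 2 ^+ m = 2 * (K * W t) / 2 ^+ m.+1 + K / 2 ^+ m * W t.
    by rewrite exprS invfM; field; rewrite expf_neq0.
  apply: le_trans (ler_normD _ _) _; apply: lerD.
    by rewrite distrC; exact: ylim.
  have P0 : 0 <= K / 2 ^+ m by rewrite divr_ge0 // exprn_ge0.
  apply: (@derive_exp_bound L _ _ _ _ P0 (fun s => dD _ _ i s (cpic m i) (cy i))).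
    move=> s; apply: le_trans (FL _ _ _) _.
    apply: le_trans (ler_wpM2l (ltW L0) (ylim' s m)) _.
    by rewrite /W le_eqVlt; apply/orP; left; apply/eqP; field; rewrite expf_neq0.
  by rewrite (_ : forall f g : R -> R, (f - g) 0 = f 0 - g 0) // (primitive0 (cpic m i)) (primitive0 (cy i)) subrr.
exists y => [|t i].
  by apply/rowP => i; rewrite yE primitive0 ?addr0 //; exact: cy.
have -> : (fun s => y s ord0 i) =
    cst (z0 ord0 i) + primitive (fun s => F (y s) ord0 i).
  by apply/funext => s; rewrite yE.
rewrite -[F (y t) ord0 i]add0r; apply: is_deriveD; exact: is_derive_primitive.
Qed.

End picard.

(** * Vector fields and Hamilton's equations in coordinates *)

Section fields.
Context {R : realType} {n : nat}.
Implicit Types (f g : 'rV[R]_n -> R) (U : set 'rV[R]_n) (x y v : 'rV[R]_n)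
  (V W : 'rV[R]_n -> 'rV[R]_n).

Definition smooth_field U V := forall i, smooth_Rn U (fun x => V x ord0 i).

Definition lieD V f x := \sum_i V x ord0 i * pd i f x.

Definition bracket V W : 'rV[R]_n -> 'rV[R]_n := fun x =>
  \row_m (lieD V (fun y => W y ord0 m) x - lieD W (fun y => V y ord0 m) x).

Lemma bracketC V W x : bracket V W x = - bracket W V x.
Proof. by apply/rowP => m; rewrite !mxE opprB. Qed.

Lemma smooth_differentiable U f x : open U -> smooth_Rn U f -> U x ->
  differentiable f x.
Proof. by move=> oU /(_ 1%N); exact: C1_differentiable. Qed.

Lemma smooth_pd U f i : smooth_Rn U f -> smooth_Rn U (pd i f).
Proof. by move=> sf m; apply: Ck_pd. Qed.

Lemma smooth_lieD U V f : open U -> smooth_field U V -> smooth_Rn U f ->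
  smooth_Rn U (lieD V f).
Proof.
move=> oU sV sf m; apply: Ck_sum => // i _; apply: Ck_mul => //.
  exact: sV.
exact: smooth_pd.
Qed.

Lemma smooth_bracket U V W : open U -> smooth_field U V -> smooth_field U W ->
  smooth_field U (bracket V W).
Proof.
move=> oU sV sW i m.
have sVW := smooth_lieD oU sV (sW i).
have sWV := smooth_lieD oU sW (sV i).
by apply: Ck_eq (Ck_add oU (sVW m) (Ck_opp oU (sWV m))) => // x _; rewrite mxE.
Qed.

Lemma pairingDl (l l' v : 'rV[R]_n) : pairing (l + l') v = pairing l v + pairing l' v.
Proof. by rewrite /pairing -big_split /=; apply: eq_bigr => i _; rewrite mxE mulrDl. Qed.

Lemma pairingC (l v : 'rV[R]_n) : pairing l v = pairing v l.
Proof. by apply: eq_bigr => i _; rewrite mulrC. Qed.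

Lemma pairingDr (l v v' : 'rV[R]_n) : pairing l (v + v') = pairing l v + pairing l v'.
Proof. by rewrite pairingC pairingDl ![pairing _ l]pairingC. Qed.

Lemma pairingZl (a : R) (l v : 'rV[R]_n) : pairing (a *: l) v = a * pairing l v.
Proof. by rewrite /pairing mulr_sumr; apply: eq_bigr => i _; rewrite mxE mulrA. Qed.

Lemma pairingZr (a : R) (l v : 'rV[R]_n) : pairing l (a *: v) = a * pairing l v.
Proof. by rewrite pairingC pairingZl pairingC. Qed.

Lemma pairingNr (l v : 'rV[R]_n) : pairing l (- v) = - pairing l v.
Proof. by rewrite -scaleN1r pairingZr mulN1r. Qed.

Lemma pairing0r (l : 'rV[R]_n) : pairing l 0 = 0.
Proof. by rewrite -(scale0r (0 : 'rV[R]_n)) pairingZr mul0r. Qed.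

Lemma pairing_sumr (I : Type) (r : seq I) (P : pred I) (l : 'rV[R]_n)
    (v : I -> 'rV[R]_n) :
  pairing l (\sum_(i <- r | P i) v i) = \sum_(i <- r | P i) pairing l (v i).
Proof.
elim/big_rec2: _ => [|i x y _ <-]; first exact: pairing0r.
by rewrite pairingDr.
Qed.

Lemma pairing_basis_vec (l : 'rV[R]_n) i : pairing l (basis_vec i) = l ord0 i.
Proof.
rewrite /pairing (bigD1 i) //= basis_vecE eqxx mulr1 big1 ?addr0 // => j ji.
by rewrite basis_vecE (negbTE ji) mulr0.
Qed.

End fields.

Section controlled_curves.
Context {R : realType} {n k : nat}.
Implicit Types (f g : 'rV[R]_n -> R) (U : set 'rV[R]_n) (x v : 'rV[R]_n)
  (W : 'rV[R]_n -> 'rV[R]_n) (V : 'I_k -> 'rV[R]_n -> 'rV[R]_n)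
  (y p : R -> 'rV[R]_n).

(** Hamilton's equations at time [t] for the time dependent Hamiltonian
    [sum_j u_j <p, V_j>]; for [u_j = <p, V_j>] they are those of
    [1/2 sum_j <p, V_j>^2]. *)
Definition controlled V (u : 'I_k -> R) y p (t : R) := forall i,
  is_derive t 1 (fun s => y s ord0 i) (\sum_j u j * V j (y t) ord0 i) /\
  is_derive t 1 (fun s => p s ord0 i)
    (- \sum_j u j * \sum_m p t ord0 m * pd i (fun x => V j x ord0 m) (y t)).

Lemma derive_along V u y p t f : controlled V u y p t ->
  differentiable f (y t) ->
  is_derive t 1 (fun s => f (y s)) (\sum_j u j * lieD (V j) f (y t)).
Proof.
move=> hc df.
apply: is_derive_eq (is_derive_curve (fun i => (hc i).1) df) _.
under eq_bigr do rewrite mulr_suml.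
rewrite exchange_big /=; apply: eq_bigr => j _.
by rewrite mulr_sumr; apply: eq_bigr => i _; rewrite mulrA.
Qed.

(** The Poisson bracket of the linear Hamiltonians of two fields is the linear
    Hamiltonian of their Lie bracket. *)
Lemma derive_momentum V u y p t W : controlled V u y p t ->
  (forall i, differentiable (fun x => W x ord0 i) (y t)) ->
  is_derive t 1 (fun s => pairing (p s) (W (y s)))
    (\sum_j u j * pairing (p t) (bracket (V j) W (y t))).
Proof.
move=> hc dW.
have d i := is_derive_mul (hc i).2 (derive_along hc (dW i)).
apply: is_derive_eq (@is_derive_sumr R _ (index_enum _) xpredT _ _ t (fun i _ => d i)) _.
rewrite big_split /=.
have -> : \sum_(i < n) - (\sum_j u j * \sum_m p t ord0 m *
      pd i (fun x => V j x ord0 m) (y t)) * W (y t) ord0 i =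
  - \sum_j u j * \sum_m p t ord0 m * lieD W (fun x => V j x ord0 m) (y t).
  rewrite -[RHS]sumrN.
  under eq_bigr do rewrite mulNr mulr_suml -sumrN.
  rewrite exchange_big /=; apply: eq_bigr => j _; rewrite -mulrN.
  under eq_bigr do rewrite -mulrA -mulrN mulr_suml.
  rewrite -mulr_sumr; congr (_ * _); rewrite sumrN exchange_big /=; congr (- _).
  apply: eq_bigr => m _; rewrite /lieD mulr_sumr.
  by apply: eq_bigr => i _; rewrite -mulrA [pd _ _ _ * _]mulrC.
have -> : \sum_(i < n) p t ord0 i * (\sum_j u j * lieD (V j) (fun x => W x ord0 i) (y t))
  = \sum_j u j * \sum_m p t ord0 m * lieD (V j) (fun x => W x ord0 m) (y t).
  under eq_bigr do rewrite mulr_sumr.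
  rewrite exchange_big /=; apply: eq_bigr => j _.
  by rewrite mulr_sumr; apply: eq_bigr => i _; rewrite mulrCA.
rewrite addrC -sumrB; apply: eq_bigr => j _; rewrite -mulrBr; congr (_ * _).
by rewrite -sumrB; apply: eq_bigr => m _; rewrite -mulrBr mxE.
Qed.

(** The energy is preserved because the bracket is antisymmetric. *)
Lemma derive_energy V y p t (c : R) :
  controlled V (fun j => c * pairing (p t) (V j (y t))) y p t ->
  (forall j i, differentiable (fun x => V j x ord0 i) (y t)) ->
  is_derive t 1 (fun s => \sum_i pairing (p s) (V i (y s)) ^+ 2) 0.
Proof.
move=> hc dV.
have d i := is_derive_mul (derive_momentum hc (dV i)) (derive_momentum hc (dV i)).
apply: is_derive_eq (@is_derive_sumr R _ (index_enum _) xpredT _ _ t (fun i _ => d i)) _.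
pose b j i := c * pairing (p t) (V j (y t)) *
  pairing (p t) (bracket (V j) (V i) (y t)) * pairing (p t) (V i (y t)).
have E : \sum_i \sum_j b j i = 0.
  have anti : \sum_i \sum_j b j i = - \sum_i \sum_j b j i.
    rewrite [in RHS]exchange_big /= -sumrN; apply: eq_bigr => i _.
    rewrite -sumrN; apply: eq_bigr => j _; rewrite /b bracketC pairingNr.
    by ring.
  by move: anti; set e := (\sum_i _) => anti; lra.
rewrite big_split /=.
under eq_bigr do rewrite mulr_suml.
rewrite E add0r -[RHS]E; apply: eq_bigr => i _.
by rewrite mulr_sumr; apply: eq_bigr => j _; rewrite /b mulrC.
Qed.

End controlled_curves.

(** * Cubes and bounded Lipschitz functions *)

Section cubes.
Context {R : realType} {n : nat}.
Implicit Types (f g : 'rV[R]_n -> R) (U : set 'rV[R]_n) (x y v : 'rV[R]_n).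

(** The norm of ['rV_n] is the maximum norm, hence the name. *)
Definition cube (x0 : 'rV[R]_n) (r : R) : set 'rV[R]_n := [set x | `|x - x0| <= r].

Lemma cube_compact x0 r : compact (cube x0 r).
Proof.
apply: bounded_closed_compact.
  exists (`|x0| + r); split; first exact: num_real.
  move=> M hM x /= xr; apply: ltW; apply: le_lt_trans hM.
  by rewrite -[x](subrK x0) (le_trans (ler_normD _ _)) // addrC lerD2l.
have -> : cube x0 r = (fun x => `|x - x0|) @^-1` [set t | t <= r] by [].
apply: closed_comp; last exact: closed_le.
move=> x _; apply: (@continuous_comp _ _ _ (fun x : 'rV[R]_n => x - x0) Num.norm).
  by apply: continuousB; [exact: cvg_id | exact: cst_continuous].
exact: norm_continuous.
Qed.

Lemma compact_bounded_fun (K : set 'rV[R]_n) f : compact K ->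
  (forall x, K x -> {for x, continuous f}) ->
  exists2 C, 0 <= C & forall x, K x -> `|f x| <= C.
Proof.
move=> cK cf.
have /compact_bounded [M [_ hM]] : compact (f @` K).
  apply: continuous_compact => //; apply: continuous_in_subspaceT => x.
  by rewrite inE; exact: cf.
exists (`|M| + 1); first by rewrite addr_ge0.
move=> x Kx; apply: (hM (`|M| + 1)); last by exists x.
by rewrite ltr_pwDr // ler_norm.
Qed.

Lemma bounded_family (I : finType) (T : Type) (K : set T) (f : I -> T -> R) :
  (forall i, exists2 C, 0 <= C & forall u, K u -> `|f i u| <= C) ->
  exists2 C, 0 <= C & forall i u, K u -> `|f i u| <= C.
Proof.
move=> h; pose C i := projT1 (cid2 (h i)).
have C0 i : 0 <= C i by rewrite /C; case: cid2.
have hC i u : K u -> `|f i u| <= C i.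
  by rewrite /C; case: cid2 => c /= _ hc; exact: hc.
exists (\sum_i C i); first by apply: sumr_ge0.
move=> i u Ku; apply: le_trans (hC i u Ku) _.
by rewrite (bigD1 i) //= lerDl; apply: sumr_ge0.
Qed.

Lemma cube_convex x0 r a b t : cube x0 r a -> cube x0 r b -> 0 <= t <= 1 ->
  cube x0 r (b + t *: (a - b)).
Proof.
rewrite /cube /= => ha hb /andP[t0 t1].
have -> : b + t *: (a - b) - x0 = (1 - t) *: (b - x0) + t *: (a - x0).
  by apply/rowP => i; rewrite !mxE; ring.
apply: le_trans (ler_normD _ _) _; rewrite !normrZ.
rewrite (ger0_norm t0) ger0_norm ?subr_ge0 //.
have -> : r = (1 - t) * r + t * r by ring.
by apply: lerD; apply: ler_wpM2l; rewrite ?subr_ge0.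
Qed.

Lemma C1_lipschitz_cube U f x0 r : open U -> Ck 1 U f -> cube x0 r `<=` U ->
  exists2 C, 0 <= C & forall a b, cube x0 r a -> cube x0 r b ->
    `|f a - f b| <= C * `|a - b|.
Proof.
move=> oU Cf KU; have /CkS[_ hf] := Cf.
have [|C C0 hC] := @bounded_family 'I_n _ (cube x0 r) (fun i => pd i f).
  move=> i; apply: compact_bounded_fun; first exact: cube_compact.
  by move=> x /KU Ux; have [_ /Ck_continuous] := hf i; apply.
exists (n%:R * C); first by rewrite mulr_ge0.
move=> a b ha hb.
pose c t : 'rV[R]_n := b + t *: (a - b).
have dc (t : R) i : is_derive t 1 (fun s => c s ord0 i) ((a - b) ord0 i).
  have -> : (fun s => c s ord0 i) = (fun s : R => b ord0 i + (a - b) ord0 i * s).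
    by apply/funext => s; rewrite !mxE mulrC.
  have := is_derive_add (is_derive_cst (b ord0 i) t (1 : R))
    (is_derive_mull ((a - b) ord0 i) (is_derive_id t (1 : R))).
  by rewrite add0r mulr1.
have df (t : R) : 0 <= t <= 1 -> is_derive t 1 (f \o c)
    (\sum_i (a - b) ord0 i * pd i f (c t)).
  move=> t01; apply: (is_derive_curve (dc t)).
  by apply: C1_differentiable oU Cf _; apply: KU; exact: cube_convex.
have dg (t : R) : 0 <= t <= 1 ->
    is_derive t 1 (fun s : R => n%:R * C * `|a - b| * s) (n%:R * C * `|a - b|).
  by move=> _; apply: is_derive_eq (is_derive_mull _ (is_derive_id t (1 : R))) _; rewrite mulr1.
have bd (t : R) : 0 <= t <= 1 -> `|\sum_i (a - b) ord0 i * pd i f (c t)| <= n%:R * C * `|a - b|.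
  move=> t01; apply: le_trans (ler_norm_sum _ _ _) _.
  have -> : n%:R * C * `|a - b| = \sum_(i < n) `|a - b| * C.
    by rewrite sumr_const card_ord -[RHS]mulr_natl; ring.
  apply: ler_sum => i _; rewrite normrM; apply: ler_pM => //.
    exact: coord_norm_le.
  by apply: hC; exact: cube_convex.
have := mean_value_le ler01 df dg bd.
have c1 : c 1 = a by rewrite /c scale1r addrC subrK.
have c0 : c 0 = b by rewrite /c scale0r addr0.
by rewrite /= c1 c0 mulr1 mulr0 subr0.
Qed.

Definition clamp (x0 : 'rV[R]_n) (r : R) x : 'rV[R]_n :=
  \row_i Num.max (x0 ord0 i - r) (Num.min (x0 ord0 i + r) (x ord0 i)).

Lemma clamp_cube x0 r x : 0 <= r -> cube x0 r (clamp x0 r x).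
Proof.
move=> r0; apply: rV_norm_le => // i; rewrite !mxE ler_norml.
by case: (leP (x0 ord0 i + r) (x ord0 i)) => h1;
  case: (leP (x0 ord0 i - r) _) => h2; apply/andP; split; lra.
Qed.

Lemma clamp_id x0 r x : cube x0 r x -> clamp x0 r x = x.
Proof.
move=> xr; apply/rowP => i; rewrite !mxE.
have := le_trans (coord_norm_le (x - x0) i) xr.
rewrite rV_subE ler_norml => /andP[h1 h2].
by rewrite min_r ?max_r //; lra.
Qed.

Lemma clamp_lipschitz x0 r x y : 0 <= r -> `|clamp x0 r x - clamp x0 r y| <= `|x - y|.
Proof.
move=> r0; apply: rV_norm_le => // i.
apply: le_trans (coord_norm_le (x - y) i); rewrite !rV_subE !mxE.
move: (x ord0 i) (y ord0 i) (x0 ord0 i) => a b c.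
wlog ab : a b / a <= b => [hw|].
  by have [/hw//|/ltW/hw] := leP a b; rewrite distrC [`|b - a|]distrC.
rewrite [leRHS]ler0_norm ?subr_le0 // opprB ler_norml.
by case: (leP (c + r) a) => h1; case: (leP (c + r) b) => h2;
  case: (leP (c - r) a) => h3; case: (leP (c - r) b) => h4;
  do ?(case: (leP (c - r) (c + r)) => h5);
  apply/andP; split; lra.
Qed.

End cubes.

Section bounded_lipschitz.
Context {R : realType} {N : nat}.
Implicit Types (g h : 'rV[R]_N -> R).

Definition bounded_lipschitz g := exists2 C, 0 <= C &
  (forall z, `|g z| <= C) /\ (forall z z', `|g z - g z'| <= C * `|z - z'|).

Lemma bl_cst (a : R) : bounded_lipschitz (fun=> a).
Proof.
exists `|a| => //; split=> // z z'; rewrite subrr normr0.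
by rewrite mulr_ge0.
Qed.

Lemma bl_add g h : bounded_lipschitz g -> bounded_lipschitz h ->
  bounded_lipschitz (fun z => g z + h z).
Proof.
move=> [C C0 [gC gL]] [D D0 [hD hL]]; exists (C + D); first exact: addr_ge0.
split=> [z|z z']; first exact: le_trans (ler_normD _ _) (lerD (gC z) (hD z)).
rewrite opprD addrACA mulrDl.
exact: le_trans (ler_normD _ _) (lerD (gL z z') (hL z z')).
Qed.

Lemma bl_mul g h : bounded_lipschitz g -> bounded_lipschitz h ->
  bounded_lipschitz (fun z => g z * h z).
Proof.
move=> [C C0 [gC gL]] [D D0 [hD hL]].
have CD : 0 <= C * D by rewrite mulr_ge0.
exists (C * D + C * D); first exact: addr_ge0.
split=> [z|z z'].
  rewrite normrM; apply: (@le_trans _ _ (C * D)); last by rewrite lerDl.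
  exact: ler_pM.
have -> : g z * h z - g z' * h z' = (g z - g z') * h z + g z' * (h z - h z').
  by ring.
rewrite [leRHS]mulrDl; apply: le_trans (ler_normD _ _) _; rewrite !normrM; apply: lerD.
  by rewrite mulrAC; apply: ler_pM.
by rewrite -mulrA; apply: ler_pM.
Qed.

Lemma bl_opp g : bounded_lipschitz g -> bounded_lipschitz (fun z => - g z).
Proof.
by move=> [C C0 [gC gL]]; exists C => //; split=> *; rewrite -?opprD normrN.
Qed.

Lemma bl_sum (I : Type) (r : seq I) (P : pred I) (g : I -> 'rV[R]_N -> R) :
  (forall i, P i -> bounded_lipschitz (g i)) ->
  bounded_lipschitz (fun z => \sum_(i <- r | P i) g i z).
Proof.
move=> h; elim: r => [|i r IH].
  have -> : (fun z => \sum_(i <- [::] | P i) g i z) = (fun=> 0).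
    by apply/funext => z; rewrite big_nil.
  exact: bl_cst.
case Pi : (P i); last first.
  have -> : (fun z => \sum_(i <- i :: r | P i) g i z) =
    (fun z => \sum_(i <- r | P i) g i z) by apply/funext => z; rewrite big_cons Pi.
  exact: IH.
have -> : (fun z => \sum_(i <- i :: r | P i) g i z) =
  (fun z => g i z + \sum_(i <- r | P i) g i z) by apply/funext => z; rewrite big_cons Pi.
by apply: bl_add => //; exact: h.
Qed.

Lemma bl_inv g : (forall z, 1 <= g z) -> bounded_lipschitz g ->
  bounded_lipschitz (fun z => (g z)^-1).
Proof.
move=> g1 [C C0 [gC gL]]; exists (C + 1); first by rewrite addr_ge0.
have g0 z : 0 < g z by apply: lt_le_trans (g1 z).
have gi z : `|(g z)^-1| <= 1.
  by rewrite normfV invf_le1 ?normr_gt0 ?gt_eqF // ger0_norm // ltW.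
split=> [z|z z']; first by apply: le_trans (gi z) _; rewrite lerDr.
have -> : (g z)^-1 - (g z')^-1 = (g z)^-1 * ((g z')^-1 * (g z' - g z)).
  by field; rewrite !gt_eqF.
rewrite !normrM distrC; apply: (@le_trans _ _ (C * `|z - z'|)).
  apply: le_trans (gL z z'); rewrite mulrA ler_piMl // mulr_ile1 //.
by apply: ler_wpM2r => //; rewrite lerDl.
Qed.

(** The retraction onto the cube is 1-Lipschitz, and a C^1 function is Lipschitz
    on the cube, which is compact and convex.  In this way the coefficients of
    an equation given near a cube are extended to the whole space. *)
Lemma bl_comp_clamp n (L : 'rV[R]_N -> 'rV[R]_n) (U : set 'rV[R]_n)
    (f : 'rV[R]_n -> R) x0 r :
  (forall z z', `|L z - L z'| <= `|z - z'|) -> 0 <= r ->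
  open U -> Ck 1 U f -> cube x0 r `<=` U ->
  bounded_lipschitz (fun z => f (clamp x0 r (L z))).
Proof.
move=> Ll r0 oU Cf KU.
have [C C0 hC] := C1_lipschitz_cube oU Cf KU.
have [|D D0 hD] := @compact_bounded_fun _ _ _ f (@cube_compact _ _ x0 r).
  by move=> x /KU Ux; exact: Ck_continuous Cf Ux.
exists (C + D); first exact: addr_ge0; split=> [z|z z'].
  by apply: le_trans (hD _ (clamp_cube _ _ r0)) _; rewrite lerDr.
apply: le_trans (hC _ _ (clamp_cube _ _ r0) (clamp_cube _ _ r0)) _.
apply: ler_pM => //; first by rewrite lerDl.
exact: le_trans (clamp_lipschitz _ _ _ r0) (Ll _ _).
Qed.

End bounded_lipschitz.

(** * Existence of the Hamiltonian flow *)

Section hamiltonian_flow.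
Context {R : realType} {n k : nat}.

Lemma smooth_coord (U : set 'rV[R]_n) (i : 'I_n) : smooth_Rn U (fun x => x ord0 i).
Proof.
case=> [|m]; first by split=> // x _; exact: coord_continuous.
apply/CkS; split=> [x _|j]; first exact: coord_continuous.
have D x : is_derive x (basis_vec j) (fun x : 'rV[R]_n => x ord0 i) (i == j)%:R.
  apply: is_derive_of_line.
  have -> : (fun u : R => (u *: basis_vec j + x) ord0 i) =
      (fun u => (i == j)%:R * u + x ord0 i).
    by apply/funext => u; rewrite !mxE eqxx /= mulrC.
  have := is_derive_add (is_derive_mull (i == j)%:R (is_derive_id (0 : R) (1 : R)))
    (is_derive_cst (x ord0 i) (0 : R) (1 : R)).
  by rewrite addr0 mulr1.
split=> [x _|]; first by have [] := D x.
have -> : pd j (fun x : 'rV[R]_n => x ord0 i) = (fun=> (i == j)%:R).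
  by apply/funext => x; rewrite pd_derive; have Dx := D x; rewrite derive_val.
exact: Ck_cst.
Qed.

(** The energy cannot be used to bound the momenta, since it vanishes on the
    annihilator of the span of the [V j].  Instead of the Hamiltonian field, one
    integrates the field obtained by moving the position into a cube, the
    momentum into a ball of size comparable to the initial momentum, and by
    replacing the coefficients [h j = <p, V j>] by
    [2 * h j / (1 + sum_i (h i)^2)].  This field is bounded and Lipschitz.  The
    new coefficients are at most [1] in absolute value and still proportional
    to [h], so that the energy is conserved and the coefficients are equal to
    [h] on the initial energy level.  Thus neither modification is felt for a
    time that does not depend on the initial momentum. *)
Lemma hamiltonian_flow_exists (U : set 'rV[R]_n) (V : 'I_k -> 'rV[R]_n -> 'rV[R]_n)
    (x0 : 'rV[R]_n) (r : R) :
  open U -> (forall j, smooth_field U (V j)) -> 0 < r -> cube x0 (r + r) `<=` U ->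
  exists2 e : R, 0 < e & forall y0 p0 : 'rV[R]_n, cube x0 r y0 ->
    \sum_j pairing p0 (V j y0) ^+ 2 = 1 ->
    exists y p : R -> 'rV[R]_n, [/\ y 0 = y0, p 0 = p0 &
      forall t, `|t| < e -> cube x0 (r + r) (y t) /\
        controlled V (fun j => pairing (p t) (V j (y t))) y p t].
Proof.
move=> oU sV r0 KU.
have rr0 : 0 <= r + r by rewrite addr_ge0 // ltW.
have [|C1 C10 hC1] := @bounded_family R ('I_k * 'I_n)%type _ (cube x0 (r + r))
    (fun ji x => V ji.1 x ord0 ji.2).
  move=> [j i]; apply: compact_bounded_fun; first exact: cube_compact.
  by move=> x /KU Ux; exact: (Ck_continuous (sV j i 0%N) Ux).
have [|C2 C20 hC2] := @bounded_family R ('I_k * 'I_n * 'I_n)%type _ (cube x0 (r + r))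
    (fun jim => pd jim.1.2 (fun x => V jim.1.1 x ord0 jim.2)).
  move=> [[j i] m]; apply: compact_bounded_fun; first exact: cube_compact.
  by move=> x /KU Ux; exact: (Ck_continuous (smooth_pd i (sV j m) 0%N) Ux).
(* [A] bounds the velocity, and [B * R0] the derivative of a momentum of size
   at most [R0] *)
pose A := k%:R * C1; pose B := k%:R * (n%:R * C2).
have A0 : 0 <= A by rewrite mulr_ge0.
have B0 : 0 <= B by rewrite !mulr_ge0.
pose e := Num.min (r / (A + 1)) (2^-1 / (B + 1)).
have A1 : 0 < A + 1 by rewrite ltr_wpDl.
have B1 : 0 < B + 1 by rewrite ltr_wpDl.
exists e; first by rewrite lt_min !divr_gt0.
move=> y0 p0 hy0 hp0.
(* the momentum varies by at most [R0 / 2] before the time [e], so that it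
   stays in the ball of radius [R0] *)
pose R0 := 2 * `|p0| + 1.
have R00 : 0 <= R0 by rewrite addr_ge0 // mulr_ge0.
pose X (z : 'rV[R]_(n + n)) := clamp x0 (r + r) (lsubmx z).
pose P (z : 'rV[R]_(n + n)) := clamp 0 R0 (rsubmx z).
pose h j z := pairing (P z) (V j (X z)).
pose c z := 2 * (1 + \sum_j h j z ^+ 2)^-1.
pose u j z := c z * h j z.
pose F (z : 'rV[R]_(n + n)) : 'rV[R]_(n + n) := row_mx
  (\row_i \sum_j u j z * V j (X z) ord0 i)
  (\row_i - \sum_j u j z * \sum_m P z ord0 m * pd i (fun x => V j x ord0 m) (X z)).
have lsub_lip (z z' : 'rV[R]_(n + n)) : `|lsubmx z - lsubmx z'| <= `|z - z'|.
  apply: rV_norm_le => // i; rewrite !mxE.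
  by have := coord_norm_le (z - z') (lshift n i); rewrite rV_subE.
have rsub_lip (z z' : 'rV[R]_(n + n)) : `|rsubmx z - rsubmx z'| <= `|z - z'|.
  apply: rV_norm_le => // i; rewrite !mxE.
  by have := coord_norm_le (z - z') (rshift n i); rewrite rV_subE.
have blX f : Ck 1 U f -> bounded_lipschitz (fun z => f (X z)).
  by move=> Cf; exact: (bl_comp_clamp lsub_lip rr0 oU Cf KU).
have blP m : bounded_lipschitz (fun z => P z ord0 m).
  exact: (@bl_comp_clamp _ _ _ _ setT (fun x => x ord0 m) _ _ rsub_lip R00 openT
    (smooth_coord setT m 1%N)).
have blh j : bounded_lipschitz (h j).
  by apply: bl_sum => m _; exact: (bl_mul (blP m) (blX (fun x => V j x ord0 m) (sV j m 1%N))).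
have sq_ge1 z : 1 <= 1 + \sum_j h j z ^+ 2.
  by rewrite lerDl; apply: sumr_ge0 => j _; exact: sqr_ge0.
have blc : bounded_lipschitz c.
  apply: bl_mul; first exact: bl_cst.
  apply: bl_inv => //; apply: bl_add; first exact: bl_cst.
  by apply: bl_sum => j _; exact: (bl_mul (blh j) (blh j)).
have blu j : bounded_lipschitz (u j) by exact: (bl_mul blc (blh j)).
have u_le1 j z : `|u j z| <= 1.
  have S0 : 0 < 1 + \sum_j h j z ^+ 2 by exact: lt_le_trans (sq_ge1 z).
  rewrite /u /c mulrAC normrM normfV (gtr0_norm S0) ler_pdivrMr // mul1r.
  rewrite normrM ger0_norm //.
  apply: (@le_trans _ _ (1 + `|h j z| ^+ 2)).
    by have := sqr_ge0 (`|h j z| - 1); rewrite sqrrB mulr1 expr1n mulr_natl => H; lra.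
  rewrite real_normK ?num_real // lerD2l (bigD1 j) //= lerDl.
  by apply: sumr_ge0 => i _; exact: sqr_ge0.
have F_l z i : F z ord0 (lshift n i) = \sum_j u j z * V j (X z) ord0 i.
  by rewrite row_mxEl mxE.
have F_r z i : F z ord0 (rshift n i) =
    - \sum_j u j z * \sum_m P z ord0 m * pd i (fun x => V j x ord0 m) (X z).
  by rewrite row_mxEr mxE.
have blF i : bounded_lipschitz (fun z => F z ord0 i).
  case: (split_ordP i) => i' ->.
    have -> : (fun z => F z ord0 (lshift n i')) =
        (fun z => \sum_j u j z * V j (X z) ord0 i') by exact/funext.
    apply: bl_sum => j _; apply: bl_mul => //.
    exact: (blX (fun x => V j x ord0 i') (sV j i' 1%N)).
  have -> : (fun z => F z ord0 (rshift n i')) =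
    (fun z => - \sum_j u j z * \sum_m P z ord0 m * pd i' (fun x => V j x ord0 m) (X z)).
    exact/funext.
  apply: bl_opp; apply: bl_sum => j _; apply: bl_mul => //.
  apply: bl_sum => m _; apply: (bl_mul (blP m)).
  exact: (blX (pd i' (fun x => V j x ord0 m)) (smooth_pd i' (sV j m) 1%N)).
pose L i := projT1 (cid2 (blF i)).
have L0 i : 0 <= L i by rewrite /L; case: cid2.
have [FB FL] : (forall z i, `|F z ord0 i| <= \sum_i L i) /\
    (forall z z' i, `|F z ord0 i - F z' ord0 i| <= (\sum_i L i + 1) * `|z - z'|).
  have Lle i : L i <= \sum_i L i by rewrite (bigD1 i) //= lerDl sumr_ge0.
  split=> [z i|z z' i].
    by apply: le_trans (Lle i); rewrite /L; case: cid2 => C /= _ [].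
  apply: (@le_trans _ _ (L i * `|z - z'|)).
    by rewrite /L; case: cid2 => C /= _ [].
  by apply: ler_wpM2r => //; apply: le_trans (Lle i) _; rewrite lerDl.
have LL : 0 < \sum_i L i + 1 by rewrite ltr_wpDl // sumr_ge0.
have [z z0 dz] := lipschitz_flow (row_mx y0 p0) LL FL FB.
pose y t := lsubmx (z t); pose p t := rsubmx (z t).
have dy (t : R) i : is_derive t 1 (fun s => y s ord0 i) (\sum_j u j (z t) * V j (X (z t)) ord0 i).
  have := dz t (lshift n i); rewrite F_l.
  by have -> : (fun s => z s ord0 (lshift n i)) = (fun s => y s ord0 i)
    by apply/funext => s; rewrite mxE.
have dp (t : R) i : is_derive t 1 (fun s => p s ord0 i)
   (- \sum_j u j (z t) * \sum_m P (z t) ord0 m * pd i (fun x => V j x ord0 m) (X (z t))).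
  have := dz t (rshift n i); rewrite F_r.
  by have -> : (fun s => z s ord0 (rshift n i)) = (fun s => p s ord0 i)
    by apply/funext => s; rewrite mxE.
have XK s : cube x0 (r + r) (X s) by exact: clamp_cube.
have PK s m : `|P s ord0 m| <= R0.
  apply: le_trans (coord_norm_le _ _) _.
  by have := @clamp_cube _ _ 0 R0 (rsubmx s) R00; rewrite /cube /= subr0.
have dyA t i : `|\sum_j u j (z t) * V j (X (z t)) ord0 i| <= A.
  apply: le_trans (ler_norm_sum _ _ _) _.
  have -> : A = \sum_(j < k) C1 by rewrite /A sumr_const card_ord mulr_natl.
  apply: ler_sum => j _; rewrite normrM -[C1]mul1r; apply: ler_pM => //.
  exact: (hC1 (j, i)).
have dpB t i : `|- \sum_j u j (z t) * \sum_m P (z t) ord0 m *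
    pd i (fun x => V j x ord0 m) (X (z t))| <= B * R0.
  rewrite normrN; apply: le_trans (ler_norm_sum _ _ _) _.
  have -> : B * R0 = \sum_(j < k) (\sum_(m < n) R0 * C2).
    by rewrite !sumr_const !card_ord -[RHS]mulr_natl -[_ *+ n]mulr_natl /B; ring.
  apply: ler_sum => j _; rewrite normrM -[leRHS]mul1r; apply: ler_pM => //.
  apply: le_trans (ler_norm_sum _ _ _) _; apply: ler_sum => m _.
  rewrite normrM; apply: ler_pM => //; exact: (hC2 (j, i, m)).
have y00 : y 0 = y0 by rewrite /y z0 row_mxKl.
have p00 : p 0 = p0 by rewrite /p z0 row_mxKr.
have inK t : `|t| < e -> cube x0 (r + r) (y t).
  rewrite lt_min => /andP[te _]; rewrite /cube /= -(subrKA (y 0)).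
  apply: le_trans (ler_normD _ _) _; apply: lerD; last by rewrite y00.
  apply: rV_norm_le => [|i]; first exact: ltW.
  rewrite rV_subE.
  apply: le_trans (bounded_derive_lipschitz (fun s => dy s i) (fun s => dyA s i) t 0) _.
  rewrite subr0; apply: (@le_trans _ _ ((A + 1) * `|t|)).
    by apply: ler_wpM2r => //; rewrite lerDl.
  by rewrite mulrC -ler_pdivlMr // ltW.
have inP t : `|t| < e -> cube 0 R0 (p t).
  rewrite lt_min => /andP[_ te]; rewrite /cube /= subr0 -[p t](subrK (p 0)).
  apply: le_trans (ler_normD _ _) _.
  have hp : `|p t - p 0| <= 2^-1 * R0.
    apply: rV_norm_le => [|i]; first by rewrite mulr_ge0 // invr_ge0.
    rewrite rV_subE.
    apply: le_trans (bounded_derive_lipschitz (fun s => dp s i) (fun s => dpB s i) t 0) _.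
    rewrite subr0 mulrAC; apply: ler_wpM2r => //.
    apply: (@le_trans _ _ ((B + 1) * `|t|)).
      by apply: ler_wpM2r => //; rewrite lerDl.
    by rewrite mulrC -ler_pdivlMr // ltW.
  by rewrite p00 in hp *; rewrite /R0 in hp *; lra.
have Xy t : `|t| < e -> X (z t) = y t by move=> te; apply: clamp_id; exact: inK.
have Pp t : `|t| < e -> P (z t) = p t by move=> te; apply: clamp_id; exact: inP.
pose H t := \sum_j pairing (p t) (V j (y t)) ^+ 2.
have hE t j : `|t| < e -> h j (z t) = pairing (p t) (V j (y t)).
  by move=> te; rewrite /h Xy // Pp.
have ctrl t : `|t| < e ->
    controlled V (fun j => c (z t) * pairing (p t) (V j (y t))) y p t.
  move=> te i; split; [apply: is_derive_eq (dy t i) _|apply: is_derive_eq (dp t i) _].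
    by apply: eq_bigr => j _; rewrite /u hE // Xy.
  congr (- _); apply: eq_bigr => j _; rewrite /u hE // Xy // Pp //.
have dH (t : R) : `|t| < e -> is_derive t 1 H 0.
  move=> te; apply: derive_energy (ctrl t te) _ => j i.
  by apply: (smooth_differentiable oU (sV j i)); apply: KU; exact: inK.
have H0 : H 0 = 1 by rewrite /H p00 y00.
have H_const t : `|t| < e -> H t = 1.
  move=> te; have dc (s : R) : is_derive s 1 (cst (0 : R)) (0 : R) by exact: is_derive_cst.
  have [t0|t0] := leP 0 t.
    have hs (s : R) : 0 <= s <= t -> is_derive s 1 H 0.
      move=> /andP[s0 st]; apply: dH; rewrite ger0_norm //.
      by apply: le_lt_trans st _; rewrite -(ger0_norm t0).
    have := @mean_value_le R H (fun=> 0) (cst 0) (fun=> 0) 0 t t0 hs (fun s _ => dc s).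
    rewrite H0 subrr normr0 => /(_ (fun _ _ => lexx _)).
    by rewrite normr_le0 subr_eq0 => /eqP.
  have hs (s : R) : t <= s <= 0 -> is_derive s 1 H 0.
    move=> /andP[s0 st]; apply: dH; rewrite ler0_norm //.
    by apply: le_lt_trans (_ : - t < e); rewrite ?lerN2 // -(ltr0_norm t0).
  have := @mean_value_le R H (fun=> 0) (cst 0) (fun=> 0) t 0 (ltW t0) hs (fun s _ => dc s).
  rewrite H0 subrr normr0 => /(_ (fun _ _ => lexx _)).
  by rewrite normr_le0 subr_eq0 => /eqP.
exists y, p; split=> // t te; split; first exact: inK.
have c1 : c (z t) = 1.
  rewrite /c; have -> : \sum_j h j (z t) ^+ 2 = 1.
    by rewrite -(H_const t te); apply: eq_bigr => j _; rewrite hE.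
  by rewrite divff // (_ : 1 + 1 = 2 :> R).
have := ctrl t te; rewrite c1.
by have -> : (fun j => 1 * pairing (p t) (V j (y t))) = (fun j => pairing (p t) (V j (y t)))
  by apply/funext => j; rewrite mul1r.
Qed.

End hamiltonian_flow.

(** * Taylor expansion along the Hamiltonian flow *)

Lemma sum_const_ord {R : realType} m (a : R) : \sum_(i < m) a = m%:R * a.
Proof. by rewrite sumr_const card_ord mulr_natl. Qed.

Section taylor.
Context {R : realType} {n k : nat}.
Variables (U : set 'rV[R]_n) (V : 'I_k -> 'rV[R]_n -> 'rV[R]_n)
  (x0 : 'rV[R]_n) (r : R).
Hypotheses (oU : open U) (sV : forall j, smooth_field U (V j))
  (KU : cube x0 r `<=` U).
Implicit Types (y p : R -> 'rV[R]_n) (T t : R) (f : 'rV[R]_n -> R)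
  (W : 'rV[R]_n -> 'rV[R]_n) (g : (R -> 'rV[R]_n) -> (R -> 'rV[R]_n) -> R -> R).

Definition hamiltonian_arc y p T := [/\ 0 <= T <= 1,
  forall t, 0 <= t <= T -> cube x0 r (y t) /\
    controlled V (fun j => pairing (p t) (V j (y t))) y p t &
  \sum_j pairing (p 0) (V j (y 0)) ^+ 2 = 1].

Lemma energy_arc y p T t : hamiltonian_arc y p T -> 0 <= t <= T ->
  \sum_j pairing (p t) (V j (y t)) ^+ 2 = 1.
Proof.
move=> [_ hc E0] /andP[t0 tT].
have dc (s : R) : is_derive s 1 (cst (0 : R)) (0 : R) by exact: is_derive_cst.
have hs (s : R) : 0 <= s <= t ->
    is_derive s 1 (fun s => \sum_i pairing (p s) (V i (y s)) ^+ 2) 0.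
  move=> /andP[s0 st].
  have [Ks cs] : cube x0 r (y s) /\
    controlled V (fun j => pairing (p s) (V j (y s))) y p s.
    by apply: hc; rewrite s0 (le_trans st).
  apply: (@derive_energy _ _ _ _ _ _ _ 1); last first.
    by move=> j i; apply: (smooth_differentiable oU (sV j i)); exact: KU.
  have -> : (fun j => 1 * pairing (p s) (V j (y s))) = (fun j => pairing (p s) (V j (y s)))
    by apply/funext => j; rewrite mul1r.
  exact: cs.
have := @mean_value_le R _ (fun=> 0) (cst 0) (fun=> 0) 0 t t0 hs (fun s _ => dc s).
rewrite E0 subrr normr0 => /(_ (fun _ _ => lexx _)).
by rewrite normr_le0 subr_eq0 => /eqP.
Qed.

Let sqr_le_abs (a b : R) : 0 <= b -> a ^+ 2 <= b ^+ 2 -> `|a| <= b.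
Proof.
by move=> b0 h; rewrite -(@ler_sqr _ `|a| b) ?nnegrE // real_normK ?num_real.
Qed.

Lemma component_arc y p T t j : hamiltonian_arc y p T -> 0 <= t <= T ->
  `|pairing (p t) (V j (y t))| <= 1.
Proof.
move=> harc ht; have := energy_arc harc ht; rewrite (bigD1 j) //= => E.
apply: sqr_le_abs => //; rewrite expr1n.
by rewrite -E lerDl; apply: sumr_ge0 => i _; exact: sqr_ge0.
Qed.

Lemma smooth_bounded_cube f : smooth_Rn U f ->
  exists2 C, 0 <= C & forall x, cube x0 r x -> `|f x| <= C.
Proof.
move=> sf; apply: compact_bounded_fun; first exact: cube_compact.
by move=> x /KU Ux; exact: (Ck_continuous (sf 0%N) Ux).
Qed.

(** The momentum equation is linear in the momentum, with bounded
    coefficients; hence the momentum grows at most by a constant factor. *)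
Lemma momentum_arc : exists2 C, 0 <= C & forall y p T, hamiltonian_arc y p T ->
  forall t, 0 <= t <= T -> forall i, `|p t ord0 i| <= C * (1 + `|p 0|).
Proof.
have [|C C0 hC] := @bounded_family R ('I_k * 'I_n * 'I_n)%type _ (cube x0 r)
    (fun jim => pd jim.1.2 (fun x => V jim.1.1 x ord0 jim.2)).
  by move=> [[j i] m]; apply: smooth_bounded_cube; apply: smooth_pd; exact: sV.
pose A := n%:R * (2 * (k%:R * (n%:R * C))).
have A0 : 0 <= A by rewrite !mulr_ge0.
have eA : 1 <= expR A by rewrite -expR0 ler_expR.
exists (expR A * (n%:R + 1)); first by rewrite mulr_ge0 ?expR_ge0 // addr_ge0.
move=> y p T harc t ht i; have [T01 hc _] := harc.
(* Gronwall's inequality for the square of the Euclidean norm of [p] *)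
pose Q s := \sum_i p s ord0 i * p s ord0 i.
pose pd' s i := - \sum_j pairing (p s) (V j (y s)) *
   \sum_m p s ord0 m * pd i (fun x => V j x ord0 m) (y s).
pose Q' s := \sum_i (pd' s i * p s ord0 i + p s ord0 i * pd' s i).
have sub s : 0 <= s <= t -> 0 <= s <= T.
  by move=> /andP[s0 st]; rewrite s0 /=; apply: le_trans st _; case/andP: ht.
have dQ (s : R) : 0 <= s <= t -> is_derive s 1 Q (Q' s).
  move=> hs; have [_ cs] := hc s (sub s hs).
  by apply: is_derive_sumr => m _; apply: is_derive_mul; exact: (cs m).2.
have Q_ge s m : p s ord0 m * p s ord0 m <= Q s.
  rewrite /Q (bigD1 m) //= lerDl; apply: sumr_ge0 => l _; exact: sqr_ge0.
have Q0 s : 0 <= Q s by apply: sumr_ge0 => l _; exact: sqr_ge0.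
have pp_le s l m : `|p s ord0 l| * `|p s ord0 m| <= Q s.
  have h1 := Q_ge s l; have h2 := Q_ge s m.
  have : 0 <= (`|p s ord0 l| - `|p s ord0 m|) ^+ 2 by exact: sqr_ge0.
  rewrite sqrrB !real_normK ?num_real // !expr2 mulr2n; lra.
have bQ s : 0 <= s <= t -> Q' s <= A * Q s.
  move=> hs; have hsT := sub s hs; have [Ks _] := hc s hsT.
  have -> : A * Q s = \sum_(i < n) (2 * \sum_(j < k) \sum_(m < n) (C * Q s)).
    by rewrite !sum_const_ord /A; ring.
  apply: ler_sum => l _.
  have -> : pd' s l * p s ord0 l + p s ord0 l * pd' s l = 2 * (pd' s l * p s ord0 l) by ring.
  apply: ler_wpM2l => //; apply: le_trans (ler_norm _) _.
  rewrite /pd' mulNr normrN mulr_suml; apply: le_trans (ler_norm_sum _ _ _) _.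
  apply: ler_sum => j _; rewrite mulr_sumr mulr_suml.
  apply: le_trans (ler_norm_sum _ _ _) _; apply: ler_sum => m _.
  have -> : pairing (p s) (V j (y s)) * (p s ord0 m * pd l (fun x => V j x ord0 m) (y s))
     * p s ord0 l = (pairing (p s) (V j (y s)) * pd l (fun x => V j x ord0 m) (y s))
       * (p s ord0 m * p s ord0 l) by ring.
  rewrite normrM; apply: ler_pM => //; last by rewrite normrM.
  rewrite normrM -[leRHS]mul1r; apply: ler_pM => //; first exact: component_arc hsT.
  exact: (hC (j, l, m)).
have [t0 tT] := andP ht.
have dE (s : R) : is_derive s 1 (fun s => expR (- A * s)) (expR (- A * s) * - A).
  have d1 := is_derive_mull (- A) (is_derive_id s (1 : R)).
  rewrite mulr1 in d1.
  exact: (@is_derive1_comp R expR (fun s => - A * s) s _ _ (is_derive_expR _) d1).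
have dD (s : R) : 0 <= s <= t ->
    is_derive s 1 (fun s => Q s * expR (- A * s)) ((Q' s - A * Q s) * expR (- A * s)).
  by move=> hs; apply: is_derive_eq (is_derive_mul (dQ s hs) (dE s)) _; ring.
have Dle : Q t * expR (- A * t) <= Q 0 * expR (- A * 0).
  apply: (nonpos_derive_le t0 dD) => s hs.
  by rewrite mulr_le0_ge0 ?expR_ge0 // subr_le0 bQ.
have Qt : Q t <= Q 0 * expR A.
  have -> : Q t = Q t * expR (- A * t) * expR (A * t).
    by rewrite -mulrA -expRD mulNr addNr expR0 mulr1.
  apply: (@le_trans _ _ (Q 0 * expR (A * t))).
    by apply: ler_wpM2r; [exact: expR_ge0 | rewrite mulr0 expR0 mulr1 in Dle].
  apply: ler_wpM2l => //; rewrite ler_expR ler_piMr //.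
  by apply: le_trans tT _; case/andP: T01.
have Q0n : Q 0 <= n%:R * `|p 0| ^+ 2.
  have -> : n%:R * `|p 0| ^+ 2 = \sum_(i < n) `|p 0| * `|p 0|.
    by rewrite sum_const_ord expr2.
  apply: ler_sum => l _.
  have -> : p 0 ord0 l * p 0 ord0 l = `|p 0 ord0 l| * `|p 0 ord0 l|.
    by rewrite -!expr2 real_normK ?num_real.
  by apply: ler_pM => //; exact: coord_norm_le.
apply: sqr_le_abs.
  by rewrite !mulr_ge0 ?expR_ge0 ?addr_ge0.
apply: le_trans (Q_ge t i) _; apply: le_trans Qt _.
apply: (@le_trans _ _ (n%:R * `|p 0| ^+ 2 * expR A)).
  by apply: ler_wpM2r => //; exact: expR_ge0.
rewrite !exprMn.
have a1 : n%:R <= (n%:R + 1) ^+ 2 :> R.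
  have : 0 <= n%:R :> R by [].
  move=> H; rewrite sqrrD expr1n mulr1 mulr2n; have := sqr_ge0 (n%:R : R); lra.
have a2 : `|p 0| ^+ 2 <= (1 + `|p 0|) ^+ 2.
  by rewrite ler_sqr ?nnegrE ?addr_ge0 // lerDr.
have a3 : expR A <= expR A ^+ 2 by rewrite expr2 ler_peMr // expR_ge0.
rewrite [leLHS]mulrC -[leRHS]mulrA; apply: (ler_pM (expR_ge0 _) _ a3).
  by rewrite mulr_ge0 // sqr_ge0.
by apply: (ler_pM _ (sqr_ge0 _) a1 a2).
Qed.

(** The constant is uniform in the arc; only the initial momentum enters the
    bound. *)
Definition order d g := exists2 C, 0 <= C & forall y p T,
  hamiltonian_arc y p T -> forall t, 0 <= t <= T ->
  `|g y p t| <= C * (1 + `|p 0|) ^+ d.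

Definition derives g g' := forall y p T, hamiltonian_arc y p T ->
  forall t, 0 <= t <= T -> is_derive t 1 (g y p) (g' y p t).

(** Differentiation along the flow costs one more power of the momentum. *)
Definition tame d g := order d g /\ exists2 g', derives g g' & order d.+1 g'.

Lemma order_le d e g : (d <= e)%N -> order d g -> order e g.
Proof.
move=> de [C C0 hC]; exists C => // y p T harc t ht.
apply: le_trans (hC y p T harc t ht) _; apply: ler_wpM2l => //.
by apply: ler_weXn2l => //; rewrite lerDl.
Qed.

Lemma order_add d g h : order d g -> order d h ->
  order d (fun y p t => g y p t + h y p t).
Proof.
move=> [C C0 hC] [D D0 hD]; exists (C + D); first exact: addr_ge0.
move=> y p T harc t ht; rewrite mulrDl; apply: le_trans (ler_normD _ _) _.
exact: lerD (hC y p T harc t ht) (hD y p T harc t ht).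
Qed.

Lemma order_mul d e g h : order d g -> order e h ->
  order (d + e) (fun y p t => g y p t * h y p t).
Proof.
move=> [C C0 hC] [D D0 hD]; exists (C * D); first exact: mulr_ge0.
move=> y p T harc t ht; rewrite exprD mulrACA normrM.
by apply: ler_pM => //; [exact: hC harc t ht | exact: hD harc t ht].
Qed.

Lemma order0 d : order d (fun _ _ _ => 0).
Proof.
by exists 0 => // y p T _ t _; rewrite normr0 mul0r.
Qed.

Lemma order_sum d (I : Type) (s : seq I)
    (g : I -> (R -> 'rV[R]_n) -> (R -> 'rV[R]_n) -> R -> R) :
  (forall i, order d (g i)) -> order d (fun y p t => \sum_(i <- s) g i y p t).
Proof.
move=> h; elim: s => [|i s IH].
  have -> : (fun y p t => \sum_(i <- [::]) g i y p t) = (fun _ _ _ => 0).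
    by apply/funext => y; apply/funext => p; apply/funext => t; rewrite big_nil.
  exact: order0.
have -> : (fun y p t => \sum_(i <- i :: s) g i y p t) =
   (fun y p t => g i y p t + \sum_(i <- s) g i y p t).
  by apply/funext => y; apply/funext => p; apply/funext => t; rewrite big_cons.
exact: order_add.
Qed.

Lemma tame_le d e g : (d <= e)%N -> tame d g -> tame e g.
Proof.
move=> de [h1 [g' dg h2]]; split; first exact: order_le h1.
by exists g' => //; apply: order_le h2.
Qed.

Lemma tame_add d g h : tame d g -> tame d h ->
  tame d (fun y p t => g y p t + h y p t).
Proof.
move=> [og [g' dg og']] [oh [h' dh oh']]; split; first exact: order_add.
exists (fun y p t => g' y p t + h' y p t); last exact: order_add.
by move=> y p T harc t ht; apply: is_derive_add; [exact: dg harc t ht | exact: dh harc t ht].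
Qed.

Lemma tame_mul d e g h : tame d g -> tame e h ->
  tame (d + e) (fun y p t => g y p t * h y p t).
Proof.
move=> [og [g' dg og']] [oh [h' dh oh']]; split; first exact: order_mul.
exists (fun y p t => g' y p t * h y p t + g y p t * h' y p t).
  by move=> y p T harc t ht; apply: is_derive_mul; [exact: dg harc t ht | exact: dh harc t ht].
apply: order_add; first by rewrite -addSn; exact: order_mul.
by rewrite -addnS; exact: order_mul.
Qed.

Lemma derives_sum (I : Type) (s : seq I)
    (g g' : I -> (R -> 'rV[R]_n) -> (R -> 'rV[R]_n) -> R -> R) :
  (forall i, derives (g i) (g' i)) ->
  derives (fun y p t => \sum_(i <- s) g i y p t) (fun y p t => \sum_(i <- s) g' i y p t).
Proof.
by move=> h y p T harc t ht; apply: is_derive_sumr => i _; exact: h harc t ht.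
Qed.

Lemma tame_sum d (I : Type) (s : seq I)
    (g : I -> (R -> 'rV[R]_n) -> (R -> 'rV[R]_n) -> R -> R) :
  (forall i, tame d (g i)) -> tame d (fun y p t => \sum_(i <- s) g i y p t).
Proof.
move=> h; split; first by apply: order_sum => i; have [] := h i.
pose g' i := projT1 (cid2 (h i).2).
exists (fun y p t => \sum_(i <- s) g' i y p t).
  by apply: derives_sum => i; rewrite /g'; case: cid2.
by apply: order_sum => i; rewrite /g'; case: cid2.
Qed.

Definition along f : (R -> 'rV[R]_n) -> (R -> 'rV[R]_n) -> R -> R :=
  fun y _ t => f (y t).

Definition momentum W : (R -> 'rV[R]_n) -> (R -> 'rV[R]_n) -> R -> R :=
  fun y p t => pairing (p t) (W (y t)).

Lemma order_along f : smooth_Rn U f -> order 0 (along f).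
Proof.
move=> /smooth_bounded_cube[C C0 hC]; exists C => // y p T [_ hc _] t ht.
by rewrite expr0 mulr1; apply: hC; have [] := hc t ht.
Qed.

Lemma order_momentum W : smooth_field U W -> order 1 (momentum W).
Proof.
move=> sW; have [D D0 hD] := momentum_arc.
have [|C C0 hC] := @bounded_family R 'I_n _ (cube x0 r) (fun i x => W x ord0 i).
  by move=> i; apply: smooth_bounded_cube; exact: sW.
exists (n%:R * (D * C)); first by rewrite !mulr_ge0.
move=> y p T harc t ht; have [_ hc _] := harc.
apply: le_trans (ler_norm_sum _ _ _) _; rewrite expr1.
have -> : n%:R * (D * C) * (1 + `|p 0|) = \sum_(i < n) D * (1 + `|p 0|) * C.
  by rewrite sum_const_ord; ring.
apply: ler_sum => i _; rewrite normrM; apply: ler_pM => //; first exact: hD harc t ht i.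
by apply: (hC i); have [] := hc t ht.
Qed.

Lemma order_component j : order 0 (momentum (V j)).
Proof.
exists 1 => // y p T harc t ht; rewrite mul1r expr0; exact: component_arc harc ht.
Qed.

Lemma derives_along f : smooth_Rn U f -> derives (along f)
  (fun y p t => \sum_j momentum (V j) y p t * along (lieD (V j) f) y p t).
Proof.
move=> sf y p T [_ hc _] t ht; have [Kt ct] := hc t ht.
by apply: derive_along ct _; apply: (smooth_differentiable oU sf); exact: KU.
Qed.

Lemma derives_momentum W : smooth_field U W -> derives (momentum W)
  (fun y p t => \sum_j momentum (V j) y p t * momentum (bracket (V j) W) y p t).
Proof.
move=> sW y p T [_ hc _] t ht; have [Kt ct] := hc t ht.
apply: derive_momentum ct _ => i.
by apply: (smooth_differentiable oU (sW i)); exact: KU.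
Qed.

Lemma tame_along f : smooth_Rn U f -> tame 0 (along f).
Proof.
move=> sf; split; first exact: order_along.
eexists; first exact: derives_along.
apply: (@order_le 0) => //; apply: order_sum => j.
apply: (@order_mul 0 0); first exact: order_component.
by apply: order_along; exact: smooth_lieD.
Qed.

Let order_dmomentum W : smooth_field U W -> order 1
  (fun y p t => \sum_j momentum (V j) y p t * momentum (bracket (V j) W) y p t).
Proof.
move=> sW; apply: order_sum => j; apply: (@order_mul 0 1); first exact: order_component.
by apply: order_momentum; exact: smooth_bracket.
Qed.

Lemma tame_momentum W : smooth_field U W -> tame 1 (momentum W).
Proof.
move=> sW; split; first exact: order_momentum.
by eexists; [exact: derives_momentum | apply: (@order_le 1) => //; exact: order_dmomentum].
Qed.

Lemma tame_component j : tame 0 (momentum (V j)).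
Proof.
split; first exact: order_component.
by eexists; [apply: derives_momentum; exact: sV | apply: order_dmomentum; exact: sV].
Qed.

(** The first two derivatives of [f] along the flow, as functions of the
    position and momentum, by [derive_along] and [derive_momentum]. *)
Definition flow_derive1 f x (l : 'rV[R]_n) : R :=
  \sum_i pairing l (V i x) * lieD (V i) f x.

Definition flow_derive2 f x (l : 'rV[R]_n) : R :=
  \sum_i ((\sum_j pairing l (V j x) * pairing l (bracket (V j) (V i) x)) * lieD (V i) f x
    + pairing l (V i x) * \sum_j pairing l (V j x) * lieD (V j) (lieD (V i) f) x).

Lemma derives_flow1 f : smooth_Rn U f ->
  derives (along f) (fun y p t => flow_derive1 f (y t) (p t)).
Proof. exact: derives_along. Qed.

Lemma derives_flow2 f : smooth_Rn U f ->
  derives (fun y p t => flow_derive1 f (y t) (p t))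
          (fun y p t => flow_derive2 f (y t) (p t)).
Proof.
move=> sf; apply: derives_sum => i y p T harc t ht; apply: is_derive_mul.
  by have := derives_momentum (sV i) harc ht.
by have := derives_along (smooth_lieD oU (sV i) sf) harc ht.
Qed.

Lemma tame_flow2 f : smooth_Rn U f -> tame 1 (fun y p t => flow_derive2 f (y t) (p t)).
Proof.
move=> sf; apply: tame_sum => i; apply: tame_add.
  apply: (@tame_mul 1 0); last by apply: tame_along; exact: smooth_lieD.
  apply: tame_sum => j; apply: (@tame_mul 0 1); first exact: tame_component.
  by apply: tame_momentum; exact: smooth_bracket.
apply: (@tame_le 0) => //; apply: (@tame_mul 0 0); first exact: tame_component.
apply: tame_sum => j; apply: (@tame_mul 0 0); first exact: tame_component.
by apply: tame_along; do 2 apply: smooth_lieD => //.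
Qed.

(** By [tame_flow2] the third derivative of [f] along an arc is
    [O((1 + |p 0|)^2)]; this is integrated three times. *)
Lemma arc_taylor f : smooth_Rn U f -> exists2 C, 0 <= C & forall y p T,
  hamiltonian_arc y p T ->
  `|f (y T) - f (y 0) - T * flow_derive1 f (y 0) (p 0)
    - T ^+ 2 / 2 * flow_derive2 f (y 0) (p 0)| <= C * T ^+ 3 * (1 + `|p 0|) ^+ 2.
Proof.
move=> sf; have [_ [F3 dF3 [C C0 hC]]] := tame_flow2 sf.
exists C => // y p T harc; have [/andP[T0 T1] _ _] := harc.
pose f1 s := flow_derive1 f (y s) (p s).
pose f2 s := flow_derive2 f (y s) (p s).
pose B := C * (1 + `|p 0|) ^+ 2.
have B0 : 0 <= B by rewrite mulr_ge0 // sqr_ge0.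
have sub s t : 0 <= t <= T -> 0 <= s <= t -> 0 <= s <= T.
  by move=> /andP[_ tT] /andP[s0 st]; rewrite s0 (le_trans st).
have dlin (a s : R) : is_derive s 1 (fun s => a * s) a.
  by apply: is_derive_eq (is_derive_mull a (is_derive_id s (1 : R))) _; rewrite mulr1.
have dsq (s : R) : is_derive s 1 (fun s => s ^+ 2) (2 * s).
  have -> : (fun s : R => s ^+ 2) = (fun s => s * s) by apply/funext => u; rewrite expr2.
  have d1 := is_derive_id s (1 : R).
  by apply: is_derive_eq (is_derive_mul d1 d1) _; rewrite mul1r mulr1 mulr2n mulrDl mul1r.
have dcub (s : R) : is_derive s 1 (fun s => s ^+ 3) (3 * s ^+ 2).
  have -> : (fun s : R => s ^+ 3) = (fun s => s * s ^+ 2) by apply/funext => u; rewrite exprS.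
  by apply: is_derive_eq (is_derive_mul (is_derive_id s (1 : R)) (dsq s)) _; ring.
have e2 t : 0 <= t <= T -> `|f2 t - f2 0| <= B * t.
  move=> ht; have t0 : 0 <= t by case/andP: ht.
  have := @mean_value_le R f2 (F3 y p) (fun s => B * s) (fun=> B) 0 t t0
    (fun s hs => dF3 y p T harc s (sub s t ht hs)) (fun s _ => dlin B s).
  rewrite mulr0 subr0; apply => s hs; exact: hC harc s (sub s t ht hs).
have e1 t : 0 <= t <= T -> `|f1 t - f1 0 - t * f2 0| <= B * t ^+ 2.
  move=> ht; have t0 : 0 <= t by case/andP: ht.
  have d1 (s : R) : 0 <= s <= t -> is_derive s 1 (fun s => f1 s + - f2 0 * s) (f2 s + - f2 0).
    by move=> hs; apply: is_derive_add (dlin _ s); exact: derives_flow2 sf _ _ _ harc s (sub s t ht hs).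
  have d2 (s : R) : 0 <= s <= t -> is_derive s 1 (fun s => B * s ^+ 2) (B * (2 * s)).
    by move=> _; exact: is_derive_mull.
  have := mean_value_le t0 d1 d2.
  rewrite mulr0 addr0 expr0n mulr0 subr0 => h.
  apply: le_trans (h _); last first.
    move=> s hs; apply: le_trans (e2 s (sub s t ht hs)) _.
    apply: ler_wpM2l => //; case/andP: hs => s0 _; lra.
  by rewrite le_eqVlt; apply/orP; left; apply/eqP; congr (`|_|); ring.
have d1 (s : R) : 0 <= s <= T ->
    is_derive s 1 (fun s => f (y s) + (- f1 0 * s + - (f2 0 / 2) * s ^+ 2))
      (f1 s + (- f1 0 + - (f2 0 / 2) * (2 * s))).
  move=> hs; exact: (is_derive_add (derives_flow1 sf harc hs)
    (is_derive_add (dlin (- f1 0) s) (is_derive_mull _ (dsq s)))).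
have d2 (s : R) : 0 <= s <= T -> is_derive s 1 (fun s => B * s ^+ 3) (B * (3 * s ^+ 2)).
  by move=> _; exact: is_derive_mull.
have := mean_value_le T0 d1 d2.
rewrite !expr0n /= !mulr0 !addr0 subr0 => h.
have -> : C * T ^+ 3 * (1 + `|p 0|) ^+ 2 = B * T ^+ 3 by rewrite /B; ring.
apply: le_trans (h _); last first.
  move=> s hs; have -> : f1 s + (- f1 0 + - (f2 0 / 2) * (2 * s)) = f1 s - f1 0 - s * f2 0.
    by field.
  apply: le_trans (e1 s hs) _; apply: ler_wpM2l => //.
  by have := sqr_ge0 s; lra.
rewrite le_eqVlt; apply/orP; left; apply/eqP; congr (`|_|).
by rewrite /f1 /f2; field.
Qed.

(** The velocity is [sum_j h_j V_j] with [|h_j| <= 1] by conservation of the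
    energy, whatever the size of the momentum. *)
Lemma arc_speed : exists2 C, 0 <= C & forall y p T, hamiltonian_arc y p T ->
  `|y T - y 0| <= C * T.
Proof.
have /choice[C hC] : forall i : 'I_n, exists c, 0 <= c /\ forall y p T,
    hamiltonian_arc y p T -> `|y T ord0 i - y 0 ord0 i| <= c * T.
  move=> i.
  have sc := @smooth_coord R n U i.
  have [|c c0 hc] := @order_sum 0 _ (index_enum _)
    (fun j y p t => momentum (V j) y p t * along (lieD (V j) (fun x => x ord0 i)) y p t).
    move=> j; apply: (@order_mul 0 0); first exact: order_component.
    by apply: order_along; exact: smooth_lieD.
  exists c; split=> // y p T harc; have [/andP[T0 _] _ _] := harc.
  have dl (s : R) : 0 <= s <= T -> is_derive s 1 (fun s => c * s) c.
    move=> _; apply: is_derive_eq (is_derive_mull c (is_derive_id s (1 : R))) _.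
    by rewrite mulr1.
  have := mean_value_le T0 (fun s hs => derives_along sc harc hs) dl.
  rewrite mulr0 subr0; apply => s hs.
  by have := hc y p T harc s hs; rewrite expr0 mulr1.
exists (\sum_i C i); first by apply: sumr_ge0 => i _; have [] := hC i.
move=> y p T harc; have [/andP[T0 _] _ _] := harc.
have S0 : 0 <= \sum_i C i by apply: sumr_ge0 => i _; have [] := hC i.
apply: rV_norm_le => [|i]; first exact: mulr_ge0.
rewrite rV_subE; apply: le_trans ((hC i).2 _ _ _ harc) _; apply: ler_wpM2r => //.
by rewrite (bigD1 i) //= lerDl; apply: sumr_ge0 => j _; have [] := hC j.
Qed.

End taylor.

(** * Charts and tangent vectors *)

Section bracket_derivation.
Context {R : realType} {n : nat}.
Implicit Types (f : 'rV[R]_n -> R) (U : set 'rV[R]_n) (x : 'rV[R]_n)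
  (V W : 'rV[R]_n -> 'rV[R]_n).

Let derive_lieD U V W f x : open U -> Ck 2 U f -> U x ->
  (forall a, differentiable (fun y => W y ord0 a) x) ->
  lieD V (lieD W f) x = \sum_i V x ord0 i * \sum_a
    (W x ord0 a * pd i (pd a f) x + pd a f x * pd i (fun y => W y ord0 a) x).
Proof.
move=> oU Cf Ux dW; apply: eq_bigr => i _; congr (_ * _).
have df a : derivable (pd a f) x (basis_vec i).
  have C1 : Ck 1 U (pd a f) := Ck_pd a Cf.
  exact: (@Ck_derivable _ _ 0 U _ x i C1 Ux).
have dWa a : derivable (fun y => W y ord0 a) x (basis_vec i) by exact: diff_derivable.
have [_ ->] := @pd_sum R n i _ (index_enum _) xpredT (fun a y => W y ord0 a * pd a f y) x
  (fun a _ => derivableM (dWa a) (df a)).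
by apply: eq_bigr => a _; exact: (pdM (dWa a) (df a)).
Qed.

(** The second derivatives of [f] cancel by [pd_comm]. *)
Lemma lieD_bracket U V W f x : open U -> Ck 2 U f -> U x ->
  (forall a, differentiable (fun y => V y ord0 a) x) ->
  (forall a, differentiable (fun y => W y ord0 a) x) ->
  lieD (bracket V W) f x = lieD V (lieD W f) x - lieD W (lieD V f) x.
Proof.
move=> oU Cf Ux dV dW; rewrite (derive_lieD _ oU Cf Ux dW) (derive_lieD _ oU Cf Ux dV).
have E (P Q : 'rV[R]_n -> 'rV[R]_n) : \sum_i P x ord0 i * \sum_a
    (Q x ord0 a * pd i (pd a f) x + pd a f x * pd i (fun y => Q y ord0 a) x) =
  \sum_i \sum_a P x ord0 i * Q x ord0 a * pd i (pd a f) x +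
  \sum_a lieD P (fun y => Q y ord0 a) x * pd a f x.
  transitivity (\sum_i \sum_a P x ord0 i * Q x ord0 a * pd i (pd a f) x +
     \sum_i \sum_a P x ord0 i * pd i (fun y => Q y ord0 a) x * pd a f x).
    rewrite -big_split /=; apply: eq_bigr => i _.
    rewrite mulr_sumr -big_split /=; apply: eq_bigr => a _.
    by rewrite mulrDr mulrA [pd a f x * _]mulrC mulrA.
  congr (_ + _); rewrite exchange_big /=; apply: eq_bigr => a _.
  by rewrite /lieD mulr_suml.
rewrite !E.
have -> : \sum_i \sum_a W x ord0 i * V x ord0 a * pd i (pd a f) x =
          \sum_i \sum_a V x ord0 i * W x ord0 a * pd i (pd a f) x.
  rewrite exchange_big /=; apply: eq_bigr => i _; apply: eq_bigr => a _.
  by rewrite (pd_comm _ _ oU Cf Ux) [W x _ _ * _]mulrC.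
rewrite opprD addrACA subrr add0r -sumrB; apply: eq_bigr => a _.
by rewrite mxE mulrBl.
Qed.

End bracket_derivation.

Section charts.
Context {R : realType} {n : nat} {M : topologicalType} (A : manifold R n M).
Implicit Types (c : chart R n M) (q : M) (U : set M) (v : 'rV[R]_n).

Lemma chart_image_open c U : open U -> open (c @` (cdom c `&` U)).
Proof.
move=> oU; rewrite openE => x [q [cq Uq] <-].
have h1 : nbhs (c q) (c @` cdom c).
  by apply: open_nbhs_nbhs; split; [exact: cimg_open | exists q].
have h2 : nbhs (c q) (cinv c @^-1` U).
  have := cinv_continuous cq; rewrite /prop_for /continuous_at cmapK // => cc.
  by apply: cc; exact: open_nbhs_nbhs.
apply: filterS2 h1 h2 => y [q' cq' <-]; rewrite /= cmapK // => Uq'.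
by exists q'.
Qed.

(** The derivative at [q] of the transition map from [c] to [c'].  Tangent and
    cotangent coordinates are all expressed with it. *)
Definition jac c c' q v := 'D_v (fun x => c' (cinv c x)) (c q).

Section transition.
Variables (c c' : chart R n M) (q : M).
Hypotheses (hc : atlas A c) (hc' : atlas A c') (cq : cdom c q) (c'q : cdom c' q).

Lemma transition_dom_open : open (c @` (cdom c `&` cdom c')).
Proof. exact/chart_image_open/cdom_open. Qed.

Lemma transition_dom : (c @` (cdom c `&` cdom c')) (c q).
Proof. by exists q. Qed.

Lemma transition_differentiable i :
  differentiable (fun x => c' (cinv c x) ord0 i) (c q).
Proof.
apply: smooth_differentiable transition_dom_open _ transition_dom.
exact: (transition_smooth hc hc').
Qed.

Lemma transition_differentiable_rV : differentiable (fun x => c' (cinv c x)) (c q).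
Proof. exact: (differentiable_rV transition_differentiable). Qed.

Lemma jacE v : jac c c' q v = 'd (fun x => c' (cinv c x)) (c q) v.
Proof. by rewrite /jac deriveE //; exact: transition_differentiable_rV. Qed.

Lemma jac_linear (a : R) v w : jac c c' q (a *: v + w) = a *: jac c c' q v + jac c c' q w.
Proof. by rewrite !jacE linearP. Qed.

Lemma jac_coord v i : jac c c' q v ord0 i = 'D_v (fun x => c' (cinv c x) ord0 i) (c q).
Proof.
rewrite /jac derive_mx ?mxE //; apply: diff_derivable.
exact: transition_differentiable_rV.
Qed.

Lemma jac_coordE v i :
  jac c c' q v ord0 i = \sum_m v ord0 m * pd m (fun x => c' (cinv c x) ord0 i) (c q).
Proof. by rewrite jac_coord derive_pd //; exact: transition_differentiable. Qed.

End transition.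

Lemma near_chart c c' q : cdom c q -> cdom c' q ->
  \forall x \near c q, exists2 p, cdom c p /\ cdom c' p & x = c p.
Proof.
move=> cq c'q; have := @transition_dom_open c c'; move=> oD.
have : nbhs (c q) (c @` (cdom c `&` cdom c')).
  by apply: open_nbhs_nbhs; split=> //; exists q.
by apply: filterS => x [p [h1 h2] <-]; exists p.
Qed.

Lemma jac_comp c c' c'' q v : atlas A c -> atlas A c' -> atlas A c'' ->
  cdom c q -> cdom c' q -> cdom c'' q ->
  jac c' c'' q (jac c c' q v) = jac c c'' q v.
Proof.
move=> hc hc' hc'' cq c'q c''q.
have d1 := transition_differentiable_rV hc hc' cq c'q.
have d2 := transition_differentiable_rV hc' hc'' c'q c''q.
have E : cinv c (c q) = q by rewrite cmapK.
have d2' : differentiable (fun x => c'' (cinv c' x)) (c' (cinv c (c q))) by rewrite E.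
transitivity ('D_v ((fun x => c'' (cinv c' x)) \o (fun x => c' (cinv c x))) (c q)).
  rewrite deriveE; last exact: differentiable_comp.
  by rewrite diff_comp //= E (jacE hc' hc'' c'q c''q) (jacE hc hc' cq c'q).
apply: near_eq_derive; have := near_chart cq c'q.
by apply: filterS => x [p [cp c'p] ->] /=; rewrite !cmapK.
Qed.

Lemma jac_id c q v : cdom c q -> jac c c q v = v.
Proof.
move=> cq; rewrite -[RHS](derive_id (c q) v).
apply: near_eq_derive; have := near_chart cq cq.
by apply: filterS => x [p [cp c'p] ->] /=; rewrite !cmapK.
Qed.

Let ca q := chart_at A q.

Lemma tangent_coordE c q v : tangent_coord A c q v = jac (ca q) c q v.
Proof. by []. Qed.

Lemma coord_fieldE c q i : coord_field A c i q = jac c (ca q) q (basis_vec i).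
Proof. by []. Qed.

Section at_point.
Variables (c : chart R n M) (q : M).
Hypotheses (hc : atlas A c) (cq : cdom c q).
Let hca : atlas A (ca q). Proof. exact: chart_at_atlas. Qed.
Let caq : cdom (ca q) q. Proof. exact: chart_at_dom. Qed.

Lemma tangent_coord_linear (a : R) v w :
  tangent_coord A c q (a *: v + w) = a *: tangent_coord A c q v + tangent_coord A c q w.
Proof. exact: (jac_linear hca hc). Qed.

Lemma tangent_coord0 : tangent_coord A c q 0 = 0.
Proof.
have := tangent_coord_linear 1 0 0; rewrite !scale1r addr0.
by move/(congr1 (fun u => u - tangent_coord A c q 0)); rewrite subrr addrK => <-.
Qed.

Lemma tangent_coordZ (a : R) v : tangent_coord A c q (a *: v) = a *: tangent_coord A c q v.
Proof. by have := tangent_coord_linear a v 0; rewrite tangent_coord0 !addr0. Qed.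

Lemma tangent_coordD v w :
  tangent_coord A c q (v + w) = tangent_coord A c q v + tangent_coord A c q w.
Proof. by have := tangent_coord_linear 1 v w; rewrite !scale1r. Qed.

Lemma tangent_coord_sum (I : Type) (s : seq I) (P : pred I) (v : I -> 'rV[R]_n) :
  tangent_coord A c q (\sum_(i <- s | P i) v i) =
  \sum_(i <- s | P i) tangent_coord A c q (v i).
Proof.
elim/big_rec2: _ => [|i x y _ <-]; first exact: tangent_coord0.
exact: tangent_coordD.
Qed.

Lemma tangent_coord_inj v w : tangent_coord A c q v = tangent_coord A c q w -> v = w.
Proof.
by move=> /(congr1 (jac c (ca q) q)); rewrite !tangent_coordE !jac_comp // !jac_id.
Qed.

Lemma tangent_coordK v : jac c (ca q) q (tangent_coord A c q v) = v.
Proof. by rewrite tangent_coordE jac_comp // jac_id. Qed.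

Lemma tangent_coord_field i : tangent_coord A c q (coord_field A c i q) = basis_vec i.
Proof. by rewrite tangent_coordE coord_fieldE jac_comp // jac_id. Qed.

Lemma tangent_coord_span v :
  v = \sum_i tangent_coord A c q v ord0 i *: coord_field A c i q.
Proof.
apply: tangent_coord_inj; rewrite tangent_coord_sum.
under eq_bigr do rewrite tangent_coordZ tangent_coord_field.
exact: row_sum_delta.
Qed.

Lemma pairing_covector p v : pairing (covector A c q p) v = pairing p (tangent_coord A c q v).
Proof.
rewrite [in RHS](row_sum_delta v) tangent_coord_sum pairing_sumr.
by apply: eq_bigr => j _; rewrite mxE tangent_coordZ pairingZr mulrC.
Qed.

Lemma pairing_covector_coord l v :
  pairing (covector_coord A c q l) (tangent_coord A c q v) = pairing l v.
Proof.
rewrite [in RHS](tangent_coord_span v) pairing_sumr.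
by apply: eq_bigr => i _; rewrite mxE pairingZr mulrC.
Qed.

Lemma covectorK p : covector_coord A c q (covector A c q p) = p.
Proof.
apply/rowP => i; rewrite mxE pairing_covector tangent_coord_field.
exact: pairing_basis_vec.
Qed.

Lemma covector_coordK l : covector A c q (covector_coord A c q l) = l.
Proof.
apply/rowP => j; rewrite -(pairing_basis_vec _ j) pairing_covector.
by rewrite pairing_covector_coord pairing_basis_vec.
Qed.

Lemma vderiveE (X : vfield (R := R) (n := n) (M := M)) (f : M -> R) :
  differentiable (fun x => f (cinv c x)) (c q) ->
  vderive A X f q = 'D_(tangent_coord A c q (X q)) (fun x => f (cinv c x)) (c q).
Proof.
move=> df.
have d1 := transition_differentiable_rV hca hc caq cq.
have E : cinv (ca q) (ca q q) = q by rewrite cmapK.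
have df' : differentiable (fun x => f (cinv c x)) (c (cinv (ca q) (ca q q))) by rewrite E.
transitivity ('D_(X q) ((fun x => f (cinv c x)) \o (fun x => c (cinv (ca q) x))) (ca q q)).
  apply: near_eq_derive; have := near_chart caq cq.
  by apply: filterS => x [p [cp c'p] ->] /=; rewrite !cmapK.
rewrite deriveE; last exact: differentiable_comp.
by rewrite diff_comp //= E deriveE // tangent_coordE (jacE hca hc caq cq).
Qed.

End at_point.

Definition chart_field c (X : vfield (R := R) (n := n) (M := M)) (x : 'rV[R]_n) :=
  tangent_coord A c (cinv c x) (X (cinv c x)).

Lemma chart_fieldE c X q : cdom c q -> chart_field c X (c q) = tangent_coord A c q (X q).
Proof. by move=> cq; rewrite /chart_field cmapK. Qed.

Lemma chart_field_transition c c' X q : atlas A c -> atlas A c' -> cdom c q -> cdom c' q ->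
  chart_field c' X (c' q) = jac c c' q (chart_field c X (c q)).
Proof.
move=> hc hc' cq c'q; rewrite !chart_fieldE // !tangent_coordE jac_comp //.
  exact: chart_at_atlas.
exact: chart_at_dom.
Qed.

End charts.

(** * Hamilton's equations under a change of chart *)

Section change_of_chart.
Context {R : realType} {n k : nat} {M : topologicalType} (A : manifold R n M).
Implicit Types (c : chart R n M) (q : M) (U : set M) (v : 'rV[R]_n).

Lemma pairing_covector_transition c c' q l v : atlas A c -> atlas A c' ->
  cdom c q -> cdom c' q ->
  pairing (covector_coord A c q l) v =
  pairing (covector_coord A c' q l) (jac c c' q v).
Proof.
move=> hc hc' cq c'q; pose w := jac c (chart_at A q) q v.
have ha := chart_at_atlas A q; have da := chart_at_dom A q.
have E d : atlas A d -> cdom d q -> tangent_coord A d q w = jac c d q v.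
  by move=> hd dq; rewrite tangent_coordE (@jac_comp _ _ _ A).
rewrite -(E c' hc' c'q) (pairing_covector_coord hc' c'q) -(pairing_covector_coord hc cq l w).
by rewrite E // jac_id.
Qed.

Lemma lieD_transition c c' q (V : 'rV[R]_n -> 'rV[R]_n) (f : 'rV[R]_n -> R) :
  atlas A c -> atlas A c' -> cdom c q -> cdom c' q ->
  differentiable f (c' q) ->
  lieD V (fun x => f (c' (cinv c x))) (c q) =
  \sum_i jac c c' q (V (c q)) ord0 i * pd i f (c' q).
Proof.
move=> hc hc' cq c'q df.
have E : c' (cinv c (c q)) = c' q by rewrite cmapK.
have df' : differentiable f (c' (cinv c (c q))) by rewrite E.
have dg := transition_differentiable hc hc' cq c'q.
have dfg : differentiable (fun x => f (c' (cinv c x))) (c q).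
  by apply: (differentiable_comp (differentiable_rV dg) df').
rewrite /lieD -derive_pd //.
rewrite (derive_comp_rV (g := fun x => c' (cinv c x)) (V (c q)) dg df') /= E.
by apply: eq_bigr => i _; rewrite (@jac_coord _ _ _ A).
Qed.

Lemma pd_near_cst (f : 'rV[R]_n -> R) (a : R) x i :
  (\near x, f x = a) -> pd i f x = 0.
Proof.
move=> h; rewrite (@pd_eq_near _ _ f (cst a) x i h) pd_derive.
exact: derive_cst.
Qed.

(** Hamilton's equations do not depend on the chart.  In the chart [c0], the
    coordinate field [d/dc_i] of the chart [c] is a vector field [W], the [i]-th
    momentum of [c] is the pairing with [W], and its derivative is the pairing
    with the brackets [[X_j, W]].  In the chart [c] the field [W] is constant,
    so that these brackets are the opposite of the partial derivatives of
    [X_j]. *)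
Lemma controlled_change_chart c0 c U (X : 'I_k -> vfield (R := R) (n := n) (M := M))
    (x : R -> M) (l : R -> 'rV[R]_n) (u : 'I_k -> R) (t : R) :
  atlas A c0 -> atlas A c -> open U -> (forall j, smooth_vfield A U (X j)) ->
  {for t, continuous x} -> U (x t) -> cdom c0 (x t) -> cdom c (x t) ->
  controlled (fun j => chart_field A c0 (X j)) u (fun s => c0 (x s))
    (fun s => covector_coord A c0 (x s) (l s)) t ->
  controlled (fun j => chart_field A c (X j)) u (fun s => c (x s))
    (fun s => covector_coord A c (x s) (l s)) t.
Proof.
move=> hc0 hc oU sX cx Ut c0t ct ctrl.
have near_t : \forall s \near t, cdom c0 (x s) /\ cdom c (x s).
  have o : nbhs (x t) (cdom c0 `&` cdom c).
    by apply: open_nbhs_nbhs; split=> //; apply: openI; exact: cdom_open.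
  exact: cx o.
have oD := @transition_dom_open R n M c0 c.
have Dt : (c0 @` (cdom c0 `&` cdom c)) (c0 (x t)) by exists (x t).
have near_z : \forall z \near c0 (x t),
    exists2 q, [/\ cdom c0 q, cdom c q & U q] & z = c0 q.
  have o : nbhs (c0 (x t)) (c0 @` (cdom c0 `&` (cdom c `&` U))).
    apply: open_nbhs_nbhs; split; last by exists (x t).
    by apply: chart_image_open; apply: openI => //; exact: cdom_open.
  by apply: filterS o => z [q [h1 [h2 h3]] <-]; exists q.
have oD0 := chart_image_open (c := c0) oU.
have oD1 := chart_image_open (c := c) oU.
have dV0 j a : differentiable (fun z => chart_field A c0 (X j) z ord0 a) (c0 (x t)).
  by apply: (smooth_differentiable oD0 (sX j c0 hc0 a)); exists (x t).
have dV j a : differentiable (fun z => chart_field A c (X j) z ord0 a) (c (x t)).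
  by apply: (smooth_differentiable oD1 (sX j c hc a)); exists (x t).
move=> i; split.
  have d := derive_along ctrl (transition_differentiable hc0 hc c0t ct i).
  apply: (@near_eq_is_derive _ _ _ (fun s => c (cinv c0 (c0 (x s))) ord0 i)).
    by apply: filterS near_t => s [h _]; rewrite cmapK.
  apply: is_derive_eq d _; apply: eq_bigr => j _; congr (_ * _).
  by rewrite (chart_field_transition _ hc0 hc c0t ct) (jac_coordE hc0 hc c0t ct).
(* [W] is the coordinate field of index [i] of [c], in the coordinates of [c0] *)
pose g a w := c0 (cinv c w) ord0 a.
pose W z : 'rV[R]_n := \row_a pd i (g a) (c (cinv c0 z)).
have WE q : cdom c0 q -> cdom c q -> W (c0 q) = jac c c0 q (basis_vec i).
  move=> h0 h; apply/rowP => a; rewrite mxE cmapK // (jac_coord hc hc0 h h0).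
  by rewrite pd_derive.
have dW a : differentiable (fun z => W z ord0 a) (c0 (x t)).
  have -> : (fun z => W z ord0 a) = pd i (g a) \o (fun z => c (cinv c0 z)).
    by apply/funext => z; rewrite mxE.
  apply: differentiable_comp; first exact: transition_differentiable_rV hc0 hc c0t ct.
  apply: (@smooth_differentiable _ _ (c @` (cdom c `&` cdom c0))).
  - exact: transition_dom_open.
  - by apply: smooth_pd; exact: (transition_smooth hc hc0).
  - by rewrite cmapK //; exists (x t).
have d := derive_momentum ctrl dW.
apply: (@near_eq_is_derive _ _ _
    (fun s => pairing (covector_coord A c0 (x s) (l s)) (W (c0 (x s))))).
  apply: filterS near_t => s [h0 h]; rewrite WE //.
  by rewrite -(pairing_covector_transition _ _ hc hc0 h h0) pairing_basis_vec.
apply: is_derive_eq d _; rewrite -sumrN; apply: eq_bigr => j _.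
rewrite -mulrN; congr (_ * _).
pose V0 := chart_field A c0 (X j); pose V := chart_field A c (X j).
have JB m : jac c0 c (x t) (bracket V0 W (c0 (x t))) ord0 m =
    - pd i (fun w => V w ord0 m) (c (x t)).
  rewrite (jac_coordE hc0 hc c0t ct).
  rewrite -/(lieD (bracket V0 W) (fun z => c (cinv c0 z) ord0 m) (c0 (x t))).
  rewrite (lieD_bracket oD (transition_smooth hc0 hc m 2%N) Dt (dV0 j) dW).
  have -> : lieD V0 (lieD W (fun z => c (cinv c0 z) ord0 m)) (c0 (x t)) = 0.
    apply: big1 => a _.
    rewrite (@pd_near_cst _ ((basis_vec i : 'rV[R]_n) ord0 m)) ?mulr0 //.
    apply: filterS near_z => _ [q [h0 h _] ->].
    rewrite /lieD -(jac_coordE hc0 hc h0 h) WE // (@jac_comp _ _ _ A) // jac_id //.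
  have -> : lieD W (lieD V0 (fun z => c (cinv c0 z) ord0 m)) (c0 (x t)) =
      lieD W (fun z => V (c (cinv c0 z)) ord0 m) (c0 (x t)).
    apply: eq_bigr => a _; congr (_ * _); apply: pd_eq_near.
    apply: filterS near_z => _ [q [h0 h _] ->].
    rewrite /lieD -(jac_coordE hc0 hc h0 h) /V cmapK //.
    by rewrite (chart_field_transition _ hc0 hc h0 h).
  rewrite (lieD_transition W hc0 hc c0t ct (dV j m)) WE // (@jac_comp _ _ _ A) // jac_id //.
  rewrite sub0r; congr (- _).
  rewrite (bigD1 i) //= basis_vecE eqxx mul1r big1 ?addr0 // => a ai.
  by rewrite basis_vecE (negbTE ai) mul0r.
rewrite -[bracket _ _ _](jac_id _ c0t) -(jac_comp _ hc0 hc hc0) //.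
rewrite -(pairing_covector_transition _ _ hc hc0 ct c0t).
have -> : jac c0 c (x t) (bracket V0 W (c0 (x t))) =
    - \row_m pd i (fun w => V w ord0 m) (c (x t)).
  by apply/rowP => m; rewrite JB !mxE.
rewrite pairingNr; congr (- _); apply: eq_bigr => m _.
by rewrite [in LHS]mxE.
Qed.

End change_of_chart.

(** * Orthonormal frames and the Hamiltonian *)

Section spans.
Context {R : realType} {n : nat}.

Lemma span_imageP (I : finType) (X : I -> 'rV[R]_n) (v : 'rV[R]_n) :
  v \in <<[seq X i | i : I]>>%VS -> exists a : I -> R, v = \sum_i a i *: X i.
Proof.
rewrite span_def big_image /= => /memv_sumP[w hw ->].
have h i : exists a, w i = a *: X i.
  by have /vlineP[a ->] := hw i isT; exists a.
have [a ha] := choice h; exists a; exact: eq_bigr.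
Qed.

Lemma free_image (I : finType) (X : I -> 'rV[R]_n) :
  (forall a : I -> R, \sum_i a i *: X i = 0 -> forall i, a i = 0) ->
  free [seq X i | i : I].
Proof.
move=> h; pose s := [seq X i | i : I].
have szs : size s = #|I| by rewrite size_image.
rewrite -/s -[s]/(tval (in_tuple s)); apply/freeP => a ha i.
have lt_i : (i < #|I|)%N by rewrite -szs.
have e1 (j : 'I_(size s)) : (in_tuple s)`_j = X (enum_val (cast_ord szs j)).
  by rewrite /= (nth_image _ X (cast_ord szs j)).
pose b (x : I) := a (cast_ord (esym szs) (enum_rank x)).
have bE (j : 'I_(size s)) : b (enum_val (cast_ord szs j)) = a j.
  by rewrite /b enum_valK cast_ordK.
rewrite -bE; apply: h; rewrite -[RHS]ha.
rewrite (reindex (fun j : 'I_(size s) => enum_val (cast_ord szs j))) /=.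
  by apply: eq_bigr => j _; rewrite bE -e1.
exists (fun x => cast_ord (esym szs) (enum_rank x)) => x _.
  by rewrite enum_valK cast_ordK.
by rewrite cast_ordKV enum_rankK.
Qed.

Lemma basis_image_coord (I : finType) (E : {vspace 'rV[R]_n}) (X : I -> 'rV[R]_n) v :
  basis_of E [seq X i | i : I] -> v \in E -> exists a : I -> R, v = \sum_i a i *: X i.
Proof. by move=> /span_basis <-; exact: span_imageP. Qed.

Lemma basis_image_mem (I : finType) (E : {vspace 'rV[R]_n}) (X : I -> 'rV[R]_n) i :
  basis_of E [seq X i | i : I] -> X i \in E.
Proof.
move=> /basis_mem; apply.
by apply/fintype.imageP; exists i.
Qed.

Lemma basis_image_dim (I : finType) (E : {vspace 'rV[R]_n}) (X : I -> 'rV[R]_n) :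
  basis_of E [seq X i | i : I] -> \dim E = #|I|.
Proof. by move=> b; rewrite -(span_basis b) (eqP (basis_free b)) size_image. Qed.

End spans.

Section frames.
Context {R : realType} {n : nat} {M : topologicalType} {A : manifold R n M}
  {k : nat} (S : subriemannian A k).
Local Notation field := (vfield (R := R) (n := n) (M := M)).
Implicit Types (q : M) (U : set M) (l u v w : 'rV[R]_n).

Lemma metric0l q w : w \in dist S q -> metric S q 0 w = 0.
Proof.
move=> wD; have := metric_linear 1 (mem0v (dist S q)) (mem0v (dist S q)) wD.
by rewrite scale1r addr0 mul1r => /(congr1 (fun a => a - metric S q 0 w));
  rewrite subrr addrK.
Qed.

Lemma metric_suml q (I : Type) (s : seq I) (a : I -> R) (X : I -> 'rV[R]_n) w :
  (forall i, X i \in dist S q) -> w \in dist S q ->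
  metric S q (\sum_(i <- s) a i *: X i) w = \sum_(i <- s) a i * metric S q (X i) w.
Proof.
move=> XD wD; elim: s => [|i s IH]; first by rewrite !big_nil metric0l.
rewrite !big_cons metric_linear ?IH // memv_suml // => j _; exact: memvZ.
Qed.

Definition orthonormal_at (I : finType) q (X : I -> 'rV[R]_n) :=
  basis_of (dist S q) [seq X i | i : I] /\
  forall i j, metric S q (X i) (X j) = (i == j)%:R.

Lemma orthonormal_expand (I : finType) q (X : I -> 'rV[R]_n) v :
  orthonormal_at q X -> v \in dist S q -> v = \sum_i metric S q v (X i) *: X i.
Proof.
move=> [bX oX] vD; have [a va] := basis_image_coord bX vD.
have XD i := basis_image_mem i bX.
rewrite {1}va; apply: eq_bigr => i _; congr (_ *: _).
rewrite va metric_suml // (bigD1 i) //= oX eqxx mulr1 big1 ?addr0 // => j ji.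
by rewrite oX (negbTE ji) mulr0.
Qed.

Lemma metric_parseval (I : finType) q (X : I -> 'rV[R]_n) v w :
  orthonormal_at q X -> v \in dist S q -> w \in dist S q ->
  metric S q v w = \sum_i metric S q v (X i) * metric S q w (X i).
Proof.
move=> oX vD wD; have XD i := basis_image_mem i oX.1.
rewrite {1}(orthonormal_expand oX vD) metric_suml //.
by apply: eq_bigr => i _; rewrite (Defs.metric_sym (XD i) wD).
Qed.

(** Two orthonormal bases are related by an orthogonal matrix. *)
Lemma sum_sqr_pairing_orthonormal (I J : finType) q (X : I -> 'rV[R]_n)
    (Y : J -> 'rV[R]_n) l : orthonormal_at q X -> orthonormal_at q Y ->
  \sum_i pairing l (X i) ^+ 2 = \sum_j pairing l (Y j) ^+ 2.
Proof.
move=> oX oY; have XD i := basis_image_mem i oX.1; have YD j := basis_image_mem j oY.1.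
have E j : pairing l (Y j) = \sum_i metric S q (Y j) (X i) * pairing l (X i).
  rewrite {1}(orthonormal_expand oX (YD j)) pairing_sumr.
  by apply: eq_bigr => i _; rewrite pairingZr.
transitivity (\sum_i \sum_i' (i == i')%:R * (pairing l (X i) * pairing l (X i'))).
  apply: eq_bigr => i _; rewrite (bigD1 i) //= eqxx mul1r big1 ?addr0 ?expr2 // => j ji.
  by rewrite eq_sym (negbTE ji) mul0r.
transitivity (\sum_i \sum_i' \sum_j metric S q (Y j) (X i) * metric S q (Y j) (X i')
   * (pairing l (X i) * pairing l (X i'))).
  apply: eq_bigr => i _; apply: eq_bigr => i' _; rewrite -mulr_suml; congr (_ * _).
  rewrite -(oX.2 i i') (metric_parseval oY (XD i) (XD i')).
  by apply: eq_bigr => j _; rewrite (Defs.metric_sym (XD i) (YD j)) (Defs.metric_sym (XD i') (YD j)).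
under eq_bigr do rewrite exchange_big /=.
rewrite exchange_big /=; apply: eq_bigr => j _; rewrite E expr2 mulr_suml.
apply: eq_bigr => i _; rewrite mulr_sumr; apply: eq_bigr => i' _.
by rewrite mulrACA.
Qed.

Lemma orthonormal_frame_at (I : finType) U (X : I -> field) q :
  orthonormal_frame S U X -> U q -> orthonormal_at q (fun i => X i q).
Proof. by move=> [[_ _ bX] oX] Uq; split; [exact: bX | exact: oX]. Qed.

(** The first hypothesis provides a candidate for the choice made in the
    definition of [hamiltonian]; by [sum_sqr_pairing_orthonormal] the result of
    the choice is the same for all frames. *)
Lemma hamiltonianE (I : finType) U (X : I -> field) q l :
  (exists V (Y : 'I_k -> field), V q /\ orthonormal_frame S V Y) ->
  orthonormal_frame S U X -> U q ->
  hamiltonian S q l = 2^-1 * \sum_i pairing l (X i q) ^+ 2.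
Proof.
move=> [V [Y [Vq oY]]] oX Uq; rewrite /hamiltonian.
case: xgetP => [h -> [V' [Y' [oY' V'q ->]]]|/(_ (2^-1 * \sum_i pairing l (Y i q) ^+ 2))].
  congr (_ * _); apply: (@sum_sqr_pairing_orthonormal _ _ q).
    exact: orthonormal_frame_at oY' V'q.
  exact: orthonormal_frame_at oX Uq.
by case; exists V, Y.
Qed.

Lemma smooth_field_chart U (X : field) c : smooth_vfield A U X -> atlas A c ->
  smooth_field (c @` (cdom c `&` U)) (chart_field A c X).
Proof. by move=> sX hc i; exact: sX. Qed.

Lemma smooth_vfield_comb U (f g : M -> R) (X Y : field) : open U ->
  smooth_on A U f -> smooth_on A U g -> smooth_vfield A U X -> smooth_vfield A U Y ->
  smooth_vfield A U (fun q => f q *: X q + g q *: Y q).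
Proof.
move=> oU sf sg sX sY c hc i m.
have oD := @chart_image_open R n M c U oU.
have h1 := Ck_mul oD (sf c hc m) (sX c hc i m).
have h2 := Ck_mul oD (sg c hc m) (sY c hc i m).
apply: Ck_eq (Ck_add oD h1 h2) => // _ [q [cq Uq] <-].
rewrite (cmapK cq).
rewrite (tangent_coordD hc cq).
rewrite !(tangent_coordZ hc cq).
rewrite [in RHS]mxE.
by congr (_ + _); rewrite [in RHS]mxE.
Qed.

Lemma smooth_on_cst U (a : R) : smooth_on A U (fun=> a).
Proof. by move=> c hc m; exact: Ck_cst. Qed.

Lemma smooth_vfield_sub_sum U (Y : field) (N : nat) (f : nat -> M -> R) (Z : nat -> field) :
  open U -> smooth_vfield A U Y -> (forall i, (i < N)%N -> smooth_on A U (f i)) ->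
  (forall i, (i < N)%N -> smooth_vfield A U (Z i)) ->
  smooth_vfield A U (fun q => Y q - \sum_(i < N) f i q *: Z i q).
Proof.
move=> oU sY; elim: N => [|N IH] sf sZ.
  have -> : (fun q => Y q - \sum_(i < 0) f i q *: Z i q) = Y.
    by apply/funext => q; rewrite big_ord0 subr0.
  exact: sY.
have h : smooth_vfield A U (fun q => Y q - \sum_(i < N) f i q *: Z i q).
  by apply: IH => i iN; [apply: sf|apply: sZ]; exact: ltnW.
have nf : smooth_on A U (fun q => - f N q).
  move=> c hc m; apply: (Ck_opp (chart_image_open (c := c) oU)); exact: sf.
have -> : (fun q => Y q - \sum_(i < N.+1) f i q *: Z i q) =
   (fun q => 1 *: (Y q - \sum_(i < N) f i q *: Z i q) + (- f N q) *: Z N q).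
  by apply/funext => q; rewrite big_ord_recr /= scale1r scaleNr opprD addrA.
exact: (smooth_vfield_comb oU (smooth_on_cst U 1) nf h (sZ N (ltnSn N))).
Qed.

Lemma smooth_vfield_normalize U (f : M -> R) (X : field) : open U ->
  smooth_on A U f -> (forall q, U q -> 0 < f q) -> smooth_vfield A U X ->
  smooth_vfield A U (fun q => (Num.sqrt (f q))^-1 *: X q).
Proof.
move=> oU sf f0 sX.
have sg : smooth_on A U (fun q => (Num.sqrt (f q))^-1).
  move=> c hc m; have oD := @chart_image_open R n M c U oU.
  have p0 x : (c @` (cdom c `&` U)) x -> 0 < f (cinv c x).
    by move=> [q [cq Uq] <-]; rewrite cmapK //; exact: f0.
  apply: (Ck_inv oD); first by move=> x /p0 ?; rewrite gt_eqF // sqrtr_gt0.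
  by apply: (Ck_sqrt oD p0); exact: sf.
have -> : (fun q => (Num.sqrt (f q))^-1 *: X q) =
   (fun q => (Num.sqrt (f q))^-1 *: X q + 0 *: X q).
  by apply/funext => q; rewrite scale0r addr0.
exact: (smooth_vfield_comb oU sg (smooth_on_cst U 0) sX sX).
Qed.

Lemma metricZl q (a : R) v w : v \in dist S q -> w \in dist S q ->
  metric S q (a *: v) w = a * metric S q v w.
Proof.
move=> vD wD; have := metric_linear a vD (mem0v (dist S q)) wD.
by rewrite addr0 metric0l // addr0.
Qed.

(** The next field is made orthogonal to the previous ones and divided by its
    length, which does not vanish because the frame is free.  All coefficients
    are smooth since they are values of the metric on smooth sections. *)
Lemma gram_schmidt U (Y : 'I_k -> field) : local_frame A (dist S) U Y ->
  forall m, (m <= k)%N -> exists Z : nat -> field, forall i, (i < m)%N ->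
    smooth_vfield A U (Z i) /\ forall q, U q ->
      Z i q \in <<take m [seq Y j q | j : 'I_k]>>%VS /\
      forall j, (j < m)%N -> metric S q (Z i q) (Z j q) = (i == j)%:R.
Proof.
move=> [oU sY bY]; elim=> [|m IH] mk; first by exists (fun=> 0).
have [Z hZ] := IH (ltnW mk).
pose Ym := Y (Ordinal mk).
pose ys q := [seq Y j q | j : 'I_k].
have szs q : size (ys q) = k by rewrite size_image card_ord.
have takeS q : take m.+1 (ys q) = rcons (take m (ys q)) (Ym q).
  rewrite (take_nth 0) ?szs //; congr rcons.
  rewrite (_ : m = nat_of_ord (cast_ord (esym (card_ord k)) (Ordinal mk))) //.
  rewrite nth_image; congr (Y _ q); apply/val_inj.
  by rewrite enum_val_ord /=.
have subT q N : (<<take N (ys q)>> <= <<ys q>>)%VS.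
  by apply: sub_span => x; exact: mem_take.
have spanD q : U q -> <<ys q>>%VS = dist S q by move=> Uq; exact: span_basis (bY q Uq).
have YD q : U q -> Ym q \in dist S q.
  by move=> Uq; exact: basis_image_mem (bY q Uq).
have ZD q i : U q -> (i < m)%N -> Z i q \in dist S q.
  move=> Uq im; rewrite -spanD //; apply: (subvP (subT q m)).
  by have [_ /(_ q Uq)[]] := hZ i im.
have ZZ q i j : U q -> (i < m)%N -> (j < m)%N -> metric S q (Z i q) (Z j q) = (i == j)%:R.
  by move=> Uq im jm; have [_ /(_ q Uq)[_]] := hZ i im; apply.
pose a i q := metric S q (Ym q) (Z i q).
pose W q := Ym q - \sum_(i < m) a i q *: Z i q.
pose f q := metric S q (W q) (W q).
have sumT q : U q -> \sum_(i < m) a i q *: Z i q \in <<take m (ys q)>>%VS.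
  move=> Uq; apply: memv_suml => i _; apply: memvZ.
  by have [_ /(_ q Uq)[]] := hZ i (ltn_ord i).
have sumD q : U q -> \sum_(i < m) a i q *: Z i q \in dist S q.
  by move=> Uq; rewrite -spanD //; apply: (subvP (subT q m)); exact: sumT.
have WD q : U q -> W q \in dist S q.
  by move=> Uq; apply: memvB; [exact: YD | exact: sumD].
have WZ q j : U q -> (j < m)%N -> metric S q (W q) (Z j q) = 0.
  move=> Uq jm; rewrite /W addrC -scaleN1r metric_linear ?sumD ?YD ?ZD //.
  have -> : metric S q (\sum_(i < m) a i q *: Z i q) (Z j q) = a j q.
    have XD (i : 'I_m) : Z i q \in dist S q by exact: ZD.
    rewrite (metric_suml _ (fun i : 'I_m => a i q) XD (ZD q j Uq jm)).
    rewrite (bigD1 (Ordinal jm)) //= ZZ // eqxx mulr1 big1 ?addr0 // => i ij.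
    by rewrite ZZ // -[_ == _]/(i == Ordinal jm) (negbTE ij) mulr0.
  by rewrite mulN1r addNr.
have W0 q : U q -> W q != 0.
  move=> Uq; apply/negP => /eqP/subr0_eq YE.
  have fr : free (take m.+1 (ys q)).
    apply: (catl_free (Y := drop m.+1 (ys q))); rewrite cat_take_drop.
    exact: basis_free (bY q Uq).
  have pr := perm_rcons (Ym q) (take m (ys q)).
  move: fr; rewrite takeS (perm_free (Y := Ym q :: take m (ys q))) ?pr // free_cons.
  by rewrite YE sumT.
have f0 q : U q -> 0 < f q by move=> Uq; apply: metric_pos; [exact: WD | exact: W0].
have secY : smooth_section A (dist S) U Ym by split; [exact: sY | exact: YD].
have secZ i : (i < m)%N -> smooth_section A (dist S) U (Z i).
  by move=> im; split; [have [] := hZ i im | move=> q Uq; exact: ZD].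
have sW : smooth_vfield A U W.
  apply: (smooth_vfield_sub_sum (N := m) (f := a) (Z := Z) oU (sY _)) => i im.
    exact: metric_smooth oU secY (secZ i im).
  by have [] := hZ i im.
have sf : smooth_on A U f by apply: metric_smooth oU _ _; split.
pose Zm q := (Num.sqrt (f q))^-1 *: W q.
exists (fun i => if i == m then Zm else Z i) => i; rewrite ltnS => im.
have ZmD q : U q -> Zm q \in dist S q by move=> Uq; apply: memvZ; exact: WD.
have ZmZ q j : U q -> (j < m)%N -> metric S q (Zm q) (Z j q) = 0.
  by move=> Uq jm; rewrite metricZl ?WZ ?mulr0 ?WD ?ZD.
have ZmZm q : U q -> metric S q (Zm q) (Zm q) = 1.
  move=> Uq; have s0 : Num.sqrt (f q) != 0 by rewrite gt_eqF // sqrtr_gt0 f0.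
  rewrite metricZl ?WD ?ZmD // Defs.metric_sym ?WD ?ZmD // metricZl ?WD // -/(f q).
  by rewrite -{3}(sqr_sqrtr (ltW (f0 q Uq))) expr2 mulKf // mulVf.
have take_sub q v : v \in <<take m (ys q)>>%VS -> v \in <<take m.+1 (ys q)>>%VS.
  apply: subvP; apply: sub_span => x xs; rewrite takeS mem_rcons inE xs.
  by rewrite orbT.
split.
  by case: eqVneq im => [_ _|ne]; [exact: smooth_vfield_normalize
    | rewrite leq_eqVlt (negbTE ne) => /hZ[]].
move=> q Uq; split.
  case: eqVneq im => [_ _|ne].
    apply: memvZ; apply: memvB; last by apply: take_sub; exact: sumT.
    by apply: memv_span; rewrite takeS mem_rcons inE eqxx.
  rewrite leq_eqVlt (negbTE ne) => /hZ[_ /(_ q Uq)[h _]]; exact: take_sub.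
move=> j; rewrite ltnS => jm.
have lt_of N : (N <= m)%N -> N != m -> (N < m)%N by move=> h1 h2; rewrite ltn_neqAle h2.
have [Ei|ni] := eqVneq i m; have [Ej|nj] := eqVneq j m.
- by rewrite (ZmZm q Uq) Ei Ej eqxx.
- by rewrite (ZmZ q j Uq (lt_of j jm nj)) Ei eq_sym (negbTE nj).
- rewrite Defs.metric_sym ?ZmD ?ZD ?lt_of // (ZmZ q i Uq (lt_of i im ni)) Ej.
  by rewrite (negbTE ni).
- exact: ZZ Uq (lt_of i im ni) (lt_of j jm nj).
Qed.

Lemma exists_orthonormal_frame q : exists U (X : 'I_k -> field),
  U q /\ orthonormal_frame S U X.
Proof.
have [U [Y [Uq hY]]] := dist_smooth S q.
have [oU sY bY] := hY.
have [Z hZ] := gram_schmidt hY (leqnn k).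
have ZZ p (i j : 'I_k) : U p -> metric S p (Z i p) (Z j p) = (i == j)%:R.
  by move=> Up; have [_ /(_ p Up)[_ ->]] := hZ i (ltn_ord i).
have ZD p (i : 'I_k) : U p -> Z i p \in dist S p.
  move=> Up; have [_ /(_ p Up)[+ _]] := hZ i (ltn_ord i).
  rewrite -(span_basis (bY p Up)); apply: subvP; apply: sub_span => x.
  exact: mem_take.
exists U, (fun i : 'I_k => Z i); split; first exact: Uq.
split; last by move=> p Up i j; exact: ZZ.
split; [exact: oU | by move=> i; have [] := hZ i (ltn_ord i) | move=> p Up].
rewrite basisEfree; apply/and3P; split.
- apply: free_image => a ha i.
  have XD (j : 'I_k) : Z j p \in dist S p by exact: ZD.
  have := metric_suml (index_enum _) a XD (XD i); rewrite ha metric0l //.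
  rewrite (bigD1 i) //= ZZ // eqxx mulr1 big1 ?addr0 // => j ji.
  by rewrite ZZ // (negbTE ji) mulr0.
- apply/span_subvP => _ /fintype.imageP[i _ ->]; exact: ZD.
- by rewrite size_image (basis_image_dim (bY p Up)).
Qed.

End frames.

(** * The exponential map *)

(** The infimum of the counterexamples would contradict the hypothesis. *)
Lemma real_induction {R : realType} (T : R) (P : R -> Prop) :
  (forall t, 0 <= t <= T -> (forall s, 0 <= s < t -> P s) -> \forall u \near t, P u) ->
  forall t, 0 <= t <= T -> P t.
Proof.
move=> h t0 ht0; apply: contrapT => nP.
pose B := [set s | 0 <= s <= T /\ ~ P s].
have B0 : B !=set0 by exists t0.
have lbB : has_lbound B by exists 0 => s [/andP[]].
have iB : 0 <= inf B <= T.
  apply/andP; split; first by apply: lb_le_inf => // s [/andP[]].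
  by apply: (@le_trans _ _ t0); [apply: ge_inf => //; split | case/andP: ht0].
have below s : 0 <= s < inf B -> P s.
  move=> /andP[s0 sB]; apply: contrapT => nPs.
  have : inf B <= s.
    apply: ge_inf => //; split=> //; rewrite s0 /=.
    by case/andP: iB => _; apply: le_trans; exact: ltW.
  by rewrite leNgt sB.
have /nbhs_ballP [d /= d0 hd] := h _ iB below.
have iBd : inf B < inf B + d by rewrite ltrDl.
have [s Bs sd] := inf_lt B0 iBd.
have [_] := Bs; apply; apply: hd.
have : inf B <= s by exact: ge_inf.
by rewrite /ball /= ltr_norml => H; apply/andP; split; lra.
Qed.

Section exponential.
Context {R : realType} {n : nat} {M : topologicalType} {A : manifold R n M}
  {k : nat} (S : subriemannian A k).
Local Notation field := (vfield (R := R) (n := n) (M := M)).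
Variables (U : set M) (X : 'I_k -> field).
Hypothesis oX : orthonormal_frame S U X.
Implicit Types (c : chart R n M) (q : M) (l : 'rV[R]_n).

Local Notation V c := (fun j => chart_field A c (X j)).
Local Notation D c := (c @` (cdom c `&` U)).

Let oU : open U. Proof. by have [[]] := oX. Qed.
Let sX j : smooth_vfield A U (X j). Proof. by have [[_ + _] _] := oX; apply. Qed.

Lemma frame_dom_open c : open (D c).
Proof. exact: chart_image_open. Qed.

Lemma frame_field_smooth c j : atlas A c -> smooth_field (D c) (V c j).
Proof. by move=> hc i; exact: sX. Qed.

Lemma hamiltonian_pairing q l : U q ->
  hamiltonian S q l = 2^-1 * \sum_j pairing l (X j q) ^+ 2.
Proof. by move=> Uq; apply: (hamiltonianE _ _ oX Uq); exists U, X. Qed.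

Lemma hamiltonian_chart c q l : atlas A c -> cdom c q -> U q ->
  hamiltonian S q l = 2^-1 * \sum_j pairing (covector_coord A c q l) (V c j (c q)) ^+ 2.
Proof.
move=> hc cq Uq; rewrite hamiltonian_pairing //; congr (_ * _).
by apply: eq_bigr => j _; rewrite chart_fieldE // (pairing_covector_coord hc cq).
Qed.

Lemma hamiltonian_coordE c x p : atlas A c -> D c x ->
  hamiltonian_coord S c x p = 2^-1 * \sum_j pairing p (V c j x) ^+ 2.
Proof.
move=> hc [q [cq Uq] <-]; rewrite /hamiltonian_coord (cmapK cq).
by rewrite (hamiltonian_chart _ hc cq Uq) (covectorK hc cq).
Qed.

Lemma derive_hamiltonian_momentum c x p i : atlas A c -> D c x ->
  'D_(basis_vec i) (fun p => hamiltonian_coord S c x p) p =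
  \sum_j pairing p (V c j x) * V c j x ord0 i.
Proof.
move=> hc Dx.
have -> : (fun p => hamiltonian_coord S c x p) =
    (fun p => 2^-1 * \sum_j pairing p (V c j x) ^+ 2).
  by apply/funext => p'; exact: hamiltonian_coordE.
have d1 j : is_derive (0 : R) 1 (fun u : R => pairing (u *: basis_vec i + p) (V c j x))
    (V c j x ord0 i).
  have -> : (fun u : R => pairing (u *: basis_vec i + p) (V c j x)) =
     (fun u => V c j x ord0 i * u + pairing p (V c j x)).
    apply/funext => u; rewrite pairingDl pairingZl pairingC pairing_basis_vec.
    by rewrite mulrC.
  have := is_derive_add (is_derive_mull (V c j x ord0 i) (is_derive_id (0 : R) (1 : R)))
    (is_derive_cst (pairing p (V c j x)) (0 : R) (1 : R)).
  by rewrite addr0 mulr1.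
have d2 := is_derive_mull 2^-1 (@is_derive_sumr R _ (index_enum _) xpredT _ _ 0
  (fun j _ => is_derive_mul (d1 j) (d1 j))).
have := @is_derive_of_line R n (fun p => 2^-1 * \sum_j pairing p (V c j x) ^+ 2) p
  (basis_vec i) _ d2.
move=> d3; rewrite derive_val mulr_sumr; apply: eq_bigr => j _.
by rewrite scale0r add0r; field.
Qed.

Lemma derive_hamiltonian_position c x p i : atlas A c -> D c x ->
  'D_(basis_vec i) (fun y => hamiltonian_coord S c y p) x =
  \sum_j pairing p (V c j x) * \sum_m p ord0 m * pd i (fun y => V c j y ord0 m) x.
Proof.
move=> hc Dx; have oD := @frame_dom_open c.
have dV j m : derivable (fun y => V c j y ord0 m) x (basis_vec i).
  by apply: diff_derivable; exact: (smooth_differentiable oD (frame_field_smooth j hc m)).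
rewrite (near_eq_derive (g := fun y => 2^-1 * \sum_j pairing p (V c j y) ^+ 2)); last first.
  by apply: (open_near oD Dx) => y Dy; exact: hamiltonian_coordE.
have dVp j m : derivable (fun y => p ord0 m * V c j y ord0 m) x (basis_vec i).
  exact: (derivableM (derivable_cst _ _ _) (dV j m)).
have [dP pP] : (forall j, derivable (fun y => pairing p (V c j y)) x (basis_vec i)) /\
   forall j, pd i (fun y => pairing p (V c j y)) x =
     \sum_m p ord0 m * pd i (fun y => V c j y ord0 m) x.
  split=> j; have [d E] := @pd_sum R n i _ (index_enum _) xpredT
      (fun m y => p ord0 m * V c j y ord0 m) x (fun m _ => dVp j m).
    exact: d.
  by rewrite E; apply: eq_bigr => m _; exact: (pdMl (p ord0 m) (dV j m)).
have dP2 j : derivable (fun y => pairing p (V c j y) * pairing p (V c j y)) x (basis_vec i).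
  exact: (derivableM (dP j) (dP j)).
have [dS ES] := @pd_sum R n i _ (index_enum _) xpredT
  (fun j y => pairing p (V c j y) * pairing p (V c j y)) x (fun j _ => dP2 j).
rewrite -pd_derive (pdMl 2^-1 dS) ES mulr_sumr; apply: eq_bigr => j _.
by rewrite (pdM (dP j) (dP j)) pP; field.
Qed.

(** The two partial gradients of [1/2 sum_j <p, X_j>^2] are the right hand
    sides of [controlled] for [u_j = <p, X_j>]. *)
Lemma hamilton_controlled c (x : R -> M) (l : R -> 'rV[R]_n) (t : R) :
  atlas A c -> cdom c (x t) -> U (x t) ->
  (forall i, let xt := c (x t) in let pt := covector_coord A c (x t) (l t) in
    is_derive t 1 (fun s => c (x s) ord0 i)
        ('D_(basis_vec i) (fun p => hamiltonian_coord S c xt p) pt) /\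
    is_derive t 1 (fun s => covector_coord A c (x s) (l s) ord0 i)
        (- 'D_(basis_vec i) (fun y => hamiltonian_coord S c y pt) xt)) <->
  controlled (V c) (fun j => pairing (covector_coord A c (x t) (l t)) (V c j (c (x t))))
    (fun s => c (x s)) (fun s => covector_coord A c (x s) (l s)) t.
Proof.
move=> hc ct Ut; have Dt : D c (c (x t)) by exists (x t).
by split=> h i; have := h i => /=; rewrite /= (derive_hamiltonian_momentum _ i hc Dt)
  (derive_hamiltonian_position _ i hc Dt).
Qed.

Section near_point.
Variables (c : chart R n M) (q0 : M) (r : R).
Hypotheses (hc : atlas A c) (r0 : 0 < r) (KD : cube (c q0) (r + r) `<=` D c).

Let rr0 : 0 <= r + r. Proof. by rewrite addr_ge0 // ltW. Qed.

Let cube_sub x : cube (c q0) r x -> cube (c q0) (r + r) x.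
Proof. by move=> h; apply: le_trans h _; rewrite lerDl ltW. Qed.

Lemma cube_dom q : cdom c q -> cube (c q0) (r + r) (c q) -> U q.
Proof. by move=> cq /KD[p [cp Up]] /(congr1 (cinv c)); rewrite !cmapK // => <-. Qed.

(** The flow is obtained in the chart [c] by [hamiltonian_flow_exists], and
    [controlled_change_chart] yields Hamilton's equations in all other charts. *)
Lemma hamiltonian_curve_exists : exists2 e : R, 0 < e &
  forall q l, cdom c q -> cube (c q0) r (c q) -> cosphere S q l ->
    exists x p, [/\ hamiltonian_curve S (- e) e x p, x 0 = q & p 0 = l].
Proof.
have oD := @frame_dom_open c.
have [e e0 he] := hamiltonian_flow_exists oD (fun j => frame_field_smooth j hc) r0 KD.
exists e => // q l cq hq hl.
have Uq : U q by apply: cube_dom => //; exact: cube_sub.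
have E0 : \sum_j pairing (covector_coord A c q l) (V c j (c q)) ^+ 2 = 1.
  by move: hl; rewrite /cosphere /= (hamiltonian_chart _ hc cq Uq) mulrA divff ?mul1r.
have [y [p [y0 p0 hyp]]] := he _ _ hq E0.
pose x t := cinv c (y t).
have xE t : `|t| < e -> [/\ cdom c (x t), U (x t) & c (x t) = y t].
  by move=> /hyp[/KD[q' [cq' Uq'] yE] _]; rewrite /x -yE cmapK.
exists x, (fun t => covector A c (x t) (p t)); split; last 2 first.
- by rewrite /x y0 cmapK.
- by rewrite /x y0 cmapK // p0 (covector_coordK hc cq).
move=> t /andP[t1 t2].
have te : `|t| < e by rewrite ltr_norml t1 t2.
have [_ ct] := hyp t te.
have [cxt Uxt cx] := xE t te.
have near_e : \forall s \near t, `|s| < e.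
  have : {for t, continuous (fun s : R => `|s|)} by exact: norm_continuous.
  by move=> /cvgr_lt; apply.
have cont_y : {for t, continuous y}.
  apply: differentiable_continuous; apply/derivable1_diffP.
  by apply/derivable_mxP => i j; rewrite ord1; have [[]] := ct j.
have cont_x : {for t, continuous x}.
  have h : {for y t, continuous (cinv c)} by rewrite -cx; exact: cinv_continuous.
  exact: continuous_comp cont_y h.
split=> // c' hc' c'xt.
have ctrl : controlled (V c)
    (fun j => pairing (covector_coord A c (x t) (covector A c (x t) (p t))) (V c j (c (x t))))
    (fun s => c (x s)) (fun s => covector_coord A c (x s) (covector A c (x s) (p s))) t.
  move=> i; have [d1 d2] := ct i; split.
    rewrite cx (covectorK hc cxt).
    apply: near_eq_is_derive d1; apply: filterS near_e => s /xE[_ _ ->] //.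
  rewrite cx (covectorK hc cxt).
  apply: near_eq_is_derive d2; apply: filterS near_e => s /xE[cxs _ _].
  by rewrite (covectorK hc cxs).
apply/(hamilton_controlled _ hc' c'xt Uxt).
have := controlled_change_chart hc hc' oU sX cont_x Uxt cxt c'xt ctrl.
suff -> : (fun j => pairing (covector_coord A c (x t) (covector A c (x t) (p t))) (V c j (c (x t)))) =
  (fun j => pairing (covector_coord A c' (x t) (covector A c (x t) (p t))) (V c' j (c' (x t)))) by [].
apply/funext => j; rewrite (pairing_covector_transition _ _ hc hc' cxt c'xt).
by rewrite (chart_field_transition _ hc hc' cxt c'xt).
Qed.

Let Kset := [set q | cdom c q /\ cube (c q0) (r + r) (c q)].

(** It is the image of a compact cube, and the manifold is Hausdorff. *)
Lemma chart_cube_closed : closed Kset.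
Proof.
have -> : Kset = cinv c @` cube (c q0) (r + r).
  apply/seteqP; split=> [q [cq hq]|q [x hx <-]].
    by exists (c q) => //; rewrite cmapK.
  by have [p [cp Up] E] := KD hx; rewrite -E cmapK //; split=> //; rewrite E.
apply: compact_closed; first exact: manifold_hausdorff A.
apply: continuous_compact; last exact: cube_compact.
apply: continuous_in_subspaceT => x; rewrite inE => hx.
by have [p [cp Up] <-] := KD hx; exact: cinv_continuous.
Qed.

(** The speed is bounded on the unit energy level, so that a curve cannot leave
    the cube of radius [r + r] before a time independent of its momentum. *)
Lemma hamiltonian_curve_arc : exists2 e : R, 0 < e &
  forall q l a b x p T, cdom c q -> cube (c q0) r (c q) -> cosphere S q l ->
    a < 0 < b -> hamiltonian_curve S a b x p -> x 0 = q -> p 0 = l ->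
    0 <= T < b -> T < e ->
    (forall t, 0 <= t <= T -> cdom c (x t)) /\
    hamiltonian_arc (V c) (c q0) (r + r) (fun s => c (x s))
      (fun s => covector_coord A c (x s) (p s)) T.
Proof.
have oD := @frame_dom_open c.
have [C C0 hC] := arc_speed oD (fun j => frame_field_smooth j hc) KD.
pose e := Num.min 1 (r / (C + 1)).
have C1 : 0 < C + 1 by rewrite ltr_wpDl.
exists e; first by rewrite lt_min ltr01 divr_gt0.
move=> q l a b x p T cq hq hl /andP[a0 b0] hcurve x0 p0 /andP[T0 Tb].
rewrite lt_min => /andP[T1 Te].
pose P s := Kset (x s).
have arc t : 0 <= t <= T -> (forall s, 0 <= s <= t -> P s) ->
    hamiltonian_arc (V c) (c q0) (r + r) (fun s => c (x s))
      (fun s => covector_coord A c (x s) (p s)) t.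
  move=> /andP[t0 tT] hP; split.
  - by rewrite t0 (le_trans tT) // ltW.
  - move=> s hs; have [cs Ks] := hP s hs; split=> //.
    have Us := cube_dom cs Ks.
    apply/(hamilton_controlled _ hc cs Us).
    have sab : a < s < b.
      case/andP: hs => s0 st; apply/andP; split; first exact: lt_le_trans s0.
      by apply: le_lt_trans Tb; exact: le_trans tT.
    by have [_ /(_ c hc cs)] := hcurve s sab.
  - rewrite x0 p0; have Uq := cube_dom cq (cube_sub hq).
    by move: hl; rewrite /cosphere /= (hamiltonian_chart _ hc cq Uq) mulrA divff ?mul1r.
have allP : forall t, 0 <= t <= T -> P t.
  apply: real_induction => t ht below; have [t0 tT] := andP ht.
  have [cont _] : {for t, continuous x} /\ True.
    split=> //; have tab : a < t < b.
      by apply/andP; split; [exact: lt_le_trans t0 | exact: le_lt_trans Tb].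
    by have [] := hcurve t tab.
  (* the property passes to the limit [t] because [Kset] is closed; then the
     bound on the speed shows that the boundary has not been reached at [t] *)
  have Pt : P t.
    have [t00|tn0] := eqVneq t 0.
      by rewrite /P t00 x0; split=> //; exact: cube_sub.
    have tpos : 0 < t by rewrite lt_def tn0.
    apply: contrapT => nP.
    have oC : open (~` Kset) by rewrite openC; exact: chart_cube_closed.
    have : \forall s \near t, (~` Kset) (x s).
      by apply: cont; apply: open_nbhs_nbhs; split.
    move=> /nbhs_ballP [d /= d0 hd].
    pose s := Num.max 0 (t - d / 2).
    have st : s < t by rewrite gt_max tpos /=; lra.
    have s0 : 0 <= s by rewrite le_max lexx.
    have : ball t d s.
      rewrite /ball /= ltr_norml; apply/andP; split; first lra.
      have : t - d / 2 <= s by rewrite le_max lexx orbT.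
      lra.
    by move=> /hd; apply; apply: below; rewrite s0.
  have hP s : 0 <= s <= t -> P s.
    move=> /andP[s0]; rewrite le_eqVlt => /orP[/eqP->//|st].
    by apply: below; rewrite s0.
  have h1 := hC _ _ _ (arc t ht hP); rewrite /= x0 in h1.
  have lt2 : `|c (x t) - c q0| < r + r.
    rewrite -(subrKA (c q)); apply: le_lt_trans (ler_normD _ _) _.
    apply: ltr_leD => //; apply: le_lt_trans h1 _.
    apply: (@le_lt_trans _ _ ((C + 1) * T)).
      by apply: ler_pM => //; rewrite lerDl.
    by rewrite mulrC -ltr_pdivlMr.
  have [cxt _] := Pt.
  have n1 : \forall s \near t, cdom c (x s).
    by apply: cont; apply: open_nbhs_nbhs; split=> //; exact: cdom_open.
  have n2 : \forall s \near t, `|c (x s) - c q0| < r + r.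
    have cc : {for t, continuous (fun s => `|c (x s) - c q0|)}.
      apply: (@continuous_comp _ _ _ (fun s => c (x s) - c q0) Num.norm).
        apply: continuousB; last exact: cst_continuous.
        exact: continuous_comp cont (cmap_continuous cxt).
      exact: norm_continuous.
    by move/cvgr_lt: cc; apply.
  by move: n1 n2; apply: filterS2 => s h3 h4; split=> //; exact: ltW.
split; first by move=> t /allP[].
by apply: arc => //; rewrite T0 lexx.
Qed.

(** By [hamiltonian_curve_exists] the exponential map is given by some
    Hamiltonian curve starting from [l]; the expansion of [arc_taylor] holds
    for all of them. *)
Lemma exp_taylor (phi : M -> R) : smooth_on A setT phi ->
  exists2 e : R, 0 < e & exists2 C, 0 <= C &
  forall q l t, cdom c q -> cube (c q0) r (c q) -> cosphere S q l -> 0 < t < e ->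
  `|phi (sr_exp S q t l) - phi q
    - t * flow_derive1 (V c) (fun x => phi (cinv c x)) (c q) (covector_coord A c q l)
    - t ^+ 2 / 2 * flow_derive2 (V c) (fun x => phi (cinv c x)) (c q)
        (covector_coord A c q l)|
  <= C * t ^+ 3 * (1 + `|covector_coord A c q l|) ^+ 2.
Proof.
move=> sphi; have oD := @frame_dom_open c.
have sf : smooth_Rn (D c) (fun x => phi (cinv c x)).
  move=> m; apply: Ck_sub (sphi c hc m) => _ [q [cq Uq] <-].
  by exists q.
have [C C0 hC] := arc_taylor oD (fun j => frame_field_smooth j hc) KD sf.
have [e1 e10 he1] := hamiltonian_curve_exists.
have [e2 e20 he2] := hamiltonian_curve_arc.
exists (Num.min e1 e2); first by rewrite lt_min e10.
exists C => // q l t cq hq hl /andP[t0]; rewrite lt_min => /andP[te1 te2].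
rewrite /sr_exp; case: xgetP => [y _ [a [b [x [p [ab tab hcurve [x0 p0] ->]]]]]|]; last first.
  have [x [p [hcurve x0 p0]]] := he1 q l cq hq hl.
  move=> /(_ (x t)); case; exists (- e1), e1, x, p; split=> //.
    by rewrite oppr_lt0 e10.
  by rewrite te1 andbT; apply: lt_trans t0; rewrite oppr_lt0.
have tb : 0 <= t < b by case/andP: tab => _ ->; rewrite ltW.
have [cdomx harc] := he2 q l a b x p t cq hq hl ab hcurve x0 p0 tb te2.
have cxt : cdom c (x t) by apply: cdomx; rewrite lexx ltW.
have := hC _ _ _ harc; rewrite /= x0 p0 !cmapK //.
Qed.

End near_point.
End exponential.

(** * Integration *)

Section integrals.
Context d (T : measurableType d) (R : realType) (mu : {measure set T -> \bar R}).
Implicit Types (D A : set T) (f g : T -> R).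

(** The integral of a nonnegative function is a supremum over the simple
    functions below it, hence monotone on all nonnegative functions, measurable
    or not.  This is what allows averaging over the exponential map. *)
Lemma le_integral_ge0 D (f g : T -> \bar R) : (forall x, D x -> (0 <= f x)%E) ->
  (forall x, D x -> (f x <= g x)%E) ->
  (\int[mu]_(x in D) f x <= \int[mu]_(x in D) g x)%E.
Proof.
move=> f0 fg; have g0 x : D x -> (0 <= g x)%E by move=> Dx; exact: le_trans (f0 x Dx) (fg x Dx).
rewrite !ge0_integralE //.
apply: le_ereal_sup => _ [h hf <-]; exists h => // x.
apply: le_trans (hf x) _; rewrite /patch; case: ifPn => // /set_mem Dx; exact: fg.
Qed.

(** The positive and negative parts are compared separately. *)
Lemma Rintegral_sandwich D f g1 g2 : measurable D -> mu.-integrable D (EFin \o g1) ->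
  mu.-integrable D (EFin \o g2) -> (forall x, D x -> g1 x <= f x <= g2 x) ->
  \int[mu]_(x in D) g1 x <= \int[mu]_(x in D) f x <= \int[mu]_(x in D) g2 x.
Proof.
move=> mD i1 i2 h.
have pos (u v : T -> R) : (forall x, D x -> u x <= v x) ->
    (\int[mu]_(x in D) (EFin \o u)^\+ x <= \int[mu]_(x in D) (EFin \o v)^\+ x)%E.
  move=> uv; apply: le_integral_ge0 => x Dx; first exact: funepos_ge0.
  by rewrite !funeposE /= -!EFin_max lee_fin le_max2 // uv.
have neg (u v : T -> R) : (forall x, D x -> u x <= v x) ->
    (\int[mu]_(x in D) (EFin \o v)^\- x <= \int[mu]_(x in D) (EFin \o u)^\- x)%E.
  move=> uv; apply: le_integral_ge0 => x Dx; first exact: funeneg_ge0.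
  by rewrite !funenegE /= -!EFin_max lee_fin le_max2 // lerN2 uv.
have h1 x : D x -> g1 x <= f x by move=> /h/andP[].
have h2 x : D x -> f x <= g2 x by move=> /h/andP[].
have fin_pos (u : T -> R) : mu.-integrable D (EFin \o u) ->
    (\int[mu]_(x in D) (EFin \o u)^\+ x)%E \is a fin_num.
  by move=> iu; exact: integrable_pos_fin_num.
have fin_neg (u : T -> R) : mu.-integrable D (EFin \o u) ->
    (\int[mu]_(x in D) (EFin \o u)^\- x)%E \is a fin_num.
  by move=> iu; exact: integrable_neg_fin_num.
have fp : (\int[mu]_(x in D) (EFin \o f)^\+ x)%E \is a fin_num.
  rewrite ge0_fin_numE; last by apply: integral_ge0 => x _; exact: funepos_ge0.
  apply: le_lt_trans (pos _ _ h2) _; rewrite -ge0_fin_numE ?fin_pos //.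
  by apply: integral_ge0 => x _; exact: funepos_ge0.
have fn : (\int[mu]_(x in D) (EFin \o f)^\- x)%E \is a fin_num.
  rewrite ge0_fin_numE; last by apply: integral_ge0 => x _; exact: funeneg_ge0.
  apply: le_lt_trans (neg _ _ h1) _; rewrite -ge0_fin_numE ?fin_neg //.
  by apply: integral_ge0 => x _; exact: funeneg_ge0.
have E (u : T -> R) : (\int[mu]_(x in D) (EFin \o u)^\+ x)%E \is a fin_num ->
    (\int[mu]_(x in D) (EFin \o u)^\- x)%E \is a fin_num ->
    \int[mu]_(x in D) u x = fine (\int[mu]_(x in D) (EFin \o u)^\+ x) -
      fine (\int[mu]_(x in D) (EFin \o u)^\- x).
  by move=> p m; rewrite /Rintegral integralE fineB.
have p1 := fin_pos _ i1; have m1 := fin_neg _ i1.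
have p2 := fin_pos _ i2; have m2 := fin_neg _ i2.
rewrite (E _ p1 m1) (E _ fp fn) (E _ p2 m2); apply/andP; split; apply: lerB.
- exact: (fine_le p1 fp (pos _ _ h1)).
- exact: (fine_le fn m1 (neg _ _ h1)).
- exact: (fine_le fp p2 (pos _ _ h2)).
- exact: (fine_le m2 fn (neg _ _ h2)).
Qed.

Section full_set.
Variables (A : set T).
Hypotheses (mA : measurable A) (A0 : mu (~` A) = 0%E).

Let mAC : measurable (~` A). Proof. exact: measurableC. Qed.
Let setTDC : setT `\` ~` A = A.
Proof. by rewrite setTD setCK. Qed.

Lemma integral_full_ge0 (f : T -> \bar R) : measurable_fun setT f ->
  (forall x, (0 <= f x)%E) -> (\int[mu]_x f x = \int[mu]_(x in A) f x)%E.
Proof.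
move=> mf f0; rewrite (@ge0_negligible_integral _ _ _ mu setT (~` A)) ?setTDC //.
Qed.

Lemma integrable_full (f : T -> \bar R) : measurable_fun setT f ->
  mu.-integrable A f -> mu.-integrable setT f.
Proof.
move=> mf /integrableP[_ fi]; apply/integrableP; split=> //.
rewrite integral_full_ge0 //; exact: measurableT_comp.
Qed.

Lemma integral_full (f : T -> \bar R) : mu.-integrable setT f ->
  (\int[mu]_x f x = \int[mu]_(x in A) f x)%E.
Proof.
move=> fi; rewrite (@negligible_integral _ _ _ mu setT (~` A)) ?setTDC //.
Qed.

Lemma eq_integral_full (f g : T -> \bar R) : measurable_fun setT f ->
  measurable_fun setT g -> (forall x, A x -> f x = g x) ->
  (\int[mu]_x f x = \int[mu]_x g x)%E.
Proof.
move=> mf mg fg; apply: ae_eq_integral => //.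
by exists (~` A); split=> // x /=; apply: contra_not => Ax _; exact: fg.
Qed.

Lemma eq_Rintegral_full f g : measurable_fun setT f ->
  measurable_fun setT g -> (forall x, A x -> f x = g x) ->
  \int[mu]_x f x = \int[mu]_x g x.
Proof.
move=> mf mg fg; rewrite /Rintegral; congr fine; apply: eq_integral_full.
- exact/measurable_EFinP.
- exact/measurable_EFinP.
- by move=> x Ax; rewrite fg.
Qed.

End full_set.

Lemma integrable_ler D f g : measurable D -> measurable_fun D f ->
  (forall x, D x -> `|f x| <= g x) -> mu.-integrable D (EFin \o g) ->
  mu.-integrable D (EFin \o f).
Proof.
move=> mD mf fg ig; apply: le_integrable ig => //; first exact/measurable_EFinP.
move=> x Dx /=; rewrite lee_fin; apply: le_trans (fg x Dx) (ler_norm _).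
Qed.

Lemma integrable_add D f g : measurable D -> mu.-integrable D (EFin \o f) ->
  mu.-integrable D (EFin \o g) -> mu.-integrable D (EFin \o (fun x => f x + g x)).
Proof.
move=> mD fi gi; have := integrableD mD fi gi.
by apply: eq_integrable => // x _; rewrite /= EFinD.
Qed.

Lemma integrable_scale D f (a : R) : measurable D -> mu.-integrable D (EFin \o f) ->
  mu.-integrable D (EFin \o (fun x => a * f x)).
Proof.
move=> mD fi; have := integrableZl mD a fi.
by apply: eq_integrable => // x _; rewrite /= EFinM.
Qed.

Lemma integrable_sumr D (I : Type) (s : seq I) (f : I -> T -> R) : measurable D ->
  (forall i, mu.-integrable D (EFin \o f i)) ->
  mu.-integrable D (EFin \o (fun x => \sum_(i <- s) f i x)).
Proof.
move=> mD fi; elim: s => [|i s IH].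
  apply: (eq_integrable _ (cst 0%E)) => //; last exact: integrable0.
  by move=> x _ /=; rewrite big_nil.
apply: (eq_integrable _ (EFin \o (fun x => f i x + \sum_(i <- s) f i x))) => //.
  by move=> x _ /=; rewrite big_cons.
exact: integrable_add.
Qed.

Lemma Rintegral_sumr D (I : Type) (s : seq I) (f : I -> T -> R) : measurable D ->
  (forall i, mu.-integrable D (EFin \o f i)) ->
  \int[mu]_(x in D) (\sum_(i <- s) f i x) = \sum_(i <- s) \int[mu]_(x in D) f i x.
Proof.
move=> mD fi; elim: s => [|i s IH].
  rewrite big_nil (@eq_Rintegral _ _ _ mu D (fun=> 0)) ?Rintegral_cst ?mul0r //.
  by move=> x _; rewrite big_nil.
rewrite big_cons -IH -RintegralD //; last exact: integrable_sumr.
by apply: eq_Rintegral => x _; rewrite big_cons.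
Qed.

End integrals.

Section borel.
Context {R : realType} {n : nat}.
Local Notation B := (borel_rV R n).

Lemma open_borel (U : set 'rV[R]_n) : open U -> measurable (U : set B).
Proof. by move=> oU; exact: sub_sigma_algebra. Qed.

Lemma continuous_borel (f : 'rV[R]_n -> R) : continuous f ->
  measurable_fun setT (f : B -> R).
Proof.
move=> /continuousP cf; apply: (measurability _ (RGenOpens.measurableE R)).
move=> _ [_ [a [b ->]] <-]; rewrite setTI; apply: open_borel; apply: cf.
exact: interval_open.
Qed.

Lemma pairing_continuous (v : 'rV[R]_n) : continuous (fun l : 'rV[R]_n => pairing l v).
Proof.
move=> l; apply: (@cvg_sumR _ _ (nbhs l) (nbhs_filter l)) => i _.
by apply: cvgMl; exact: coord_continuous.
Qed.

Lemma pairing_measurable (v : 'rV[R]_n) :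
  measurable_fun setT ((fun l : 'rV[R]_n => pairing l v) : B -> R).
Proof. exact: (@continuous_borel (fun l => pairing l v) (@pairing_continuous v)). Qed.

Lemma coord_measurable (i : 'I_n) :
  measurable_fun setT ((fun l : 'rV[R]_n => l ord0 i) : B -> R).
Proof. by apply: continuous_borel; exact: coord_continuous. Qed.

(** An open set is a countable union of cubes with rational centres and radii
    [1 / (m + 1)]; the preimage of such a cube under addition is measurable,
    since it is given by conditions on the coordinates. *)
Lemma add_measurable :
  measurable_fun setT ((fun z : B * B => (z.1 : 'rV[R]_n) + (z.2 : 'rV[R]_n)) : B * B -> B).
Proof.
pose Q (k : 'rV[rat]_n * nat) : set 'rV[R]_n :=
  [set x | forall i, ball (ratr (k.1 ord0 i) : R) k.2.+1%:R^-1 (x ord0 i)].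
have mQ k : measurable [set z : B * B | Q k ((z.1 : 'rV[R]_n) + (z.2 : 'rV[R]_n))].
  have -> : [set z : B * B | Q k ((z.1 : 'rV[R]_n) + (z.2 : 'rV[R]_n))] =
    \bigcap_(i in [set: 'I_n]) ((fun z : B * B => (z.1 : 'rV[R]_n) ord0 i +
      (z.2 : 'rV[R]_n) ord0 i) @^-1` ball (ratr (k.1 ord0 i) : R) k.2.+1%:R^-1).
    apply/seteqP; split=> z /= h i; first by move=> _; have := h i; rewrite mxE.
    by rewrite mxE; exact: h.
  apply: fin_bigcap_measurable => // i _.
  rewrite -[X in measurable X]setTI; apply: measurable_funD => //.
  - exact: (measurableT_comp (coord_measurable i) measurable_fst).
  - exact: (measurableT_comp (coord_measurable i) measurable_snd).
  - exact: measurable_ball.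
apply: (@measurability _ _ _ B setT _ (@open 'rV[R]_n) erefl) => _ [U oU <-].
rewrite setTI.
pose F (m : nat) : set (B * B) := if unpickle m is Some k then
  (if `[< Q k `<=` U >] then [set z : B * B | Q k ((z.1 : 'rV[R]_n) + (z.2 : 'rV[R]_n))]
   else set0) else set0.
have -> : (fun z : B * B => (z.1 : 'rV[R]_n) + (z.2 : 'rV[R]_n)) @^-1` U = \bigcup_m F m.
  apply/seteqP; split=> z /=; last first.
    move=> [m _]; rewrite /F; case: unpickle => // k.
    by case: ifPn => // /asboolP QU /QU.
  set x := _ + _ => Ux.
  have /nbhs_ballP [d /= d0 hd] : nbhs x U by apply: open_nbhs_nbhs.
  have [m hm] : exists m : nat, m.+1%:R^-1 < d / 2.
    have d2 : 0 < d / 2 by rewrite divr_gt0.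
    by have [m] := ltr_add_invr d2; rewrite add0r => hm; exists m.
  have [e eE] : exists e : R, e = m.+1%:R^-1 by eexists.
  have e0 : 0 < e by rewrite eE invr_gt0.
  rewrite -eE in hm.
  have /choice[a ha] : forall i, exists r : rat, x ord0 i - e < ratr r < x ord0 i + e.
    move=> i; have [|r] := @rat_in_itvoo R (x ord0 i - e) (x ord0 i + e); first by lra.
    by rewrite in_itv /=; exists r.
  pose k : 'rV[rat]_n * nat := (\row_i a i, m).
  have QE y : Q k y <-> forall i, `|ratr (a i) - y ord0 i| < e.
    by split=> h i; have := h i; rewrite /= mxE /ball /= -eE.
  exists (pickle k) => //; rewrite /F pickleK; case: ifPn => [_|/asboolP].
    apply/QE => i; rewrite -/x ltr_distlC; case/andP: (ha i) => h1 h2.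
    by apply/andP; split; lra.
  case=> y /QE hy; apply: hd; rewrite -ball_normE /=.
  apply: (@le_lt_trans _ _ (e + e)); last lra.
  apply: rV_norm_le => [|i]; first by rewrite addr_ge0 // ltW.
  have h3 := hy i; have /andP[h1 h2] := ha i.
  rewrite [X in `|X|]mxE [X in _ + X]mxE -(subrKA (ratr (a i))); apply: le_trans (ler_normD _ _) _.
  apply: lerD; apply: ltW => //; rewrite ltr_norml; apply/andP; split; lra.
apply: bigcup_measurable => m _; rewrite /F; case: unpickle => // k.
by case: ifP.
Qed.

End borel.

(** * Square integrable functions and products of probabilities *)

Section square_integrable.
Context d (T : measurableType d) (R : realType) (P : probability T R).
Implicit Types f g : T -> R.
Local Notation L2 f := (P.-integrable setT (EFin \o (fun x => f x ^+ 2))).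

Lemma integrableM_sqr f g : measurable_fun setT f -> measurable_fun setT g ->
  L2 f -> L2 g -> P.-integrable setT (EFin \o (fun x => f x * g x)).
Proof.
move=> mf mg f2 g2.
apply: (@integrable_ler _ _ _ P setT _ (fun x => f x ^+ 2 + g x ^+ 2)) => //.
- exact: measurable_funM.
- by move=> x _; rewrite ler_norml; apply/andP; split; nra.
- exact: integrable_add.
Qed.

Lemma integrable_of_sqr f : measurable_fun setT f -> L2 f ->
  P.-integrable setT (EFin \o f).
Proof.
move=> mf f2.
apply: (@integrable_ler _ _ _ P setT _ (fun x => 1 + f x ^+ 2)) => //.
- by move=> x _; rewrite ler_norml; apply/andP; split; nra.
- apply: integrable_add => //; exact: finite_measure_integrable_cst.
Qed.

Lemma integrableD_sqr f g : measurable_fun setT f -> measurable_fun setT g ->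
  L2 f -> L2 g -> L2 (fun x => f x + g x).
Proof.
move=> mf mg f2 g2.
apply: (@integrable_ler _ _ _ P setT _ (fun x => 2 * f x ^+ 2 + 2 * g x ^+ 2)) => //.
- by apply: measurable_funX; exact: measurable_funD.
- move=> x _; rewrite ger0_norm ?sqr_ge0 // -subr_ge0.
  rewrite (_ : _ - _ = (f x - g x) ^+ 2) ?sqr_ge0 //; ring.
- have h1 := @integrable_scale _ _ _ P _ _ 2 measurableT f2.
  have h2 := @integrable_scale _ _ _ P _ _ 2 measurableT g2.
  exact: (integrable_add measurableT h1 h2).
Qed.

Lemma Rintegral_probability (a : R) : \int[P]_x a = a.
Proof.
rewrite Rintegral_cst // (_ : _ setT = 1%E) ?mulr1 //; exact: probability_setT.
Qed.

End square_integrable.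

Section product.
Context d1 d2 (T1 : measurableType d1) (T2 : measurableType d2) (R : realType)
  (P1 : probability T1 R) (P2 : probability T2 R).
Local Notation P := (P1 \x P2)%E.

Lemma integrable_fst (f : T1 -> R) : P1.-integrable setT (EFin \o f) ->
  P.-integrable setT (EFin \o (fun z => f z.1)).
Proof.
move=> fi; have /integrableP[mf _] := fi.
apply/integrable12ltyP; first exact: (measurableT_comp mf measurable_fst).
have /integrableP[_] := fi; apply: le_lt_trans; rewrite le_eqVlt; apply/orP; left; apply/eqP.
apply: eq_integral => x _; rewrite /= (integral_cst _ measurableT).
by rewrite (_ : _ setT = 1%E) ?mule1 //; exact: probability_setT.
Qed.

Lemma integrable_snd (f : T2 -> R) : P2.-integrable setT (EFin \o f) ->
  P.-integrable setT (EFin \o (fun z => f z.2)).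
Proof.
move=> fi; have /integrableP[mf _] := fi.
apply/integrable21ltyP; first exact: (measurableT_comp mf measurable_snd).
have /integrableP[_] := fi; apply: le_lt_trans; rewrite le_eqVlt; apply/orP; left; apply/eqP.
apply: eq_integral => x _; rewrite /= (integral_cst _ measurableT).
by rewrite (_ : _ setT = 1%E) ?mule1 //; exact: probability_setT.
Qed.

Lemma Rintegral_product (f : T1 * T2 -> R) (g : T1 -> R) :
  P.-integrable setT (EFin \o f) ->
  (forall x, (\int[P2]_y (f (x, y))%:E = (g x)%:E)%E) ->
  \int[P]_z f z = \int[P1]_x g x.
Proof.
move=> fi fg; rewrite /Rintegral -(integral12_prod_meas1 fi); congr fine.
by apply: eq_integral => x _; exact: fg.
Qed.

Lemma product_full (A1 : set T1) (A2 : set T2) (E : set (T1 * T2)) :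
  measurable A1 -> measurable A2 -> measurable E -> P1 A1 = 1%E -> P2 A2 = 1%E ->
  A1 `*` A2 `<=` E -> P E = 1%E.
Proof.
move=> m1 m2 mE P11 P21 sub; apply/eqP; rewrite eq_le probability_le1 //=.
have E1 : P (A1 `*` A2) = (P1 A1 * P2 A2)%E by exact: product_measure1E.
have <- : P (A1 `*` A2) = 1%E by rewrite E1 P11 P21 mule1.
by apply: le_measure => //; rewrite inE //; exact: measurableX.
Qed.

End product.

(** * Moments of the uniform measure of the sphere *)

Lemma pairingNl {R : realType} {n : nat} (l v : 'rV[R]_n) :
  pairing (- l) v = - pairing l v.
Proof. by rewrite pairingC pairingNr pairingC. Qed.

Section projection.
Context {R : realType} {n : nat} {M : topologicalType} {A : manifold R n M}
  {k : nat} (S : subriemannian A k) (cc : bundle (R := R) (n := n) (M := M)) (q : M).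
Hypotheses (sumE : (dist S q + cc q = fullv)%VS) (capE : (dist S q :&: cc q = 0)%VS).
Variable X : 'I_k -> 'rV[R]_n.
Hypothesis oX : orthonormal_at S q X.
Implicit Types (l u v w : 'rV[R]_n) (j : 'I_k).

Let proj := daddv_pi (dist S q) (cc q).

Let capE' : (cc q :&: dist S q = 0)%VS. Proof. by rewrite capvC. Qed.

Let projD w : proj w \in dist S q. Proof. exact: memv_pi. Qed.

Let proj_add w : proj w + daddv_pi (cc q) (dist S q) w = w.
Proof. by apply: (daddv_pi_add capE); rewrite sumE memvf. Qed.

Let X_dist j : X j \in dist S q. Proof. exact: basis_image_mem oX.1. Qed.

Definition coef j w : R := metric S q (proj w) (X j).

Lemma coef_linear j (a : R) u v : coef j (a *: u + v) = a * coef j u + coef j v.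
Proof. by rewrite /coef linearP metric_linear // ?projD ?X_dist. Qed.

Lemma coef0 j : coef j 0 = 0.
Proof. by rewrite /coef linear0 metric0l. Qed.

Lemma coef_comp j w : w \in cc q -> coef j w = 0.
Proof.
move=> wc; suff -> : w = 0 + (w - 0) by rewrite /coef; have := proj_add w;
  rewrite (daddv_pi_id capE' wc) => /(canRL (addrK _)); rewrite subrr add0r subr0 => ->;
  rewrite metric0l.
by rewrite subr0 add0r.
Qed.

Lemma coef_frame i j : coef j (X i) = (i == j)%:R.
Proof. by rewrite /coef (daddv_pi_id capE) ?X_dist // oX.2. Qed.

Lemma coef_decomp w : exists2 w', w' \in cc q & w = \sum_j coef j w *: X j + w'.
Proof.
exists (daddv_pi (cc q) (dist S q) w); first exact: memv_pi.
by rewrite -(orthonormal_expand oX (projD w)) proj_add.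
Qed.

Lemma coef_unique (a : 'I_k -> R) w' j : w' \in cc q ->
  coef j (\sum_i a i *: X i + w') = a j.
Proof.
move=> wc; rewrite -[\sum_i _]scale1r coef_linear mul1r (coef_comp j wc) addr0.
rewrite (_ : coef j _ = \sum_i a i * coef j (X i)).
  rewrite (bigD1 j) //= coef_frame eqxx mulr1 big1 ?addr0 // => i ij.
  by rewrite coef_frame (negbTE ij) mulr0.
elim/big_rec2: _ => [|i x y _ <-]; first exact: coef0.
by rewrite coef_linear.
Qed.

(** The basis of the horizontal covectors that is dual to [X]. *)
Definition dual_covector j : 'rV[R]_n := \row_m coef j (basis_vec m).

Lemma pairing_dual j w : pairing (dual_covector j) w = coef j w.
Proof.
rewrite [in RHS](row_sum_delta w) /pairing.
transitivity (\sum_m w ord0 m * coef j (basis_vec m)).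
  by apply: eq_bigr => m _; rewrite mxE mulrC.
elim/big_rec2: _ => [|i x y _ ->]; first by rewrite coef0.
by rewrite coef_linear.
Qed.

Lemma dual_hor j : hor cc q (dual_covector j).
Proof. by move=> w wc; rewrite pairing_dual (coef_comp j wc). Qed.

Lemma hor_pairing l w : hor cc q l ->
  pairing l w = \sum_j coef j w * pairing l (X j).
Proof.
move=> hl; have [w' wc {1}->] := coef_decomp w.
rewrite pairingDr (hl w' wc) addr0 pairing_sumr.
by apply: eq_bigr => j _; rewrite pairingZr.
Qed.

(** The isometries of the sphere used below, reflections and transpositions of
    the dual basis, have this form. *)
Definition shear u e l := l + pairing l u *: e.

Lemma shear_linear u e : linear (shear u e).
Proof.
by move=> a l l'; rewrite /shear pairingDl pairingZl scalerDl -scalerA scalerDr addrACA.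
Qed.

HB.instance Definition _ u e := GRing.isLinear.Build R 'rV[R]_n 'rV[R]_n _ _ (shear_linear u e).

Lemma pairing_shear u e l w : pairing (shear u e l) w = pairing l w + pairing l u * pairing e w.
Proof. by rewrite pairingDl pairingZl. Qed.

Lemma shear_continuous u e : continuous (shear u e).
Proof.
move=> l; have h := @pairing_continuous R n u l.
apply: (@cvgD _ _ _ (nbhs l) (nbhs_filter l)); first exact: cvg_id.
exact: (@cvgZr_tmp _ _ _ (nbhs l) (nbhs_filter l) _ _ e h).
Qed.

Lemma hor_add l e (a : R) : hor cc q l -> hor cc q e -> hor cc q (l + a *: e).
Proof. by move=> hl he w wc; rewrite pairingDl pairingZl hl // he // mulr0 addr0. Qed.

End projection.

Section sphere_moments.
Context {R : realType} {n : nat} {M : topologicalType} {A : manifold R n M}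
  {k : nat} (S : subriemannian A k) (cc : bundle (R := R) (n := n) (M := M)) (q : M).
Hypotheses (sumE : (dist S q + cc q = fullv)%VS) (capE : (dist S q :&: cc q = 0)%VS).
Variable X : 'I_k -> 'rV[R]_n.
Hypotheses (oX : orthonormal_at S q X)
  (hE : forall l, hamiltonian S q l = 2^-1 * \sum_j pairing l (X j) ^+ 2).
Local Notation B := (borel_rV R n).
Local Notation h j := (fun l : B => pairing (l : 'rV[R]_n) (X j)).
Implicit Types (l u v w : 'rV[R]_n) (i j : 'I_k).

Lemma cosphereP l : cosphere S q l <-> \sum_j pairing l (X j) ^+ 2 = 1.
Proof. by rewrite /cosphere /= hE mulrA divff ?mul1r. Qed.

Lemma cosphere_le1 l j : cosphere S q l -> `|pairing l (X j)| <= 1.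
Proof.
move=> /cosphereP; rewrite (bigD1 j) //= => E.
rewrite -(@ler_sqr _ `|_| 1) ?nnegrE // real_normK ?num_real // expr1n.
by rewrite -E lerDl; apply: sumr_ge0 => i _; exact: sqr_ge0.
Qed.

Lemma zero_measurable (f : B -> R) : measurable_fun setT f -> measurable [set l | f l = 0].
Proof.
move=> mf; rewrite -[X in measurable X]setTI; apply: (mf measurableT [set 0]).
exact: measurable_set1.
Qed.

Lemma annihilator_measurable (I : finType) (E : {vspace 'rV[R]_n}) (Y : I -> 'rV[R]_n) :
  (<<[seq Y i | i : I]>>%VS = E) -> measurable (annihilator E : set B).
Proof.
move=> YE.
have -> : annihilator E = \bigcap_(i in [set: I]) [set l : B | pairing (l : 'rV[R]_n) (Y i) = 0].
  apply/seteqP; split=> l hl.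
    by move=> i _; apply: hl; rewrite -YE memv_span //; apply/fintype.imageP; exists i.
  move=> v; rewrite -YE => /span_imageP[a ->]; rewrite pairing_sumr big1 // => i _.
  by rewrite pairingZr hl // mulr0.
by apply: fin_bigcap_measurable => // i _; apply: zero_measurable; exact: pairing_measurable.
Qed.

Lemma cosphere_measurable : measurable (cosphere S q : set B).
Proof.
have -> : cosphere S q = [set l : B | (\sum_j pairing (l : 'rV[R]_n) (X j) ^+ 2) - 1 = 0].
  by apply/seteqP; split=> l /=; [move/cosphereP => -> | move/subr0_eq/cosphereP];
    rewrite ?subrr.
apply: zero_measurable; apply: measurable_funB => //.
apply: measurable_sum => j; apply: measurable_funX; exact: pairing_measurable.
Qed.

Lemma ver_measurable : measurable (ver S q : set B).
Proof. by apply: (@annihilator_measurable 'I_k _ X); exact: span_basis oX.1. Qed.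

Lemma hor_measurable : measurable (hor cc q : set B).
Proof.
apply: (@annihilator_measurable _ _ (fun i : 'I_(\dim (cc q)) => (vbasis (cc q))`_i)).
rewrite -[RHS](span_basis (vbasisP (cc q))); congr (<<_>>%VS).
apply: (@eq_from_nth _ 0) => [|i]; rewrite size_image card_ord ?size_tuple // => idim.
rewrite (_ : i = nat_of_ord (cast_ord (esym (card_ord _)) (Ordinal idim))) //.
by rewrite nth_image enum_val_ord.
Qed.

Variable muS : probability B R.
Hypothesis hS : uniform_on_sphere S cc q muS.
Let AS : set B := cosphere S q `&` hor cc q.

Let mAS : measurable AS.
Proof. by apply: measurableI; [exact: cosphere_measurable | exact: hor_measurable]. Qed.

Lemma sphere_full : muS (~` AS) = 0%E.
Proof. by rewrite probability_setC // hS.1 subee. Qed.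

Lemma sphere_integrable (f : B -> R) (C : R) : measurable_fun setT f ->
  (forall l, AS l -> `|f l| <= C) -> muS.-integrable setT (EFin \o f).
Proof.
move=> mf fC; apply: (integrable_full mAS sphere_full); first exact/measurable_EFinP.
apply: (@integrable_ler _ _ _ _ _ f (fun=> C)) => //; first exact: measurable_funTS.
by apply: (integrableS measurableT) => //; exact: finite_measure_integrable_cst.
Qed.

Lemma sphere_invariant (T : {linear 'rV[R]_n -> 'rV[R]_n}) (f g : B -> R) :
  continuous T ->
  (forall l, hor cc q l -> hor cc q (T l) /\ hamiltonian S q (T l) = hamiltonian S q l) ->
  (forall l, f (T l) = g l) ->
  measurable_fun setT f -> muS.-integrable setT (EFin \o g) ->
  \int[muS]_l f l = \int[muS]_l g l.
Proof.
move=> cT hT fg mf fi.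
have mT : measurable_fun setT (T : B -> B).
  apply: (@measurability _ _ _ B setT _ (@open 'rV[R]_n) erefl) => _ [U oU <-].
  by rewrite setTI; apply: open_borel; move/continuousP: cT; apply.
have gE : (g : B -> R) = f \o T by apply/funext => l; rewrite -fg.
rewrite gE in fi *; rewrite /Rintegral; congr fine.
transitivity (\int[pushforward muS (T : B -> B)]_x (f x)%:E)%E.
  by apply: eq_measure_integral => U mU _; exact: esym (hS.2 T hT U mU).
rewrite integral_pushforward //; exact/measurable_EFinP.
Qed.

Lemma sphere_integrable1 j : muS.-integrable setT (EFin \o h j).
Proof.
apply: (@sphere_integrable _ 1); first exact: pairing_measurable.
by move=> l [hl _]; exact: cosphere_le1.
Qed.

Lemma sphere_integrable2 i j : muS.-integrable setT (EFin \o (fun l => h i l * h j l)).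
Proof.
apply: (@sphere_integrable _ 1); first by apply: measurable_funM; exact: pairing_measurable.
by move=> l [hl _]; rewrite normrM mulr_ile1 //; exact: cosphere_le1.
Qed.

Let flip i := shear (- 2 *: X i) (dual_covector S cc q X i).

Let pairing_flip i l j : pairing (flip i l) (X j) =
  if i == j then - pairing l (X j) else pairing l (X j).
Proof.
rewrite pairing_shear pairing_dual // coef_frame // pairingZr eq_sym.
by case: eqVneq => [->|_] /=; ring.
Qed.

Let flip_hor i l : hor cc q l ->
  hor cc q (flip i l) /\ hamiltonian S q (flip i l) = hamiltonian S q l.
Proof.
move=> hl; split; first by apply: hor_add => //; exact: dual_hor.
rewrite !hE; congr (_ * _); apply: eq_bigr => j _; rewrite pairing_flip.
by case: ifP => // _; rewrite sqrrN.
Qed.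

Let neg_integral (f : B -> R) : muS.-integrable setT (EFin \o f) ->
  \int[muS]_l f l = \int[muS]_l (- 1 * f l) -> \int[muS]_l f l = 0.
Proof. by move=> fi; rewrite RintegralZl //; lra. Qed.

(** The reflection [h_j |-> - h_j] is an isometry of the horizontal covectors;
    it kills the mean and the mixed moments. *)
Lemma sphere_mean j : \int[muS]_l h j l = 0.
Proof.
apply: neg_integral; first exact: sphere_integrable1.
apply: (@sphere_invariant (flip j)) => //.
- exact: shear_continuous.
- exact: flip_hor.
- by move=> l; rewrite pairing_flip eqxx mulN1r.
- exact: pairing_measurable.
- apply: integrable_scale => //; exact: sphere_integrable1.
Qed.

Lemma sphere_mixed i j : i != j -> \int[muS]_l (h i l * h j l) = 0.
Proof.
move=> ij; apply: neg_integral; first exact: sphere_integrable2.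
apply: (@sphere_invariant (flip j)) => //.
- exact: shear_continuous.
- exact: flip_hor.
- by move=> l; rewrite !pairing_flip eqxx eq_sym (negbTE ij); ring.
- by apply: measurable_funM; exact: pairing_measurable.
- apply: integrable_scale => //; exact: sphere_integrable2.
Qed.

(** The transposition of [h_i] and [h_j] is an isometry as well, so that all
    squares have the same mean; these means add up to [1]. *)
Lemma sphere_square i j : \int[muS]_l (h i l * h i l) = \int[muS]_l (h j l * h j l).
Proof.
pose swap := shear (X j - X i) (dual_covector S cc q X i - dual_covector S cc q X j).
have E l m : pairing (swap l) (X m) = pairing l (X (tperm i j m)).
  rewrite pairing_shear pairingDl pairingDr !pairingNr pairingNl !pairing_dual //.
  rewrite !coef_frame //.
  case: tpermP => [->|->|mi mj].
  - rewrite eqxx; case: eqVneq => [->|_] /=; ring.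
  - rewrite eqxx; case: eqVneq => [->|_] /=; ring.
  - by move/eqP/negbTE: mi => ->; move/eqP/negbTE: mj => ->; rewrite /=; ring.
apply: (@sphere_invariant swap) => //.
- exact: shear_continuous.
- move=> l hl; split.
    apply: hor_add => //.
    by move=> w wc; rewrite pairingDl pairingNl !(dual_hor sumE capE oX) // subrr.
  rewrite !hE; congr (_ * _); rewrite [RHS](reindex_inj (@perm_inj _ (tperm i j))) /=.
  by apply: eq_bigr => m _; rewrite E.
- by move=> l; rewrite E tpermL.
- by apply: measurable_funM; exact: pairing_measurable.
- exact: sphere_integrable2.
Qed.

Lemma sphere_covariance i j : \int[muS]_l (h i l * h j l) = (i == j)%:R / k%:R.
Proof.
case: (eqVneq i j) => [<-|ij]; last by rewrite sphere_mixed // mul0r.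
have k0 : k%:R != 0 :> R.
  rewrite pnatr_eq0 -lt0n; exact: leq_ltn_trans (leq0n i) (ltn_ord i).
apply: (mulfI k0); rewrite mulrCA divff // mulr1 -sum_const_ord.
transitivity (\sum_j \int[muS]_l (h j l * h j l)).
  by apply: eq_bigr => m _; exact: sphere_square.
rewrite -Rintegral_sumr //; last by move=> m; exact: sphere_integrable2.
transitivity (\int[muS]_(l in setT) (1 : R)).
  apply: (eq_Rintegral_full mAS sphere_full) => //.
    by apply: measurable_sum => m; apply: measurable_funM; exact: pairing_measurable.
  by move=> l [/cosphereP <- _]; apply: eq_bigr => m _; rewrite expr2.
exact: Rintegral_probability.
Qed.

Let sphere_pairingE w l : AS l -> pairing l w = \sum_i coef S cc q X i w * h i l.
Proof. by move=> [_ hl]; exact: (hor_pairing sumE capE oX). Qed.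

(** On horizontal covectors [w] may be replaced by its projection on the
    distribution. *)
Lemma sphere_pairing_covariance j w :
  \int[muS]_l (h j l * pairing (l : 'rV[R]_n) w) = coef S cc q X j w / k%:R.
Proof.
transitivity (\int[muS]_l (\sum_i coef S cc q X i w * (h j l * h i l))).
  apply: (eq_Rintegral_full mAS sphere_full).
  - by apply: measurable_funM; exact: pairing_measurable.
  - apply: measurable_sum => m; apply: measurable_funM => //.
    by apply: measurable_funM; exact: pairing_measurable.
  - move=> l Al; rewrite (sphere_pairingE w Al) mulr_sumr.
    by apply: eq_bigr => i _; rewrite mulrCA.
rewrite Rintegral_sumr //; last first.
  by move=> i; apply: integrable_scale => //; exact: sphere_integrable2.
rewrite (bigD1 j) //= big1 ?addr0 => [|i ij].
  by rewrite RintegralZl ?sphere_covariance ?eqxx ?mul1r //; exact: sphere_integrable2.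
rewrite RintegralZl ?sphere_covariance //; last exact: sphere_integrable2.
by rewrite eq_sym (negbTE ij) mul0r mulr0.
Qed.

Lemma sphere_pairing_sqr w :
  muS.-integrable setT (EFin \o (fun l : B => pairing (l : 'rV[R]_n) w ^+ 2)).
Proof.
apply: (@sphere_integrable _ ((\sum_i `|coef S cc q X i w|) ^+ 2)).
  by apply: measurable_funX; exact: pairing_measurable.
move=> l Al; rewrite normrX; apply: lerXn2r; rewrite ?nnegrE //; first exact: sumr_ge0.
rewrite (sphere_pairingE w Al); apply: le_trans (ler_norm_sum _ _ _) _.
by apply: ler_sum => i _; rewrite normrM ler_piMr // cosphere_le1 //; case: Al.
Qed.

End sphere_moments.

(** * Moments of an adapted measure *)

Section adapted_moments.
Context {R : realType} {n : nat} {M : topologicalType} {A : manifold R n M}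
  {k : nat} (S : subriemannian A k) (cc : bundle (R := R) (n := n) (M := M)) (q : M).
Hypotheses (sumE : (dist S q + cc q = fullv)%VS) (capE : (dist S q :&: cc q = 0)%VS).
Variable X : 'I_k -> 'rV[R]_n.
Hypotheses (oX : orthonormal_at S q X)
  (hE : forall l, hamiltonian S q l = 2^-1 * \sum_j pairing l (X j) ^+ 2).
Local Notation B := (borel_rV R n).
Local Notation pr w := (fun l : B => pairing (l : 'rV[R]_n) w).
Variables (muS muV muq : probability B R).
Hypotheses (hS : uniform_on_sphere S cc q muS) (hV : muV (ver S q) = 1%E)
  (hV2 : two_decreasing S q muV).
Local Notation add := ((fun z : B * B => (z.1 : 'rV[R]_n) + (z.2 : 'rV[R]_n)) : B * B -> B).
Hypothesis muE : forall E : set B, measurable E -> muq E = (muS \x muV)%E (add @^-1` E).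
Implicit Types (l u v w : 'rV[R]_n) (i j : 'I_k).
Let nu := (muS \x muV)%E.

Let mver : measurable (ver S q : set B). Proof. exact: ver_measurable oX. Qed.
Let mco : measurable (cosphere S q : set B). Proof. exact: cosphere_measurable hE. Qed.
Let mhor : measurable (hor cc q : set B). Proof. exact: hor_measurable. Qed.

Lemma ver_full : muV (~` (ver S q : set B)) = 0%E.
Proof. by rewrite probability_setC // hV subee. Qed.

(** A vertical covector vanishes on the distribution, so that adding it does not
    change the Hamiltonian. *)
Lemma cosphere_full : muq (~` (cosphere S q : set B)) = 0%E.
Proof.
rewrite probability_setC // muE // (@product_full _ _ _ _ _ muS muV
  (cosphere S q `&` hor cc q) (ver S q)) ?subee //.
- exact: measurableI.
- by rewrite -[X in measurable X]setTI; exact: add_measurable.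
- exact: hS.1.
- move=> [s v] /= [[/(cosphereP hE) hs _] hv]; apply/(cosphereP hE).
  rewrite -hs; apply: eq_bigr => j _; rewrite pairingDl (hv (X j)) ?addr0 //.
  exact: basis_image_mem oX.1.
Qed.

Lemma integrable_adapted (f : B -> R) : measurable_fun setT f ->
  nu.-integrable setT (EFin \o (f \o add)) -> muq.-integrable setT (EFin \o f).
Proof.
move=> mf /integrableP[_ fi]; apply/integrableP; split; first exact/measurable_EFinP.
apply: le_lt_trans fi; rewrite le_eqVlt; apply/orP; left; apply/eqP.
transitivity (\int[pushforward nu add]_x `|(f x)%:E|)%E.
  by apply: eq_measure_integral => [|mA U mU _]; [exact: add_measurable | exact: muE].
rewrite ge0_integral_pushforward //.
- exact: add_measurable.
- by apply: measurableT_comp => //; exact/measurable_EFinP.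
Qed.

Lemma Rintegral_adapted (f : B -> R) : measurable_fun setT f ->
  nu.-integrable setT (EFin \o (f \o add)) ->
  \int[muq]_l f l = \int[nu]_z f (add z).
Proof.
move=> mf fi; rewrite /Rintegral; congr fine.
transitivity (\int[pushforward nu add]_x (f x)%:E)%E.
  by apply: eq_measure_integral => [|mA U mU _]; [exact: add_measurable | exact: muE].
rewrite integral_pushforward //; first exact: add_measurable.
exact/measurable_EFinP.
Qed.

Lemma ver_pairing_sqr w : muV.-integrable setT (EFin \o (fun l => pr w l ^+ 2)).
Proof.
apply: (integrable_full mver ver_full).
  by apply/measurable_EFinP; apply: measurable_funX; exact: pairing_measurable.
by apply: hV2 => a u v; rewrite pairingDl pairingZl.
Qed.

Let pr_sqr w : nu.-integrable setT (EFin \o (fun z => (pr w z.1 + pr w z.2) ^+ 2)).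
Proof.
apply: integrableD_sqr.
- exact: (measurableT_comp (pairing_measurable w) measurable_fst).
- exact: (measurableT_comp (pairing_measurable w) measurable_snd).
- exact: (@integrable_fst _ _ _ _ _ muS muV _ (sphere_pairing_sqr sumE capE oX hE hS w)).
- exact: (@integrable_snd _ _ _ _ _ muS muV _ (ver_pairing_sqr w)).
Qed.

Let pr_sqr_full w : muq.-integrable setT (EFin \o (fun l => pr w l ^+ 2)).
Proof.
apply: integrable_adapted.
  by apply: measurable_funX; exact: pairing_measurable.
by have := pr_sqr w; apply: eq_integrable => // z _; rewrite /= pairingDl.
Qed.

Let mpr w : measurable_fun setT (pr w). Proof. exact: pairing_measurable. Qed.

Let prM_full u w : muq.-integrable setT (EFin \o (fun l => pr u l * pr w l)).
Proof. exact: (integrableM_sqr (mpr u) (mpr w)). Qed.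

Let pr_full w : muq.-integrable setT (EFin \o pr w).
Proof. exact: (integrable_of_sqr (mpr w)). Qed.

Let restrict (f : B -> R) : muq.-integrable setT (EFin \o f) ->
  \int[muq]_(l in (cosphere S q : set B)) f l = \int[muq]_l f l.
Proof.
by move=> fi; rewrite /Rintegral; congr fine; rewrite -(integral_full mco cosphere_full fi).
Qed.

Lemma adapted_cst (a : R) : \int[muq]_(l in (cosphere S q : set B)) a = a.
Proof.
rewrite (@restrict (fun=> a)) ?Rintegral_probability //.
exact: finite_measure_integrable_cst.
Qed.

Lemma adapted_integrable1 w : muq.-integrable (cosphere S q : set B) (EFin \o pr w).
Proof. exact: (integrableS measurableT mco _ (pr_full w)). Qed.

Lemma adapted_integrable2 u w :
  muq.-integrable (cosphere S q : set B) (EFin \o (fun l => pr u l * pr w l)).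
Proof. exact: (integrableS measurableT mco _ (prM_full u w)). Qed.

Let ver_integrable w : muV.-integrable setT (EFin \o pr w).
Proof. exact: (integrable_of_sqr (mpr w) (ver_pairing_sqr w)). Qed.

Let madd w : measurable_fun setT (fun z : B * B => pr w z.1 + pr w z.2).
Proof.
apply: measurable_funD.
- exact: (measurableT_comp (pairing_measurable w) measurable_fst).
- exact: (measurableT_comp (pairing_measurable w) measurable_snd).
Qed.

Let ver_dist j l : ver S q l -> pairing l (X j) = 0.
Proof. by apply; exact: basis_image_mem oX.1. Qed.

Lemma adapted_mean j : \int[muq]_(l in (cosphere S q : set B)) pr (X j) l = 0.
Proof.
have nui : nu.-integrable setT (EFin \o (pr (X j) \o add)).
  have := integrable_of_sqr (madd (X j)) (pr_sqr (X j)).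
  by apply: eq_integrable => // z _; rewrite /= pairingDl.
rewrite (restrict (pr_full _)) Rintegral_adapted //.
rewrite (Rintegral_product nui (g := fun s => pr (X j) s)) => [|s].
  exact: (sphere_mean sumE capE oX hE hS).
transitivity (\int[muV]_v (pr (X j) s)%:E)%E.
  apply: (eq_integral_full mver ver_full) => //.
    apply/measurable_EFinP => /=.
    under eq_fun do rewrite pairingDl.
    by apply: measurable_funD => //; exact: pairing_measurable.
  by move=> v hv; rewrite /= pairingDl (ver_dist j hv) addr0.
by rewrite integral_cst // (_ : _ setT = 1%E) ?mule1 //; exact: probability_setT.
Qed.

(** Given the horizontal part of a covector, its vertical part only
    contributes through the mean of the vertical measure, and this
    contribution is killed by the mean of the sphere. *)
Lemma adapted_covariance j w :
  \int[muq]_(l in (cosphere S q : set B)) (pr (X j) l * pr w l) = coef S cc q X j w / k%:R.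
Proof.
pose f (l : B) := pr (X j) l * pr w l.
have mf : measurable_fun setT f by exact: measurable_funM.
have nui : nu.-integrable setT (EFin \o (f \o add)).
  have := integrableM_sqr (madd (X j)) (madd w) (pr_sqr (X j)) (pr_sqr w).
  by apply: eq_integrable => // z _; rewrite /f /= !pairingDl.
rewrite (restrict (prM_full _ _)) (Rintegral_adapted mf nui).
(* [s] is the horizontal part of the covector, held fixed *)
pose m := \int[muV]_v pr w v.
rewrite (Rintegral_product nui (g := fun s => pr (X j) s * pr w s + m * pr (X j) s)) => [|s].
  rewrite RintegralD //; first last.
  - by apply: integrable_scale => //; exact: (sphere_integrable1 hE hS).
  - apply: integrableM_sqr => //; exact: (sphere_pairing_sqr sumE capE oX hE hS).
  rewrite RintegralZl ?(sphere_mean sumE capE oX hE hS) ?mulr0 ?addr0 //;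
    last exact: (sphere_integrable1 hE hS).
  exact: (sphere_pairing_covariance sumE capE oX hE hS).
have si : muV.-integrable setT (EFin \o (fun v => pr (X j) s * pr w v)) by exact: integrable_scale.
have ci : muV.-integrable setT (EFin \o (fun=> pr (X j) s * pr w s)).
  exact: finite_measure_integrable_cst.
transitivity (\int[muV]_v (pr (X j) s * pr w s + pr (X j) s * pr w v)%:E)%E.
  apply: (eq_integral_full mver ver_full).
  - apply/measurable_EFinP; rewrite /f /=.
    under eq_fun do rewrite !pairingDl.
    apply: measurable_funM; apply: measurable_funD => //; exact: pairing_measurable.
  - by apply/measurable_EFinP; apply: measurable_funD => //; apply: measurable_funM.
  - by move=> v hv; rewrite /f /= !pairingDl (ver_dist j hv) addr0 mulrDr.
rewrite -[LHS]fineK; last by apply: integrable_fin_num => //; exact: integrable_add.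
congr EFin; rewrite -/(Rintegral _ _ _) RintegralD // Rintegral_probability RintegralZl //.
by rewrite [m * _]mulrC.
Qed.

End adapted_moments.

(** * The mean of the Taylor expansion *)

Section expectation.
Context d (T : measurableType d) (R : realType) (mu : {measure set T -> \bar R}) (D : set T).
Hypotheses (mD : measurable D)
  (icst : forall a : R, mu.-integrable D (EFin \o (fun=> a)))
  (cst1 : forall a : R, \int[mu]_(x in D) a = a).

(** The mean of [g] is squeezed between the means of its Taylor polynomial plus
    or minus the remainder.  Division by [t ^+ 2] is harmless because the first
    order term has mean zero. *)
Lemma expectation_taylor (a t C : R) (g F1 F2 Q : T -> R) : 0 < t ->
  mu.-integrable D (EFin \o F1) -> mu.-integrable D (EFin \o F2) ->
  mu.-integrable D (EFin \o Q) -> \int[mu]_(x in D) F1 x = 0 ->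
  (forall x, D x -> `|g x - a - t * F1 x - t ^+ 2 / 2 * F2 x| <= C * t ^+ 3 * Q x) ->
  `|2 / t ^+ 2 * (\int[mu]_(x in D) g x - a) - \int[mu]_(x in D) F2 x| <=
    2 * C * t * \int[mu]_(x in D) Q x.
Proof.
move=> t0 i1 i2 iQ m1 h.
pose G s x := a + (t * F1 x + (t ^+ 2 / 2 * F2 x + s * Q x)).
have j1 := @integrable_scale _ _ _ mu D F1 t mD i1.
have j2 := @integrable_scale _ _ _ mu D F2 (t ^+ 2 / 2) mD i2.
have jQ s := @integrable_scale _ _ _ mu D Q s mD iQ.
have j3 s := integrable_add mD j2 (jQ s).
have j4 s := integrable_add mD j1 (j3 s).
have iG s : mu.-integrable D (EFin \o G s) := integrable_add mD (icst a) (j4 s).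
have GE s : \int[mu]_(x in D) G s x =
    a + (t ^+ 2 / 2 * \int[mu]_(x in D) F2 x + s * \int[mu]_(x in D) Q x).
  rewrite /G (RintegralD mD (icst a) (j4 s)) (RintegralD mD j1 (j3 s)).
  by rewrite (RintegralD mD j2 (jQ s)) !RintegralZl // m1 cst1 mulr0 add0r.
have := @Rintegral_sandwich _ _ _ mu D g (G (- (C * t ^+ 3))) (G (C * t ^+ 3)) mD (iG _) (iG _).
rewrite !GE => /(_ _)/andP[|lo hi].
  by move=> x /h; rewrite ler_norml /G => /andP[h1 h2]; apply/andP; split; lra.
set I := \int[mu]_(x in D) g x in lo hi *.
have -> : 2 / t ^+ 2 * (I - a) - \int[mu]_(x in D) F2 x =
    2 / t ^+ 2 * (I - a - t ^+ 2 / 2 * \int[mu]_(x in D) F2 x) by field; lra.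
rewrite normrM ger0_norm ?divr_ge0 ?sqr_ge0 //.
have -> : 2 * C * t * \int[mu]_(x in D) Q x =
    2 / t ^+ 2 * (C * t ^+ 3 * \int[mu]_(x in D) Q x) by field; lra.
apply: ler_wpM2l; first by rewrite divr_ge0 ?sqr_ge0.
by rewrite ler_norml; apply/andP; split; lra.
Qed.

End expectation.

(** The remainder of [exp_taylor] is dominated by a quadratic polynomial, whose mean is
    a combination of second moments. *)
Lemma sqr_norm_le_sum {R : realType} {n : nat} (x : 'rV[R]_n) :
  (1 + `|x|) ^+ 2 <= 2 + 2 * \sum_i x ord0 i * x ord0 i.
Proof.
have s0 : 0 <= \sum_i x ord0 i * x ord0 i.
  by apply: sumr_ge0 => i _; rewrite -expr2 sqr_ge0.
have h : `|x| <= Num.sqrt (\sum_i x ord0 i * x ord0 i).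
  apply: rV_norm_le => [|i]; first exact: sqrtr_ge0.
  rewrite -sqrtr_sqr; apply: ler_wsqrtr; rewrite (bigD1 i) //= expr2 lerDl.
  by apply: sumr_ge0 => j _; rewrite -expr2 sqr_ge0.
have h2 : `|x| ^+ 2 <= \sum_i x ord0 i * x ord0 i.
  by rewrite -[leRHS]sqr_sqrtr // lerXn2r ?nnegrE ?sqrtr_ge0.
have := sqr_ge0 (1 - `|x|); nra.
Qed.

Lemma sum_mul_split {R : comNzRingType} {k : nat} (h b d : 'I_k -> R) (a e : R) :
  (\sum_j h j * b j) * a + e * (\sum_j h j * d j) =
  \sum_j (a * (h j * b j) + d j * (e * h j)).
Proof.
rewrite mulr_suml mulr_sumr -big_split /=; apply: eq_bigr => j _.
by ring.
Qed.

Lemma sum_kronecker {R : pzRingType} {k : nat} (d : 'I_k -> R) (i : 'I_k) :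
  \sum_j d j * (i == j)%:R = d i.
Proof.
rewrite (bigD1 i) //= eqxx mulr1 big1 ?addr0 // => j ji.
by rewrite eq_sym (negbTE ji) mulr0.
Qed.

Section operator.
Context {R : realType} {n : nat} {M : topologicalType} {A : manifold R n M}
  {k : nat} (S : subriemannian A k) (cc : bundle (R := R) (n := n) (M := M)).
Variables (U : set M) (X : 'I_k -> vfield (R := R) (n := n) (M := M)).
Hypotheses (oX : orthonormal_frame S U X) (hcc : is_complement S cc).
Variable c : chart R n M.
Hypothesis hc : atlas A c.
Let V (j : 'I_k) := chart_field A c (X j).
Local Notation B := (borel_rV R n).

Lemma jac_chart_at_id q v : jac (chart_at A q) (chart_at A q) q v = v.
Proof. exact/jac_id/chart_at_dom. Qed.

Lemma pairing_covector_jac q (l v : 'rV[R]_n) : cdom c q ->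
  pairing (covector_coord A c q l) v = pairing l (jac c (chart_at A q) q v).
Proof.
move=> cq; have ha := chart_at_atlas A q; have hd := chart_at_dom A q.
rewrite (pairing_covector_transition _ _ hc ha cq hd) -[RHS](pairing_covector_coord ha hd).
by rewrite tangent_coordE jac_chart_at_id.
Qed.

(** The limit operator, computed in the chart [c].  The tangent coordinates of
    the brackets are first brought back to [T_qM] by [jac], where their
    projection on the distribution is taken. *)
Definition chart_laplacian (phi : M -> R) q : R :=
  let f x := phi (cinv c x) in
  \sum_i (\sum_j coef S cc q (X^~ q) j (jac c (chart_at A q) q (bracket (V j) (V i) (c q))) *
            lieD (V i) f (c q)
          + lieD (V i) (lieD (V i) f) (c q)).

Section at_point.
Variables (q : M) (muq : probability B R).
Hypotheses (cq : cdom c q) (Uq : U q) (hmu : exists muS muV : probability B R,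
     [/\ uniform_on_sphere S cc q muS, muV (ver S q) = 1%E, two_decreasing S q muV &
      forall E : set B, measurable E -> muq E = (muS \x muV)%E
          [set z | E ((z.1 : 'rV[R]_n) + (z.2 : 'rV[R]_n))]]).
Let D : set B := cosphere S q.
Let P (l : B) := covector_coord A c q (l : 'rV[R]_n).
Let oXq := orthonormal_frame_at oX Uq.
Let hE l : hamiltonian S q l = 2^-1 * \sum_i pairing l (X i q) ^+ 2.
Proof. by apply: (hamiltonianE _ _ oX Uq); exists U, X. Qed.
Let sumE : (dist S q + cc q = fullv)%VS. Proof. by case: (hcc.2 q). Qed.
Let capE : (dist S q :&: cc q = 0)%VS. Proof. by case: (hcc.2 q). Qed.

Let PV (l : B) j : pairing (P l) (V j (c q)) = pairing (l : 'rV[R]_n) (X j q).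
Proof. by rewrite /P /V chart_fieldE // pairing_covector_coord. Qed.

Lemma cosphere_measurable_at : measurable D.
Proof. exact: cosphere_measurable hE. Qed.

Lemma cosphere_expectation_cst a : \int[muq]_(l in D) a = a.
Proof. by case: hmu => muS [muV [h1 h2 h3 h4]]; exact: (adapted_cst oXq hE h1 h2 h4). Qed.

Lemma integrable_pairing w : muq.-integrable D (EFin \o (fun l => pairing (P l) w)).
Proof.
case: hmu => muS [muV [h1 h2 h3 h4]].
have := adapted_integrable1 sumE capE oXq hE h1 h2 h3 h4 (jac c (chart_at A q) q w).
by apply: eq_integrable => [|l _] /=; [exact: cosphere_measurable_at | rewrite pairing_covector_jac].
Qed.

Lemma integrable_pairing2 v w :
  muq.-integrable D (EFin \o (fun l => pairing (P l) v * pairing (P l) w)).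
Proof.
case: hmu => muS [muV [h1 h2 h3 h4]].
have := adapted_integrable2 sumE capE oXq hE h1 h2 h3 h4
  (jac c (chart_at A q) q v) (jac c (chart_at A q) q w).
by apply: eq_integrable => [|l _] /=; [exact: cosphere_measurable_at | rewrite !pairing_covector_jac].
Qed.

Lemma expectation_frame j : \int[muq]_(l in D) pairing (P l) (V j (c q)) = 0.
Proof.
case: hmu => muS [muV [h1 h2 h3 h4]].
rewrite -(adapted_mean sumE capE oXq hE h1 h2 h3 h4 j).
by apply: eq_Rintegral => l _; rewrite PV.
Qed.

Lemma expectation_frame2 j w : \int[muq]_(l in D) (pairing (P l) (V j (c q)) * pairing (P l) w) =
  coef S cc q (X^~ q) j (jac c (chart_at A q) q w) / k%:R.
Proof.
case: hmu => muS [muV [h1 h2 h3 h4]].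
rewrite -(adapted_covariance sumE capE oXq hE h1 h2 h3 h4 j (jac c (chart_at A q) q w)).
by apply: eq_Rintegral => l _; rewrite PV pairing_covector_jac.
Qed.

Lemma integrable_flow_derive1 f :
  muq.-integrable D (EFin \o (fun l => flow_derive1 V f (c q) (P l))).
Proof.
apply: integrable_sumr => [|i]; first exact: cosphere_measurable_at.
apply: (eq_integrable _ (EFin \o (fun l => lieD (V i) f (c q) * pairing (P l) (V i (c q))))).
- exact: cosphere_measurable_at.
- by move=> l _; rewrite /= mulrC.
- apply: integrable_scale; [exact: cosphere_measurable_at | exact: integrable_pairing].
Qed.

Lemma expectation_flow_derive1 f : \int[muq]_(l in D) flow_derive1 V f (c q) (P l) = 0.
Proof.
have i1 i : muq.-integrable D
    (EFin \o (fun l => lieD (V i) f (c q) * pairing (P l) (V i (c q)))).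
  apply: integrable_scale; [exact: cosphere_measurable_at | exact: integrable_pairing].
transitivity (\int[muq]_(l in D) \sum_i lieD (V i) f (c q) * pairing (P l) (V i (c q))).
  by apply: eq_Rintegral => l _; apply: eq_bigr => i _; rewrite mulrC.
rewrite Rintegral_sumr //; last exact: cosphere_measurable_at.
rewrite big1 // => i _; rewrite RintegralZl ?expectation_frame ?mulr0 //.
- exact: cosphere_measurable_at.
- exact: integrable_pairing.
Qed.

Let term f i j l := lieD (V i) f (c q) *
    (pairing (P l) (V j (c q)) * pairing (P l) (bracket (V j) (V i) (c q))) +
  lieD (V j) (lieD (V i) f) (c q) * (pairing (P l) (V i (c q)) * pairing (P l) (V j (c q))).

Let flow_derive2E f l : flow_derive2 V f (c q) (P l) = \sum_i \sum_j term f i j l.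
Proof.
apply: eq_bigr => i _.
exact: (sum_mul_split (fun j => pairing (P l) (V j (c q)))
  (fun j => pairing (P l) (bracket (V j) (V i) (c q)))
  (fun j => lieD (V j) (lieD (V i) f) (c q)) (lieD (V i) f (c q)) (pairing (P l) (V i (c q)))).
Qed.

Let integrable_term f i j : muq.-integrable D (EFin \o term f i j).
Proof.
by apply: integrable_add; [exact: cosphere_measurable_at | |];
  apply: integrable_scale; [exact: cosphere_measurable_at | exact: integrable_pairing2 |
    exact: cosphere_measurable_at | exact: integrable_pairing2].
Qed.

Lemma integrable_flow_derive2 f :
  muq.-integrable D (EFin \o (fun l => flow_derive2 V f (c q) (P l))).
Proof.
apply: (eq_integrable _ (EFin \o (fun l => \sum_i \sum_j term f i j l))).
- exact: cosphere_measurable_at.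
- by move=> l _; rewrite /= flow_derive2E.
- do 2![apply: integrable_sumr => [|?]; first exact: cosphere_measurable_at].
  exact: integrable_term.
Qed.

(** The covariance of [h_j] and [<l, w>] is [coef j w / k].  For
    [w = [X_j, X_i]] this produces the drift, and for [w = X_i] the Kronecker
    symbol that leaves the sum of squares. *)
Lemma expectation_flow_derive2 (phi : M -> R) :
  k%:R * \int[muq]_(l in D) flow_derive2 V (fun x => phi (cinv c x)) (c q) (P l) =
  chart_laplacian phi q.
Proof.
have mD := cosphere_measurable_at.
set f := fun x => phi (cinv c x).
transitivity (k%:R * \int[muq]_(l in D) \sum_i \sum_j term f i j l).
  by congr (_ * _); apply: eq_Rintegral => l _; exact: flow_derive2E.
rewrite Rintegral_sumr //; last first.
  by move=> i; apply: integrable_sumr => // j; exact: integrable_term.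
rewrite mulr_sumr; apply: eq_bigr => i _.
have k0 : k%:R != 0 :> R.
  rewrite pnatr_eq0 -lt0n; exact: leq_ltn_trans (leq0n i) (ltn_ord i).
rewrite Rintegral_sumr //; last by move=> j; exact: integrable_term.
rewrite mulr_sumr.
have E j : \int[muq]_(l in D) term f i j l =
    k%:R^-1 * (coef S cc q (X^~ q) j (jac c (chart_at A q) q (bracket (V j) (V i) (c q))) *
            lieD (V i) f (c q) + lieD (V j) (lieD (V i) f) (c q) * (i == j)%:R).
  rewrite RintegralD //; try by apply: integrable_scale => //; exact: integrable_pairing2.
  rewrite !RintegralZl ?expectation_frame2 //; try exact: integrable_pairing2.
  have -> : jac c (chart_at A q) q (V j (c q)) = X j q.
    by rewrite /V chart_fieldE // tangent_coordK.
  by rewrite (coef_frame capE oXq) eq_sym; ring.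
under eq_bigr do rewrite E mulrA divff // mul1r.
rewrite big_split /= -mulr_suml; congr (_ + _).
exact: (sum_kronecker (fun j => lieD (V j) (lieD (V i) f) (c q)) i).
Qed.

End at_point.
End operator.

(** * Local boundedness of the second moments *)

Lemma cube_in_open {R : realType} {n : nat} (O : set 'rV[R]_n) x : open O -> O x ->
  exists2 r : R, 0 < r & cube x (r + r) `<=` O.
Proof.
move=> oO Ox; have /nbhs_ballP[e /= e0 he] : nbhs x O by apply: open_nbhs_nbhs.
exists (e / 4); first by rewrite divr_gt0.
move=> y hy; apply: he; rewrite -ball_normE /= distrC; apply: le_lt_trans hy _; lra.
Qed.

Section bump.
Context {R : realType} {n : nat} {M : topologicalType} {A : manifold R n M}.
Variables (c : chart R n M) (q0 : M) (r : R).
Hypotheses (hc : atlas A c) (cq0 : cdom c q0) (r0 : 0 < r)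
  (KD : cube (c q0) (r + r) `<=` c @` (cdom c `&` setT)).

(** A bump function supported in the chart, to turn the coordinates of
    covectors into continuous functions on the whole cotangent bundle. *)
Definition bump q : R :=
  if `[< cdom c q >] then Num.max 0 (1 - r^-1 * `|c q - c q0|) else 0.

Lemma bumpE q : cdom c q -> bump q = Num.max 0 (1 - r^-1 * `|c q - c q0|).
Proof. by rewrite /bump => /asboolP ->. Qed.

Lemma bump_out q : ~ (cdom c q /\ cube (c q0) (r + r) (c q)) -> bump q = 0.
Proof.
rewrite /bump; case: ifPn => // /asboolP cq h; apply/max_idPl.
have {}h : r < `|c q - c q0|.
  rewrite ltNge; apply/negP => le; apply: h; split=> //; apply: (le_trans le); by rewrite lerDl ltW.
have : r^-1 * r <= r^-1 * `|c q - c q0| by rewrite ler_wpM2l ?invr_ge0 // ltW.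
by rewrite mulVf ?gt_eqF // => ?; lra.
Qed.

Lemma chart_norm_continuous q : cdom c q -> {for q, continuous (fun p => `|c p - c q0|)}.
Proof.
move=> cq; apply: (@cvg_norm _ _ _ (nbhs q) (nbhs_filter q)).
apply: (@cvgB _ _ _ (nbhs q) (nbhs_filter q)); first exact: cmap_continuous.
exact: cvg_cst.
Qed.

Lemma bump_near : \forall q \near q0, cdom c q /\ 2^-1 <= bump q.
Proof.
have h := chart_norm_continuous cq0; rewrite /prop_for /continuous_at subrr normr0 in h.
have h2 : \forall q \near q0, `|c q - c q0| < r / 2.
  by apply: (cvgr_lt _ h); rewrite divr_gt0.
have h1 : \forall q \near q0, cdom c q by apply: open_nbhs_nbhs; split=> //; exact: cdom_open.
apply: filterS2 h1 h2 => q cq hq; split=> //; rewrite bumpE // le_max; apply/orP; right.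
have : r^-1 * `|c q - c q0| <= r^-1 * (r / 2) by rewrite ler_wpM2l ?invr_ge0 // ltW.
by rewrite mulrA mulVf ?gt_eqF // => ?; lra.
Qed.

Definition bump_coord (i : 'I_n) q (l : 'rV[R]_n) : R :=
  bump q * covector_coord A c q l ord0 i.

(** On the cube of radius [r + r] the coordinates of covectors depend smoothly on
    those of any other chart.  The complement of this cube is open in the
    manifold by [chart_cube_closed], and the bump function vanishes there. *)
Lemma bump_coord_continuous i : continuous_fiberwise_linear (A := A) (bump_coord i).
Proof.
split=> [q a u v|c' hc' q p c'q].
  by rewrite /bump_coord !mxE pairingDl pairingZl mulrDr mulrCA.
have cinvq : {for (c' q, p), continuous (fun z : 'rV[R]_n * 'rV[R]_n => cinv c' z.1)}.
  apply: (@continuous_comp _ _ _ fst (cinv c')); first exact: cvg_fst.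
  exact: cinv_continuous.
have zq : cinv c' (c' q, p).1 = q by rewrite /= cmapK.
case: (pselect (cdom c q /\ cube (c q0) (r + r) (c q))) => [[cq _]|nq]; last first.
  have out : \forall z \near (c' q, p), 0 = bump_coord i (cinv c' z.1)
      (covector A c' (cinv c' z.1) z.2).
    have oC := closed_openC (@chart_cube_closed R n M A setT c q0 r KD).
    have hq : nbhs (cinv c' (c' q, p).1)
        (~` [set q' | cdom c q' /\ cube (c q0) (r + r) (c q')]).
      by rewrite zq; apply: open_nbhs_nbhs; split.
    apply: (@filterS _ _ (nbhs_filter (c' q, p)) _ _ _ (cinvq _ hq)) => z hz.
    by rewrite /bump_coord bump_out ?mul0r.
  by apply: near_continuous out _; exact: cst_continuous.
pose G a (z : 'rV[R]_n * 'rV[R]_n) :=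
  pd i (fun y => c' (cinv c y) ord0 a) (c (cinv c' z.1)).
pose N (z : 'rV[R]_n * 'rV[R]_n) := `|c (cinv c' z.1) - c q0|.
have near_chart_coord : \forall z \near (c' q, p), Num.max 0 (1 - r^-1 * N z) *
    (\sum_a z.2 ord0 a * G a z) =
    bump_coord i (cinv c' z.1) (covector A c' (cinv c' z.1) z.2).
  have hq : nbhs (cinv c' (c' q, p).1) (cdom c `&` cdom c').
    by rewrite zq; apply: open_nbhs_nbhs; split=> //; apply: openI; exact: cdom_open.
  apply: (@filterS _ _ (nbhs_filter (c' q, p)) _ _ _ (cinvq _ hq)) => z [cz c'z].
  rewrite /bump_coord bumpE //; congr (_ * _).
  rewrite -pairing_basis_vec (pairing_covector_transition _ _ hc hc' cz c'z) covectorK //.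
  by apply: eq_bigr => a _; rewrite (jac_coord hc hc' cz c'z) -pd_derive.
apply: near_continuous near_chart_coord _.
have cN : {for (c' q, p), continuous N}.
  apply: (@continuous_comp _ _ _ _ (fun p => `|c p - c q0|) _ cinvq).
  by rewrite zq; exact: chart_norm_continuous.
have cG a : {for (c' q, p), continuous (G a)}.
  apply: (@continuous_comp _ _ _ _ (fun p => pd i (fun y => c' (cinv c y) ord0 a) (c p)) _ cinvq).
  rewrite zq; apply: (@continuous_comp _ _ _ _ (pd i (fun y => c' (cinv c y) ord0 a))).
    exact: cmap_continuous.
  have C0 := Ck_pd i (transition_smooth hc hc' a 1%N).
  by apply: (Ck_continuous C0); exists q.
have cmax : {for (c' q, p), continuous (fun z => Num.max 0 (1 - r^-1 * N z))}.
  apply: (@continuous_max _ _ (fun=> 0) (fun z => 1 - r^-1 * N z)); first exact: cst_continuous.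
  apply: continuousB; first exact: cst_continuous.
  by apply: continuousM => //; exact: cst_continuous.
apply: continuousM => //.
apply: (@cvg_sumR _ _ (nbhs (c' q, p)) (nbhs_filter (c' q, p))) => a _.
apply: cvgM; last exact: cG.
by apply: (@continuous_comp _ _ _ snd (fun v : 'rV[R]_n => v ord0 a));
  [exact: cvg_snd | exact: coord_continuous].
Qed.

End bump.

Section moment_bound.
Context {R : realType} {n : nat} {M : topologicalType} {A : manifold R n M}
  {k : nat} (S : subriemannian A k) (cc : bundle (R := R) (n := n) (M := M)).
Hypothesis hcc : is_complement S cc.
Variable mu : M -> probability (borel_rV R n) R.
Hypothesis hmu : adapted S cc mu.
Variables (U : set M) (X : 'I_k -> vfield (R := R) (n := n) (M := M)).
Hypothesis oX : orthonormal_frame S U X.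
Variables (c : chart R n M) (q0 : M).
Hypotheses (hc : atlas A c) (cq0 : cdom c q0) (Uq0 : U q0).
Local Notation B := (borel_rV R n).
Let P q (l : B) := covector_coord A c q (l : 'rV[R]_n).

Let oU : open U. Proof. by case: oX => -[]. Qed.

Let integrable_coord q i : cdom c q -> U q ->
  (mu q).-integrable (cosphere S q : set B) (EFin \o (fun l => P q l ord0 i * P q l ord0 i)).
Proof.
move=> cq Uq.
have := integrable_pairing2 oX hcc hc cq Uq (hmu.1 q) (basis_vec i) (basis_vec i).
apply: eq_integrable => [|l _] /=; last by rewrite !pairing_basis_vec.
exact: (cosphere_measurable_at oX Uq).
Qed.

(** Multiplied by the square of the bump function, the moment is one of the
    functions that are continuous by the definition of an adapted measure; it
    is finite at [q0], and the bump function is at least [1/2] near [q0]. *)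
Lemma moment_coord_bound i : exists m : R, \forall q \near q0, [/\ cdom c q, U q &
  \int[mu q]_(l in (cosphere S q : set B)) (P q l ord0 i * P q l ord0 i) <= m].
Proof.
have [r r0 KD] : exists2 r : R, 0 < r & cube (c q0) (r + r) `<=` c @` (cdom c `&` setT).
  by apply: cube_in_open; [apply: chart_image_open; exact: openT | exists q0].
have hf := hmu.2 _ (bump_coord_continuous hc r0 KD i).
set h := (fun q => _) in hf.
have hE q : cdom c q -> U q -> h q = (bump c q0 r q ^+ 2 *
    \int[mu q]_(l in (cosphere S q : set B)) (P q l ord0 i * P q l ord0 i))%:E.
  move=> cq Uq; have mD := cosphere_measurable_at oX Uq.
  rewrite -RintegralZl ?integrable_coord // /Rintegral fineK; last first.
    by apply: integrable_fin_num => //; apply: integrable_scale => //; exact: integrable_coord.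
  by apply: eq_integral => l _; rewrite /bump_coord exprMn -expr2.
have lt1 : (h q0 < h q0 + 1)%E by rewrite hE // lte_fin ltrDl.
have : \forall q \near q0, (h q < h q0 + 1)%E.
  apply: (hf q0 [set y | (y < h q0 + 1)%E]); apply: open_nbhs_nbhs; split=> //.
  exact: open_ereal_lt_ereal.
have hU : \forall q \near q0, U q by apply: open_nbhs_nbhs.
have := bump_near cq0 r0.
move=> nb nh; exists (4 * (fine (h q0) + 1)).
near=> q.
have [cq b2] : cdom c q /\ 2^-1 <= bump c q0 r q by near: q.
have Uq : U q by near: q.
have : (h q < h q0 + 1)%E by near: q.
rewrite (hE q cq Uq) (hE q0 cq0 Uq0) /= -EFinD lte_fin; set v := _ + 1.
set I := Rintegral _ _ _ => hI; split=> //.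
have I0 : 0 <= I by apply: Rintegral_ge0 => l _; rewrite -expr2 sqr_ge0.
have b4 : 4^-1 <= bump c q0 r q ^+ 2 by nra.
have : 4^-1 * I <= bump c q0 r q ^+ 2 * I by rewrite ler_wpM2r.
by move=> ?; lra.
Unshelve. all: by end_near.
Qed.

End moment_bound.

(** * Locally uniform convergence of the difference quotient *)

Section local_estimate.
Context {R : realType} {n : nat} {M : topologicalType} {A : manifold R n M}
  {k : nat} (S : subriemannian A k) (cc : bundle (R := R) (n := n) (M := M)).
Hypothesis hcc : is_complement S cc.
Variable mu : M -> probability (borel_rV R n) R.
Hypothesis hmu : adapted S cc mu.
Variables (U : set M) (X : 'I_k -> vfield (R := R) (n := n) (M := M)).
Hypothesis oX : orthonormal_frame S U X.
Variable c : chart R n M.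
Hypothesis hc : atlas A c.
Local Notation B := (borel_rV R n).
Let P q (l : B) := covector_coord A c q (l : 'rV[R]_n).
Let oU : open U. Proof. by case: oX => -[]. Qed.

Let Q q (l : B) := 2 + 2 * \sum_i P q l ord0 i * P q l ord0 i.

Let integrable_coord2 q : cdom c q -> U q -> forall i,
  (mu q).-integrable (cosphere S q : set B) (EFin \o (fun l => P q l ord0 i * P q l ord0 i)).
Proof.
move=> cq Uq i.
have := integrable_pairing2 oX hcc hc cq Uq (hmu.1 q) (basis_vec i) (basis_vec i).
apply: eq_integrable => [|l _] /=; last by rewrite !pairing_basis_vec.
exact: (cosphere_measurable_at oX Uq).
Qed.

Let integrable_cst q (a : R) : U q ->
  (mu q).-integrable (cosphere S q : set B) (EFin \o (fun=> a)).
Proof.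
move=> Uq; apply: finite_measure_integrable_cst; exact: (cosphere_measurable_at oX Uq).
Qed.

Let integrable_sum2 q : cdom c q -> U q -> (mu q).-integrable (cosphere S q : set B)
  (EFin \o (fun l => 2 * \sum_i P q l ord0 i * P q l ord0 i)).
Proof.
move=> cq Uq; have mD := cosphere_measurable_at oX Uq.
by apply: integrable_scale => //; apply: integrable_sumr => // i; exact: integrable_coord2.
Qed.

Let integrableQ q : cdom c q -> U q ->
  (mu q).-integrable (cosphere S q : set B) (EFin \o Q q).
Proof.
move=> cq Uq; have mD := cosphere_measurable_at oX Uq.
apply: integrable_add => //; [exact: integrable_cst | exact: integrable_sum2].
Qed.

Lemma moment_bound q0 : cdom c q0 -> U q0 -> exists m : R,
  \forall q \near q0, [/\ cdom c q, U q & \int[mu q]_(l in (cosphere S q : set B)) Q q l <= m].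
Proof.
move=> cq0 Uq0; have /choice[m hm] := moment_coord_bound hcc hmu oX hc cq0 Uq0.
exists (2 + 2 * \sum_i m i).
have h1 : \forall q \near q0, cdom c q by apply: open_nbhs_nbhs; split=> //; exact: cdom_open.
have h2 : \forall q \near q0, U q by apply: open_nbhs_nbhs.
have h3 := @filter_forall _ _ _ _ (nbhs_filter q0) hm.
near=> q.
have cq : cdom c q by near: q.
have Uq : U q by near: q.
have h : forall i, [/\ cdom c q, U q &
  \int[mu q]_(l in (cosphere S q : set B)) (P q l ord0 i * P q l ord0 i) <= m i].
  by near: q.
have mD := cosphere_measurable_at oX Uq.
split=> //; rewrite /Q RintegralD //; [|exact: integrable_cst | exact: integrable_sum2].
rewrite (cosphere_expectation_cst oX Uq (hmu.1 q)).
rewrite RintegralZl //; last by apply: integrable_sumr => // i; exact: integrable_coord2.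
rewrite Rintegral_sumr //; last exact: integrable_coord2.
by rewrite lerD2l ler_wpM2l //; apply: ler_sum => i _; case: (h i).
Unshelve. all: by end_near.
Qed.

(** The remainder of [exp_taylor] is uniform in the base point, up to a factor
    whose mean is locally bounded by [moment_bound]. *)
Lemma local_estimate phi q0 : smooth_on A setT phi -> cdom c q0 -> U q0 ->
  exists2 e : R, 0 < e & exists C : R, \forall q \near q0, [/\ cdom c q, U q &
    forall t, 0 < t < e ->
    `|laplacian_quotient S mu phi t q - chart_laplacian S cc X c phi q| <= C * t].
Proof.
move=> sphi cq0 Uq0.
have [r r0 KD] : exists2 r : R, 0 < r & cube (c q0) (r + r) `<=` c @` (cdom c `&` U).
  by apply: cube_in_open; [exact: chart_image_open | exists q0].
have [e e0 [C C0 hT]] := exp_taylor oX hc r0 KD sphi.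
have [m hm] := moment_bound cq0 Uq0.
exists e => //; exists (k%:R * (2 * C * m)).
have h : {for q0, continuous (fun p => `|c p - c q0|)} := chart_norm_continuous cq0.
rewrite /prop_for /continuous_at subrr normr0 in h.
have h2 : \forall q \near q0, `|c q - c q0| < r by apply: (cvgr_lt _ h).
near=> q.
have [cq Uq hQ] : [/\ cdom c q, U q &
  \int[mu q]_(l in (cosphere S q : set B)) Q q l <= m] by near: q.
have hr : cube (c q0) r (c q) by apply: ltW; near: q.
split=> // t /andP[t0 te].
have mD := cosphere_measurable_at oX Uq.
have E := @expectation_taylor _ _ _ (mu q) (cosphere S q : set B) mD
  (fun a => integrable_cst a Uq) (cosphere_expectation_cst oX Uq (hmu.1 q)) (phi q) t C
  (fun l => phi (sr_exp S q t l)) _ _ (Q q) t0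
  (integrable_flow_derive1 oX hcc hc cq Uq (hmu.1 q) (fun x => phi (cinv c x)))
  (integrable_flow_derive2 oX hcc hc cq Uq (hmu.1 q) (fun x => phi (cinv c x)))
  (integrableQ cq Uq) (expectation_flow_derive1 oX hcc hc cq Uq (hmu.1 q) _).
rewrite -(expectation_flow_derive2 oX hcc hc cq Uq (hmu.1 q)).
rewrite /laplacian_quotient (_ : 2 * k%:R / t ^+ 2 = k%:R * (2 / t ^+ 2)); last by ring.
rewrite -(mulrA k%:R (2 / t ^+ 2)) -mulrBr normrM ger0_norm // -(mulrA k%:R _ t) ler_wpM2l //.
apply: le_trans (E _) _ => [l hl|].
  apply: le_trans (hT q l t cq hr hl _) _; first by rewrite t0 te.
  by apply: ler_wpM2l; [rewrite mulr_ge0 // exprn_ge0 // ltW | exact: sqr_norm_le_sum].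
rewrite -[leRHS]mulrA [m * t]mulrC mulrA; apply: ler_wpM2l => //.
by rewrite !mulr_ge0 // ltW.
Unshelve. all: by end_near.
Qed.

Lemma quotient_cvg phi q : smooth_on A setT phi -> cdom c q -> U q ->
  laplacian_quotient S mu phi t q @[t --> 0^'+] --> chart_laplacian S cc X c phi q.
Proof.
move=> sphi cq Uq; have [e e0 [C /nbhs_singleton[_ _ h]]] := local_estimate sphi cq Uq.
apply/cvgrPdist_lt => d d0; near=> t.
have t0 : 0 < t by near: t; exact: nbhs_right_gt.
have te : t < e by near: t; exact: nbhs_right_lt.
have td : t < d / (`|C| + 1) by near: t; apply: nbhs_right_lt; rewrite divr_gt0 // ltr_wpDl.
rewrite distrC; apply: le_lt_trans (h t _) _; first by rewrite t0.
rewrite ltr_pdivlMr ?ltr_wpDl // in td.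
by have := ler_norm C; nra.
Unshelve. all: by end_near.
Qed.

Lemma microscopic_laplacianE phi q : smooth_on A setT phi -> cdom c q -> U q ->
  microscopic_laplacian S mu phi q = chart_laplacian S cc X c phi q.
Proof. by move=> sphi cq Uq; apply: cvg_lim => //; exact: quotient_cvg. Qed.

End local_estimate.

(** * Derivations and brackets in a chart *)

Section chart_derivations.
Context {R : realType} {n : nat} {M : topologicalType} {A : manifold R n M}.
Implicit Types (X Y : vfield (R := R) (n := n) (M := M)) (f : M -> R) (c : chart R n M).

Lemma lieD_eq_near (V : 'rV[R]_n -> 'rV[R]_n) (f g : 'rV[R]_n -> R) x :
  (\near x, f x = g x) -> lieD V f x = lieD V g x.
Proof. by move=> fg; apply: eq_bigr => i _; rewrite (pd_eq_near i fg). Qed.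

Lemma vderive_chart c q X f : atlas A c -> cdom c q ->
  differentiable (fun x => f (cinv c x)) (c q) ->
  vderive A X f q = lieD (chart_field A c X) (fun x => f (cinv c x)) (c q).
Proof.
move=> hc cq df; rewrite (vderiveE hc cq X df) (derive_pd _ df).
by apply: eq_bigr => i _; rewrite chart_fieldE.
Qed.

Section second.
Variables (c : chart R n M) (U : set M) (X Y : vfield (R := R) (n := n) (M := M)) (f : M -> R).
Hypotheses (hc : atlas A c) (oU : open U) (sY : smooth_vfield A U Y)
  (sf : smooth_Rn (c @` (cdom c `&` U)) (fun x => f (cinv c x))).
Let O := c @` (cdom c `&` U).
Let oO : open O. Proof. exact: chart_image_open. Qed.

Lemma vderive2_chart q : cdom c q -> U q ->
  vderive A X (vderive A Y f) q =
  lieD (chart_field A c X) (lieD (chart_field A c Y) (fun x => f (cinv c x))) (c q).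
Proof.
move=> cq Uq.
have E x : O x -> lieD (chart_field A c Y) (fun x => f (cinv c x)) x = vderive A Y f (cinv c x).
  move=> [p [cp Up] <-]; rewrite cmapK // (vderive_chart _ hc cp) //.
  by apply: smooth_differentiable oO sf _; exists p.
have Oq : O (c q) by exists q.
rewrite (vderive_chart _ hc cq).
  by apply: lieD_eq_near; apply: (open_near oO Oq) => x Ox; rewrite E.
apply: smooth_differentiable oO _ Oq => m; apply: Ck_eq oO E _.
by apply: smooth_lieD => //; exact: (smooth_field_chart sY hc).
Qed.

End second.

(** In the coordinates of the chart itself the coordinate functions are the
    linear ones. *)
Lemma lieD_chart_coord c (V : 'rV[R]_n -> 'rV[R]_n) q l : atlas A c -> cdom c q ->
  lieD V (fun x => c (cinv c x) ord0 l) (c q) = V (c q) ord0 l.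
Proof.
by move=> hc cq; rewrite /lieD -(jac_coordE hc hc cq cq) jac_id.
Qed.

(** The bracket is defined by its action on the coordinate functions of the
    preferred chart, and a field applied to a coordinate function is a component
    of this field. *)
Lemma lie_bracket_chart (U : set M) X Y q : open U -> smooth_vfield A U X ->
  smooth_vfield A U Y -> U q ->
  lie_bracket A X Y q = bracket (chart_field A (chart_at A q) X)
    (chart_field A (chart_at A q) Y) (chart_at A q q).
Proof.
move=> oU sX sY Uq; set c := chart_at A q.
have hc : atlas A c := chart_at_atlas A q; have cq : cdom c q := chart_at_dom A q.
have sl l : smooth_Rn (c @` (cdom c `&` U)) (fun x => c (cinv c x) ord0 l).
  move=> m; apply: Ck_sub (transition_smooth hc hc l m).
  by move=> _ [p [cp _] <-]; exists p.
have nE V l : \forall x \near c q, lieD V (fun x => c (cinv c x) ord0 l) x = V x ord0 l.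
  apply: (@open_near _ _ (c @` (cdom c `&` U))).
  - exact: chart_image_open.
  - by exists q.
  - by move=> _ [p [cp _] <-]; exact: lieD_chart_coord.
apply/rowP => l; rewrite !mxE /= -/c.
rewrite (vderive2_chart _ hc oU sY (f := fun p => c p ord0 l)) //.
rewrite (vderive2_chart _ hc oU sX (f := fun p => c p ord0 l)) //.
rewrite (lieD_eq_near (chart_field A c X) (nE (chart_field A c Y) l)).
by rewrite (lieD_eq_near (chart_field A c Y) (nE (chart_field A c X) l)).
Qed.

End chart_derivations.

Lemma local_frame_reindex {R : realType} {n : nat} {M : topologicalType}
    (A : manifold R n M) (I J : finType) (E : bundle (R := R) (n := n) (M := M)) U
    (X : I -> vfield) (g : J -> I) : bijective g ->
  local_frame A E U X -> local_frame A E U (X \o g).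
Proof.
move=> bg [oU sX bX]; split=> // [j|q Uq]; first exact: sX.
rewrite (perm_basis (Y := [seq X i q | i : I])) ?bX //.
rewrite /image_mem (map_comp (fun i => X i q) g); apply: perm_map.
have [h gh hg] := bg; apply: uniq_perm; last 1 first.
- by move=> i; rewrite mem_enum; apply/mapP; exists (h i); rewrite ?mem_enum.
- rewrite map_inj_uniq; [exact: enum_uniq | exact: (bij_inj bg)].
- exact: enum_uniq.
Qed.

(** * The Laplacian in a frame *)

Section frame_formula.
Context {R : realType} {n : nat} {M : topologicalType} {A : manifold R n M}
  {k : nat} (S : subriemannian A k) (cc : bundle (R := R) (n := n) (M := M)).
Hypothesis hcc : is_complement S cc.

Let wide (j : 'I_k) : 'I_n := widen_ord (ltnW (rank_lt S)) j.

Lemma widen_frame (U : set M) (X : 'I_n -> vfield (R := R) (n := n) (M := M)) :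
  orthonormal_frame S U (fun i : {i : 'I_n | (i < k)%N} => X (val i)) ->
  orthonormal_frame S U (X \o wide).
Proof.
pose g (j : 'I_k) : {i : 'I_n | (i < k)%N} := Sub (wide j) (ltn_ord j).
have bg : bijective g.
  exists (fun i : {i : 'I_n | (i < k)%N} => Ordinal (valP i)) => [j|i].
    exact: val_inj.
  by apply: val_inj; apply: val_inj.
move=> [fX oX]; split; first exact: (local_frame_reindex bg fX).
move=> q Uq i j; rewrite -(inj_eq (bij_inj bg)); exact: (oX q Uq (g i) (g j)).
Qed.

(** In the preferred chart at [q] tangent vectors are their own coordinates.
    The terms of [[X_j, X_i]] with index at least [k] lie in the complement and
    are killed by the projection, which leaves the structural functions of index
    less than [k]. *)
Lemma chart_laplacian_frame (U : set M) (X : 'I_n -> vfield (R := R) (n := n) (M := M))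
    (sc : 'I_n -> 'I_n -> 'I_n -> M -> R) phi q :
  orthonormal_frame S U (X \o wide) ->
  local_frame A cc U (fun i : {i : 'I_n | (k <= i)%N} => X (val i)) ->
  (forall i j q, U q ->
     lie_bracket A (X i) (X j) q = \sum_(l < n) sc i j l q *: X l q) ->
  smooth_on A setT phi -> U q ->
  chart_laplacian S cc (X \o wide) (chart_at A q) phi q =
    \sum_(i < n | (i < k)%N) vderive A (X i) (vderive A (X i) phi) q +
    \sum_(i < n | (i < k)%N) \sum_(j < n | (j < k)%N)
      sc j i j q * vderive A (X i) phi q.
Proof.
move=> oX fC hsc sphi Uq; pose le := ltnW (rank_lt S).
have hc := chart_at_atlas A q; have cq := chart_at_dom A q.
have [[oU sX _] _] := oX.
have sXw i : smooth_vfield A U (X (wide i)) := sX i.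
have sf : smooth_Rn (chart_at A q @` (cdom (chart_at A q) `&` U))
    (fun x => phi (cinv (chart_at A q) x)).
  by move=> m; apply: Ck_sub (sphi _ hc m) => _ [p [cp _] <-]; exists p.
rewrite !(big_ord_narrow le) addrC -big_split /=; apply: eq_bigr => i _.
rewrite (big_ord_narrow le) /= /chart_laplacian; congr (_ + _); last first.
  by rewrite (vderive2_chart _ hc oU (sXw i) sf cq Uq).
apply: eq_bigr => j _; rewrite (vderive_chart _ hc cq); last first.
  have Oq : (chart_at A q @` (cdom (chart_at A q) `&` U)) (chart_at A q q) by exists q.
  exact: (smooth_differentiable (@chart_image_open _ _ _ (chart_at A q) U oU) sf Oq).
congr (_ * _).
rewrite -(lie_bracket_chart oU (sXw j) (sXw i) Uq) jac_chart_at_id hsc //.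
rewrite (bigID (fun l : 'I_n => (l < k)%N)) /= (big_ord_narrow le).
have [sumE capE] := hcc.2 q.
rewrite (coef_unique sumE capE (orthonormal_frame_at oX Uq)) //.
apply: memv_suml => l; rewrite -leqNgt => kl; apply: memvZ.
have [_ _ /(_ q Uq) bC] := fC.
exact: (@basis_image_mem _ _ _ _ (fun i : {i : 'I_n | (k <= i)%N} => X (val i) q)
  (Sub l kl) bC).
Qed.

End frame_formula.

Theorem theorem5 (R : realType) (n k : nat) (M : topologicalType)
    (A : manifold R n M) (S : subriemannian A k)
    (cc : bundle (R := R) (n := n) (M := M)) (hcc : is_complement S cc)
    (mu : M -> probability (borel_rV R n) R) (hmu : adapted S cc mu) :
  [/\ (* the limit exists *)
      forall phi, smooth_on A setT phi -> forall q,
        cvg (laplacian_quotient S mu phi t q @[t --> 0^'+]),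
      (* it depends only on the complement *)
      forall mu' : M -> probability (borel_rV R n) R, adapted S cc mu' ->
        forall phi, smooth_on A setT phi ->
        microscopic_laplacian S mu phi = microscopic_laplacian S mu' phi,
      (* expression in a local frame *)
      forall (U : set M) (X : 'I_n -> vfield (R := R) (n := n) (M := M))
        (sc : 'I_n -> 'I_n -> 'I_n -> M -> R),
        orthonormal_frame S U (fun i : {i : 'I_n | (i < k)%N} => X (val i)) ->
        local_frame A cc U (fun i : {i : 'I_n | (k <= i)%N} => X (val i)) ->
        (forall i j q, U q ->
           lie_bracket A (X i) (X j) q = \sum_(l < n) sc i j l q *: X l q) ->
        forall phi, smooth_on A setT phi -> forall q, U q ->
        microscopic_laplacian S mu phi q =
          \sum_(i < n | (i < k)%N) vderive A (X i) (vderive A (X i) phi) q +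
          \sum_(i < n | (i < k)%N) \sum_(j < n | (j < k)%N)
            sc j i j q * vderive A (X i) phi q &
      (* uniform convergence on compact sets *)
      forall phi, smooth_on A setT phi -> forall K : set M, compact K ->
        {uniform K, (fun t => laplacian_quotient S mu phi t) @ 0^'+ -->
                    microscopic_laplacian S mu phi} ].
Proof.
have hc q : atlas A (chart_at A q) := chart_at_atlas A q.
have cq q : cdom (chart_at A q) q := chart_at_dom A q.
split.
- move=> phi sphi q; have [U [X [Uq oX]]] := exists_orthonormal_frame S q.
  apply/cvg_ex; exists (chart_laplacian S cc X (chart_at A q) phi q).
  exact: (quotient_cvg hcc hmu oX (hc q) sphi (cq q) Uq).
- move=> mu' hmu' phi sphi; apply/funext => q.
  have [U [X [Uq oX]]] := exists_orthonormal_frame S q.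
  rewrite (microscopic_laplacianE hcc hmu oX (hc q) sphi (cq q) Uq).
  by rewrite (microscopic_laplacianE hcc hmu' oX (hc q) sphi (cq q) Uq).
- move=> U X sc oX fC hsc phi sphi q Uq; have oX' := widen_frame oX.
  rewrite (microscopic_laplacianE hcc hmu oX' (hc q) sphi (cq q) Uq).
  exact: (chart_laplacian_frame hcc oX' fC hsc sphi Uq).
- move=> phi sphi K cK P /uniform_nbhs[E [entE EP]].
  have [d /= d0 dE] : exists2 d : R, 0 < d & forall x y, `|x - y| < d -> E (x, y).
    move: entE; rewrite -entourage_ballE => -[d /= d0 dE]; exists d => // x y xy.
    by apply: dE; rewrite /= -ball_normE.
  pose close t q := `|microscopic_laplacian S mu phi q - laplacian_quotient S mu phi t q| < d.
  suff : \forall t \near 0^'+, K `<=` close t.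
    by apply: filterS => t ht; apply: EP => q Kq; apply: dE; exact: ht.
  apply: ((compact_near_coveringP K).1 cK R 0^'+ close) => q0 _.
  have [U [X [Uq0 oX]]] := exists_orthonormal_frame S q0.
  have [e e0 [C hC]] := local_estimate hcc hmu oX (hc q0) sphi (cq q0) Uq0.
  have tsmall : \forall t \near (0 : R)^'+, 0 < t < e /\ t * (`|C| + 1) < d.
    near=> t; split.
      by apply/andP; split; near: t; [exact: nbhs_right_gt | exact: nbhs_right_lt].
    rewrite -ltr_pdivlMr ?ltr_wpDl //; near: t; apply: nbhs_right_lt.
    by rewrite divr_gt0 // ltr_wpDl.
  exists ([set q | [/\ cdom (chart_at A q0) q, U q & forall t, 0 < t < e ->
      `|laplacian_quotient S mu phi t q -
        chart_laplacian S cc X (chart_at A q0) phi q| <= C * t]],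
    [set t | 0 < t < e /\ t * (`|C| + 1) < d]).
    by split; [exact: hC | exact: tsmall].
  move=> [q t] /= [[cq' Uq h] [ht td]]; rewrite /close distrC.
  rewrite (microscopic_laplacianE hcc hmu oX (hc q0) sphi cq' Uq).
  apply: le_lt_trans (h t ht) _; apply: le_lt_trans td.
  have /andP[t0 _] := ht; rewrite mulrC ler_wpM2l ?(ltW t0) //.
  by apply: le_trans (ler_norm C) _; rewrite lerDl.
Unshelve. all: by end_near.
Qed.
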